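(* Let $\beta>1$ be a real number. Then: (i) the set $\{x\in[0,1):\hat{r}_\beta(x)=0\}$ has full Lebesgue measure in $[0,1)$; (ii) for every $\hat{r}$ with $1<\hat{r}\leq+\infty$, the set $\{x\in[0,1):\hat{r}_\beta(x)\geq\hat{r}\}$ is countable; (iii) for every real $\hat{r}$ with $0\leq\hat{r}\leq 1$, $$\dim_{\mathrm{H}}\{x\in[0,1):\hat{r}_\beta(x)\geq\hat{r}\}=\dim_{\mathrm{H}}\{x\in[0,1):\hat{r}_\beta(x)=\hat{r}\}=\left(\frac{1-\hat{r}}{1+\hat{r}}\right)^2.$$
   Context: For real $\beta>1$, the $\beta$-transformation $T_\beta:[0,1)\to[0,1)$ is $T_\beta(x)=\beta x \bmod 1=\beta x-\lfloor\beta x\rfloor$, and $T_\beta^n$ denotes its $n$-th iterate. For $x\in[0,1)$ the uniform recurrence exponent is $$\hat{r}_\beta(x):=\sup\{0\leq\hat{r}\leq+\infty:\ \text{for all sufficiently large integers } N \text{ there is an integer } n\in[1,N] \text{ with } |T_\beta^n x-x|<(\beta^N)^{-\hat{r}}\}\in[0,+\infty].$$ $\dim_{\mathrm{H}}$ denotes Hausdorff dimension. ''Countable'' means finite or countably infinite. *)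

(* Defs.v *)
From HB Require Import structures.
From mathcomp Require Import all_boot all_order all_algebra.
From mathcomp Require Import all_classical all_reals all_analysis.

Set Implicit Arguments.
Unset Strict Implicit.
Unset Printing Implicit Defensive.

Import Order.TTheory GRing.Theory Num.Theory.
Import numFieldNormedType.Exports.

Local Open Scope classical_set_scope.
Local Open Scope ring_scope.

(* Only the restriction of this total function to [0, 1[, which it maps to
   itself, is meaningful. *)
Definition beta_transformation (R : realType) (beta x : R) : R :=
  beta * x - (Num.floor (beta * x))%:~R.

(* b ^ (- r) for b > 1 and an extended exponent r, so that b ^ (- +oo) = 0. *)
Definition inv_power (R : realType) (b : R) (r : \bar R) : \bar R :=
  match r with
  | r'%:E => (b `^ (- r'))%:E
  | +oo => 0
  | -oo => +oo
  end%E.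

Definition uniform_recurrence_exponent (R : realType) (beta x : R) : \bar R :=
  ereal_sup [set r : \bar R | (0 <= r)%E /\
    \forall N \near \oo, exists n : nat, (1 <= n <= N)%N /\
      (`|iter n (beta_transformation beta) x - x|%:E
         < inv_power (beta ^+ N) r)%E].

(* The diameter of the empty set is -oo here, hence the case distinction in
   [diam_power]. *)
Definition diam (R : realType) (A : set R) : \bar R :=
  ereal_sup [set d : \bar R | exists x y : R,
    [/\ A x, A y & d = `|x - y|%:E]].

(* For s = 0 this is 1 on every nonempty bounded set, singletons included,
   since 0 `^ 0 = 1. *)
Definition diam_power (R : realType) (s : R) (A : set R) : \bar R :=
  if A == set0 then 0%E else (diam A `^ s)%E.

(* Finite covers are covered by this definition, as some of the U i may be
   empty. *)
Definition hausdorff_premeasure (R : realType) (s delta : R) (A : set R) :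
    \bar R :=
  ereal_inf [set v : \bar R | exists U : nat -> set R,
    [/\ forall i, (diam (U i) <= delta%:E)%E,
        A `<=` \bigcup_i U i
      & v = (\sum_(0 <= i <oo) diam_power s (U i))%E]].

Definition hausdorff_measure (R : realType) (s : R) (A : set R) : \bar R :=
  ereal_sup [set v : \bar R | exists2 delta : R, 0 < delta &
    v = hausdorff_premeasure s delta A].

Definition hausdorff_dim (R : realType) (A : set R) : \bar R :=
  ereal_inf [set v : \bar R | exists s : R,
    [/\ 0 <= s, hausdorff_measure s A = 0%E & v = s%:E]].

(* Main.v *)
Require Import Defs.
From HB Require Import structures.
From mathcomp Require Import all_boot all_order all_algebra.
From mathcomp Require Import all_classical all_reals all_analysis.
From mathcomp Require Import ring lra zify.

Set Implicit Arguments.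
Unset Strict Implicit.
Unset Printing Implicit Defensive.

Import Order.TTheory GRing.Theory Num.Theory.
Import numFieldNormedType.Exports.

Local Open Scope classical_set_scope.
Local Open Scope ring_scope.

(** Why the theorem holds.  On each of its branches [T^n] is affine with slope
    [beta^n], so the points with [|T^n x - x| < beta^-L] form one interval of
    length about [beta^-(n + L)] per branch.  In terms of digits, such a return
    says that the first [n + L] digits of [x] are determined by the first [n].
    A point of exponent at least [r] has a sequence of first return times
    [n_k], with agreement lengths [L_k >= r n_(k+1)]: digits may be chosen
    freely only in the gaps between [n_k + L_k] and [n_(k+1)].

    Upper bound.  Let [F] be the number of free digits used so far.  If
    [F >= s (n_k + L_k)] at every stage, with [s > ((1 - r) / (1 + r))^2], then
    [F / n] drops by a fixed amount at each gap: this is the negativity of the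
    discriminant of a quadratic polynomial.  Since [0 <= F / n <= 1], after a
    bounded number of scales [X, theta X, theta^2 X, ...] some stage has
    [F < s (n_k + L_k)].  There, about [beta^F] intervals of length
    [beta^-(n_k + L_k)] suffice, up to a factor polynomial in [X]
    ([coverable_state], [coverable_recurrent]).  No coding by digits is used:
    left endpoints of branches that appear at step [i] are [beta^-i]-separated,
    and hence an interval [J] meets at most polynomially many branches of [T^n]
    for each [beta^-n] of its length ([return_cover]).  These covers have
    arbitrarily small cost; since [s < 1] is allowed when [r > 0], they also show
    that the points of positive exponent are Lebesgue negligible, which is (i).

    Exponent above 1.  Two first returns [n < n'], where the distance at time
    [n] is much less than [beta^-n'], allow [T^(n + n') x] to be computed in two
    ways, as in the theorem of Fine and Wilf.  The results disagree unless the
    orbit is periodic ([no_two_fast_returns]), and there are only countably many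
    periodic points, which proves (ii).

    Lower bound.  Full branches of some iterate [T^l] give an alphabet of
    [M >= beta^(l (1 - eps))] letters that may follow one another in any order
    ([alphabet_exists]).  Points are written with this alphabet, with copies of
    the prefix of length [L_k ~ r n_(k+1)] at the places
    [n_k ~ 10 (2 / (1 - r))^k] and free letters between them; then the exponent
    is at least [r].  Each copy is followed by a run of zeros that is longer
    than all previous ones.  A return that lasted longer than [L_k] would
    reproduce this run too early, so the exponent is exactly [r]
    ([coded_exponent]).  The map that reads off the free letters as the digits
    of a real number is Hoelder with any exponent [s < ((1 - r) / (1 + r))^2] and
    maps onto the unit interval, which bounds the Hausdorff measure from below
    ([embed_hoelder], [hausdorff_measure_neq0]). *)

(** * Branches of the iterates *)

Section Dynamics.
Context (R : realType) (b : R) (hb : 1 < b).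
Local Notation T := (beta_transformation b).

Lemma base_gt0 : 0 < b. Proof. exact: lt_trans hb. Qed.
Local Hint Resolve base_gt0 : core.

Lemma beta_transformation_itv (x : R) : 0 <= T x < 1.
Proof.
rewrite /beta_transformation; have := floor_itv (b * x).
rewrite intrD; lra.
Qed.

Lemma iter_itv n (x : R) : 0 <= x < 1 -> 0 <= iter n T x < 1.
Proof. by case: n => [//|n] _; exact: beta_transformation_itv. Qed.

Lemma beta_transformation_small (x : R) : 0 <= b * x < 1 -> T x = b * x.
Proof.
move=> hx; rewrite /beta_transformation (@floor_def _ _ 0) ?subr0 //.
Qed.

(** Moving down from [x] never meets a discontinuity of [T^n] before [T^n]
    reaches [0]: the branches of [T^n] are increasing and start at the value
    [0]. *)
Lemma iter_down n (x t : R) : 0 <= x < 1 -> 0 <= t <= iter n T x ->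
  iter n T (x - t / b ^+ n) = iter n T x - t.
Proof.
move=> hx; elim: n t => [|n IH] t /= ht; first by rewrite expr0 divr1.
set u := iter n T x in IH ht *.
have hu : 0 <= u < 1 by exact: iter_itv.
have hf : 0 <= (Num.floor (b * u))%:~R :> R.
  by rewrite ler0z floor_ge0 mulr_ge0 ?(ltW base_gt0) //; lra.
have -> : x - t / b ^+ n.+1 = x - (t / b) / b ^+ n.
  by rewrite exprS invfM mulrA.
have h1 : t <= b * u - (Num.floor (b * u))%:~R by case/andP: ht.
rewrite IH; last first.
  apply/andP; split; first by rewrite divr_ge0 ?(ltW base_gt0) //; lra.
  rewrite ler_pdivrMr //; lra.
rewrite /beta_transformation mulrBr mulrC -[b * (t / b)]mulrCA divff ?gt_eqF //.
rewrite mulr1 (mulrC u).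
rewrite (@floor_def _ (b * u - t) (Num.floor (b * u))); first by ring.
have := floor_itv (b * u); rewrite intrD; lra.
Qed.

Lemma iter_left_endpoint n (x : R) : 0 <= x < 1 ->
  iter n T (x - iter n T x / b ^+ n) = 0.
Proof.
move=> hx; rewrite iter_down ?subrr // lexx andbT.
by case/andP: (iter_itv n hx).
Qed.

Lemma left_endpoint_itv n (x : R) : 0 <= x < 1 ->
  0 <= x - iter n T x / b ^+ n < 1.
Proof.
move=> hx; have hn := iter_itv n hx.
have hbn : 0 < b ^+ n by rewrite exprn_gt0.
apply/andP; split; last first.
  have : 0 <= iter n T x / b ^+ n by rewrite divr_ge0 ?(ltW hbn) //; lra.
  lra.
rewrite subr_ge0 ler_pdivrMr //.
elim: n {hn hbn} => [|n IH] /=; first by rewrite expr0 mulr1.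
have h := iter_itv n hx.
have hf : 0 <= (Num.floor (b * iter n T x))%:~R :> R.
  by rewrite ler0z floor_ge0 mulr_ge0 ?(ltW base_gt0) //; lra.
rewrite {1}/beta_transformation exprS.
apply: (@le_trans _ _ (b * iter n T x)); first by lra.
by rewrite mulrCA ler_pM2l.
Qed.

Lemma iter_zero n : iter n T 0 = 0.
Proof. by elim: n => //= n ->; rewrite /beta_transformation mulr0 floor0 subr0. Qed.

(** The left endpoints of the branches of [T^n], sorted by the first iterate
    that sends them to [0]. *)
Definition new_endpoint (i : nat) (y : R) : Prop :=
  [/\ 0 <= y < 1, iter i T y = 0 & forall j, (j < i)%N -> iter j T y != 0].

Lemma new_endpoint_exists n (y : R) : 0 <= y < 1 -> iter n T y = 0 ->
  exists2 i, (i <= n)%N & new_endpoint i y.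
Proof.
move=> hy hn.
have ex : exists i, iter i T y == 0 by exists n; rewrite hn.
exists (ex_minn ex); first by case: ex_minnP => m _; apply; rewrite hn.
case: ex_minnP => m /eqP hm hmin; split=> // j hj.
by apply/negP => /hmin; rewrite leqNgt hj.
Qed.

Lemma new_endpoint_int i y : new_endpoint i.+1 y ->
  exists2 k : nat, (0 < k)%N & b * iter i T y = k%:R.
Proof.
case=> hy hi hj; have hu := iter_itv i hy.
have h0 : iter i T y != 0 by exact: hj.
have hg0 : 0 < b * iter i T y by rewrite mulr_gt0 // lt_def h0; case/andP: hu.
have hf : (0 <= Num.floor (b * iter i T y))%R by rewrite floor_ge0 ltW.
have heq : b * iter i T y = (Num.floor (b * iter i T y))%:~R.
  by apply/eqP; rewrite -subr_eq0; apply/eqP.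
exists `|Num.floor (b * iter i T y)|%N.
  rewrite lt0n absz_eq0; apply/eqP => h.
  by move: heq; rewrite h => heq; rewrite heq ltxx in hg0.
by rewrite pmulrn gez0_abs.
Qed.

(** [T^(i-1)] is nonzero and a multiple of [1 / b] at an endpoint of exact
    order [i], so there is a whole branch of [T^i] of length [b^-i] on its
    left. *)
Lemma new_endpoint_full i (y t : R) : new_endpoint i.+1 y -> 0 < t <= 1 ->
  iter i.+1 T (y - t / b ^+ i.+1) = 1 - t.
Proof.
move=> hy ht; have [k k0 hk] := new_endpoint_int hy.
have [hy1 _ _] := hy.
have hk1 : 1 <= b * iter i T y by rewrite hk ler1n.
have -> : y - t / b ^+ i.+1 = y - (t / b) / b ^+ i.
  by rewrite exprS invfM mulrA.
rewrite iterS iter_down //; last first.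
  apply/andP; split; first by rewrite divr_ge0 ?(ltW base_gt0) //; lra.
  rewrite ler_pdivrMr // mulrC; lra.
rewrite /beta_transformation mulrBr hk mulrCA divff ?gt_eqF // mulr1.
rewrite (@floor_def _ _ (k%:Z - 1)) ?intrB -?pmulrn; first by ring.
rewrite subrK -!pmulrn; lra.
Qed.

Lemma new_endpoint_sep i (y y' : R) : new_endpoint i y -> new_endpoint i y' ->
  y' < y -> b ^- i <= y - y'.
Proof.
move=> hy hy' hlt; case: i hy hy' => [|i] hy hy'.
  by case: hy hy' => [_ /= h _] [_ /= h' _]; rewrite h h' ltxx in hlt.
rewrite leNgt; apply/negP => hc.
have hbi : 0 < b ^+ i.+1 by rewrite exprn_gt0.
have := @new_endpoint_full i y ((y - y') * b ^+ i.+1) hy.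
have h1 : (y - y') * b ^+ i.+1 < 1 by rewrite -ltr_pdivlMr // mul1r.
have h0 : 0 < (y - y') * b ^+ i.+1 by rewrite mulr_gt0 // subr_gt0.
rewrite mulfK ?gt_eqF // subKr; case: hy' => _ -> _ h.
by move: (h ltac:(lra)); lra.
Qed.

Lemma new_endpoint_floor_inj i (y y' : R) : new_endpoint i y -> new_endpoint i y' ->
  Num.floor (b ^+ i * y) = Num.floor (b ^+ i * y') -> y = y'.
Proof.
have hbi : 0 < b ^+ i by rewrite exprn_gt0.
suff main z z' : new_endpoint i z -> new_endpoint i z' -> z' < z ->
    Num.floor (b ^+ i * z) = Num.floor (b ^+ i * z') -> False.
  move=> hy hy' hf; apply/eqP; rewrite eq_le !leNgt; apply/andP.
  by split; apply/negP => h; [apply: (main _ _ hy hy')|apply: (main _ _ hy' hy)].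
move=> hz hz' hlt hf.
have := new_endpoint_sep hz hz' hlt.
rewrite -[b ^- i]mul1r ler_pdivrMr // mulrBl ![_ * b ^+ i]mulrC => h.
have := floor_itv (b ^+ i * z); have := floor_itv (b ^+ i * z').
by rewrite hf intrD; lra.
Qed.

(** At a discontinuity [T] drops from [1] to [0].  So when two nearby points
    leave their common branch, at a first time [j], the upper one is thrown near
    [0], where it stays as long as the expansion of its distance to [0] permits,
    and the lower one is thrown near [1]. *)
Lemma crossing m (u v : R) : 0 <= u -> u < v -> v < 1 -> b ^+ m * (v - u) < 1 ->
  iter m T v - iter m T u = b ^+ m * (v - u) \/
  exists j, [/\ (j < m)%N,
    forall i, (i <= j)%N -> iter i T v - iter i T u = b ^+ i * (v - u),
    1 <= b * iter j T v,
    iter j.+1 T u >= 1 - b ^+ j.+1 * (v - u) &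
    forall i, (j < i <= m)%N -> iter i T v < b ^+ i * (v - u)].
Proof.
move=> u0 uv v1.
suff main : b ^+ m * (v - u) < 1 ->
  (forall i, (i <= m)%N -> iter i T v - iter i T u = b ^+ i * (v - u)) \/
  exists j, [/\ (j < m)%N,
    forall i, (i <= j)%N -> iter i T v - iter i T u = b ^+ i * (v - u),
    1 <= b * iter j T v,
    iter j.+1 T u >= 1 - b ^+ j.+1 * (v - u) &
    forall i, (j < i <= m)%N -> iter i T v < b ^+ i * (v - u)].
  by move=> /main[h|h]; [left; exact: h|right].
have TE w : T w = b * w - (Num.floor (b * w))%:~R by [].
elim: m => [|m IH] hm.
  by left => i; rewrite leqn0 => /eqP -> /=; rewrite expr0 mul1r.
have hd : 0 < b ^+ m * (v - u) by rewrite mulr_gt0 ?exprn_gt0 ?subr_gt0.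
have hmS : b ^+ m.+1 * (v - u) = b * (b ^+ m * (v - u)) by rewrite exprS mulrA.
have hm' : b ^+ m * (v - u) < 1.
  apply: le_lt_trans hm; rewrite hmS ler_peMl ?(ltW hd) //; exact: ltW.
have hu : 0 <= iter m T u < 1 by apply: iter_itv; lra.
have hv : 0 <= iter m T v < 1 by apply: iter_itv; lra.
have [hl|[j [jm h1 h2 h3 h4]]] := IH hm'; last first.
  right; exists j; split=> //; first exact: ltnW.
  move=> i /andP[ji]; rewrite leq_eqVlt => /predU1P[->|im]; last first.
    by apply: h4; rewrite ji.
  have h5 : iter m T v < b ^+ m * (v - u) by apply: h4; rewrite jm leqnn.
  have hs : 0 <= b * iter m T v < 1.
    apply/andP; split; first by rewrite mulr_ge0 ?(ltW base_gt0) //; lra.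
    by apply: lt_trans hm; rewrite hmS ltr_pM2l.
  by rewrite iterS (beta_transformation_small hs) hmS ltr_pM2l.
have hlm := hl m (leqnn m).
have hlin : b * iter m T v = b * iter m T u + b * (b ^+ m * (v - u)).
  by rewrite -hlm; ring.
have hfu := floor_itv (b * iter m T u); have hfv := floor_itv (b * iter m T v).
rewrite !intrD in hfu hfv.
have [e|ne] := eqVneq (Num.floor (b * iter m T v)) (Num.floor (b * iter m T u)).
  left => i; rewrite leq_eqVlt => /predU1P[->|im]; last exact: hl.
  rewrite !iterS hmS !TE e hlin.
  by ring.
have le_f : (Num.floor (b * iter m T u) <= Num.floor (b * iter m T v))%R.
  apply: le_floor; rewrite hlin lerDl; apply: ltW; rewrite mulr_gt0 //.
have hS : (Num.floor (b * iter m T u))%:~R + 1 <=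
          (Num.floor (b * iter m T v))%:~R :> R.
  rewrite -intrD1 ler_int lezD1 lt_def ne //.
right; exists m; split=> //.
- apply: le_trans (andP hfv).1; apply: le_trans hS; rewrite lerDr ler0z floor_ge0.
  by rewrite mulr_ge0 ?(ltW base_gt0) //; lra.
- rewrite hmS iterS TE; lra.
- move=> i hi; have -> : i = m.+1 by apply/eqP; rewrite eqn_leq andbC.
  rewrite hmS iterS TE; lra.
Qed.

End Dynamics.

(** * Covering the points that return at a given time *)
Section ReturnCover.
Context (R : realType) (b : R) (hb : 1 < b).
Local Notation T := (beta_transformation b).

(** An interval meets few branches of [T^n]: their left endpoints of exact
    order [i <= n] are separated by [b^-i].  On each branch [T^n x - x] is
    affine with slope [b^n - 1]. *)
Lemma return_cover n (z w e : R) : (0 < n)%N -> 0 <= w ->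
  exists c : seq R,
    (size c)%:R <= n.+1%:R * (2 * w * b ^+ n + 4) /\
    forall x, 0 <= x < 1 -> `|x - z| <= w -> `|iter n T x - x| <= e ->
      exists2 t, t \in c & `|x - t| <= e / (b ^+ n - 1).
Proof.
move=> n0 w0.
have b0 := base_gt0 hb.
have hbn : 0 < b ^+ n by rewrite exprn_gt0.
have hbn1 : 1 < b ^+ n by rewrite exprn_egt1 // -lt0n.
pose a i := Num.floor (b ^+ i * (z - w - b ^- n)).
pose len := (Num.truncn (2 * w * b ^+ n + 2)).+1.
pose pick i (m : nat) := xget 0 [set y | new_endpoint b i y /\
  Num.floor (b ^+ i * y) = a i + m%:Z].
pose ctr i m := b ^+ n * pick i m / (b ^+ n - 1).
have hwb : 0 <= 2 * w * b ^+ n by rewrite !mulr_ge0 // ltW.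
exists [seq ctr i m | i <- iota 0 n.+1, m <- iota 0 len]; split.
  rewrite size_allpairs !size_iota natrM ler_pM2l ?ltr0n //.
  have h := truncn_itv (ltac:(lra) : 0 <= 2 * w * b ^+ n + 2).
  rewrite /len -natr1; lra.
move=> x hx hxz hxe.
pose y := x - iter n T x / b ^+ n.
have hy : 0 <= y < 1 by exact: left_endpoint_itv.
have hTn : 0 <= iter n T x < 1 by exact: iter_itv.
have [i hin hyi] := new_endpoint_exists hy (iter_left_endpoint hb n hx).
have hbi : 0 < b ^+ i by rewrite exprn_gt0.
have hbin : b ^+ i <= b ^+ n by rewrite ler_eXn2l.
have hq : 0 <= iter n T x / b ^+ n <= b ^- n.
  apply/andP; split; first by rewrite divr_ge0 ?(ltW hbn) //; lra.
  by rewrite -[leRHS]mul1r ler_pM2r ?invr_gt0 //; lra.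
have hyz : 0 <= y - (z - w - b ^- n) <= 2 * w + b ^- n.
  by move: hxz; rewrite ler_norml /y; lra.
have ha : a i <= Num.floor (b ^+ i * y).
  by apply: le_floor; rewrite ler_pM2l //; lra.
pose m := `|Num.floor (b ^+ i * y) - a i|%N.
have hm : Num.floor (b ^+ i * y) = a i + m%:Z.
  by rewrite /m gez0_abs ?subr_ge0 //; ring.
have hmlen : (m < len)%N.
  have h1 : b ^+ i * (y - (z - w - b ^- n)) <= 2 * w * b ^+ n + 1.
    apply: (@le_trans _ _ (b ^+ n * (2 * w + b ^- n))).
      by apply: ler_pM => //; [exact: ltW|case/andP: hyz|case/andP: hyz].
    by rewrite mulrDr divff ?gt_eqF //; lra.
  rewrite /len ltnS truncn_ge_nat; last by lra.
  have := floor_itv (b ^+ i * y); rewrite hm !intrD -pmulrn.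
  have := floor_itv (b ^+ i * (z - w - b ^- n)); rewrite -/(a i) intrD.
  rewrite mulrBr in h1; lra.
have hp : pick i m = y.
  have [h1 h2] : [set y | new_endpoint b i y /\
      Num.floor (b ^+ i * y) = a i + m%:Z] (pick i m).
    by apply: (@xgetPex _ 0); exists y.
  by apply: (new_endpoint_floor_inj hb h1 hyi); rewrite h2 hm.
exists (ctr i m); first by apply: allpairs_f; rewrite mem_iota //= add0n.
rewrite /ctr hp.
have -> : x - b ^+ n * y / (b ^+ n - 1) = (iter n T x - x) / (b ^+ n - 1).
  by rewrite /y; field; rewrite !gt_eqF //= subr_gt0.
have hd : 0 < b ^+ n - 1 by rewrite subr_gt0.
by rewrite normrM normfV (gtr0_norm hd) ler_pM2r ?invr_gt0.
Qed.

End ReturnCover.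

(** * The proportion of free digits *)
Section Potential.
Context (R : realType).

(** The quadratic polynomial compares the ratio [F / n] before and after a jump
    of the return time, in the worst case.  With [rho = r / theta], its
    discriminant is negative exactly when [sqrt s] lies strictly between
    [(1 - rho) / (1 + rho)] and [1], so [theta] has to be close to [1]. *)
Lemma discriminant_gap (r s : R) : 0 < r < 1 -> s < 1 ->
  ((1 - r) / (1 + r)) ^+ 2 < s ->
  exists theta c : R, [/\ 1 < theta, 0 < c & forall a,
    c <= a ^+ 2 - a * (s + 1 - r / theta + r / theta * s) + s].
Proof.
move=> hr s1 hs.
have s0 : 0 < s by apply: le_lt_trans hs; exact: sqr_ge0.
pose q := Num.sqrt s.
have q0 : 0 < q by rewrite sqrtr_gt0.
have q2 : q ^+ 2 = s by rewrite sqr_sqrtr // ltW.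
have q1 : q < 1 by rewrite -sqrtr1 ltr_sqrt.
have hq : (1 - r) / (1 + r) < q.
  rewrite -(@ltr_pXn2r _ 2) ?q2 // nnegrE ?divr_ge0 //; lra.
have hr0 : (1 - q) / (1 + q) < r.
  move: hq; rewrite !ltr_pdivrMr; lra.
pose rho := ((1 - q) / (1 + q) + r) / 2.
have p0 : 0 < (1 - q) / (1 + q) by rewrite divr_gt0 //; lra.
have hrho : (1 - q) / (1 + q) < rho < r by rewrite /rho; lra.
have hrho0 : 0 < rho by lra.
have hk : 1 - q < rho * (1 + q).
  by rewrite -ltr_pdivrMr //; lra.
exists (r / rho), (s - (s + 1 - rho + rho * s) ^+ 2 / 4); split.
- by rewrite ltr_pdivlMr //; lra.
- have h1 : 0 < s + 1 - rho + rho * s.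
    have : 0 < rho * s by rewrite mulr_gt0.
    lra.
  have h2 : s + 1 - rho + rho * s < 2 * q.
    have : 0 < (1 - q) * (rho * (1 + q) - (1 - q)) by rewrite mulr_gt0; lra.
    rewrite -q2; nra.
  have : (s + 1 - rho + rho * s) ^+ 2 < (2 * q) ^+ 2.
    by rewrite ltr_pXn2r // nnegrE; lra.
  by rewrite exprMn q2; lra.
- move=> a; have -> : r / (r / rho) = rho by field; rewrite !gt_eqF //=; lra.
  have := sqr_ge0 (a - (s + 1 - rho + rho * s) / 2); rewrite !expr2; lra.
Qed.

Section Step.
Context (r s theta c : R) (hr : 0 < r < 1) (hs : 0 < s < 1) (htheta : 1 < theta)
  (hc : 0 < c) (hgap : forall a,
    c <= a ^+ 2 - a * (s + 1 - r / theta + r / theta * s) + s).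

(** [F] counts the digits that have been chosen freely among the first
    [n + r * X], all of which are known when [T^n x] returns to within
    [b^-(r X)] of [x].  As long as the proportion of free digits is at least
    [s], a jump from [n] to [n'] that creates free digits lowers [F / n] by a
    fixed amount. *)
Lemma free_ratio_step (n F X n' : R) :
  0 < n -> F <= n -> s * (n + r * X) <= F -> n <= X -> n <= n' ->
  n' <= theta * X ->
  let F' := F + Num.max 0 (n' - (n + r * X)) in
  F' <= n' /\ ((F' = F /\ F' / n' <= F / n) \/
    (F' / n' <= F / n - c /\ F' <= F * (theta / (s * r)))).
Proof.
have [hr' hs' ht' hc'] := And4 hr hs htheta hc.
move=> n0 Fn hF nX nn' n'X /=.
have X0 : 0 < X by lra.
have rX0 : 0 < r * X by rewrite mulr_gt0 //; lra.
have n'0 : 0 < n' by lra.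
have sn0 : 0 < s * (n + r * X) by rewrite mulr_gt0; lra.
have F0 : 0 < F by lra.
have [h|h] := leP (n' - (n + r * X)) 0.
  rewrite addr0; split; first by lra.
  left; split=> //.
  by rewrite ler_pM2l // lef_pV2 // posrE.
have h1 : F + (n' - (n + r * X)) <= n' by lra.
split=> //; right; split; last first.
  rewrite mulrA ler_pdivlMr; last by rewrite mulr_gt0; lra.
  apply: (@le_trans _ _ (n' * (s * r))).
    by rewrite ler_pM2r // mulr_gt0; lra.
  apply: (@le_trans _ _ (theta * X * (s * r))).
    by rewrite ler_pM2r // mulr_gt0; lra.
  have -> : theta * X * (s * r) = theta * (s * (r * X)) by ring.
  rewrite mulrC ler_pM2r; last by lra.
  apply: le_trans hF; rewrite ler_pM2l; lra.
(* In units of [n]: a = F/n, q = n'/n, y = rX/n, so that y >= rho q. *)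
set a := F / n; pose q := n' / n; pose y := r * X / n.
have ni : 0 < n^-1 by rewrite invr_gt0.
have a1 : a <= 1 by rewrite ler_pdivrMr // mul1r.
have y0 : 0 < y by rewrite divr_gt0.
have q0 : 0 < q by rewrite divr_gt0.
pose rho := r / theta.
have rho0 : 0 < rho by rewrite divr_gt0; lra.
have hyq : rho * q <= y.
  rewrite /rho /q /y mulrA ler_pM2r // -mulrA (mulrC _ n') mulrA.
  by rewrite ler_pdivrMr; last lra; rewrite -mulrA ler_pM2l; lra.
have hay : s * (1 + y) <= a.
  rewrite /a ler_pdivlMr // /y; apply: le_trans hF.
  have -> // : s * (1 + r * X / n) * n = s * (n + r * X).
  by field; rewrite gt_eqF.
have -> : (F + (n' - (n + r * X))) / n' = 1 - (1 - a + y) / q.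
  by rewrite /a /y /q; field; rewrite !gt_eqF.
have hsy : 0 < s * y by rewrite mulr_gt0; lra.
have has : 0 < a - s by lra.
(* 1/q >= rho/y and 1/y >= s/(a-s) *)
have h2 : (1 - a + y) * (rho / y) <= (1 - a + y) / q.
  rewrite ler_pM2l; last by lra.
  by rewrite ler_pdivrMr // mulrC ler_pdivlMr.
have h3 : rho + rho * (1 - a) * s / (a - s) <= (1 - a + y) * (rho / y).
  have -> : (1 - a + y) * (rho / y) = rho + rho * (1 - a) / y.
    by field; rewrite gt_eqF.
  rewrite lerD2l -mulrA; apply: ler_wpM2l; first by rewrite mulr_ge0; lra.
  by rewrite ler_pdivrMr // mulrC ler_pdivlMr //; lra.
have h4 : c <= a - 1 + (rho + rho * (1 - a) * s / (a - s)).
  have hg := hgap a; rewrite -/rho in hg.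
  have -> : a - 1 + (rho + rho * (1 - a) * s / (a - s)) =
     (a ^+ 2 - a * (s + 1 - rho + rho * s) + s) / (a - s).
    by field; rewrite gt_eqF.
  rewrite ler_pdivlMr //; apply: le_trans hg.
  by rewrite ler_piMr ?(ltW hc) //; lra.
lra.
Qed.

(** [delay] bounds the number of steps [X -> theta X] that can pass without a
    new free digit while [F >= s r X], because [F <= n <= X] at their start. *)
Definition delay := ln ((s * r)^-1) / ln theta.
Definition weight := (delay + 1) / c.
(** The logarithm decreases by [1] at each step without new free digits; [weight]
    lets the decrease of [F / n] at the other steps outweigh its increase. *)
Definition potential (F n X : R) := weight * (F / n) + ln (F / X) / ln theta.

Lemma ln_theta_gt0 : 0 < ln theta.
Proof. by rewrite ln_gt0. Qed.

Lemma delay_gt0 : 0 < delay.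
Proof.
have [hr' hs' ht'] := And3 hr hs htheta.
rewrite divr_gt0 ?ln_theta_gt0 // ln_gt0 // invf_gt1; last by rewrite mulr_gt0; lra.
by rewrite mulr_ilt1; lra.
Qed.

Lemma weight_gt0 : 0 < weight.
Proof.
have hc' := hc.
by rewrite divr_gt0 //; have := delay_gt0; lra. Qed.

(** Jumps that create no free digits are rewarded by the growth of [X]; this
    compensates for the increase of [F] at the other jumps. *)
Lemma potential_step (n F X n' : R) :
  0 < n -> F <= n -> s * (n + r * X) <= F -> n <= X -> n <= n' ->
  n' <= theta * X ->
  potential (F + Num.max 0 (n' - (n + r * X))) n' (theta * X) <=
    potential F n X - 1.
Proof.
have [hr' hs' ht' hc'] := And4 hr hs htheta hc.
move=> n0 Fn hF nX nn' n'X.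
have X0 : 0 < X by lra.
have rX0 : 0 < r * X by rewrite mulr_gt0 //; lra.
have sn0 : 0 < s * (n + r * X) by rewrite mulr_gt0; lra.
have F0 : 0 < F by lra.
have [_] := free_ratio_step n0 Fn hF nX nn' n'X.
set F' := F + _ => h.
have F'0 : 0 < F'.
  have : 0 <= Num.max 0 (n' - (n + r * X)) by rewrite le_max lexx.
  rewrite /F'; lra.
have hl := ln_theta_gt0.
have t0 : 0 < theta by lra.
have e : ln (F' / (theta * X)) / ln theta = ln (F' / X) / ln theta - 1.
  have -> : F' / (theta * X) = (F' / X) / theta.
    by field; rewrite !gt_eqF.
  by rewrite ln_div ?posrE ?divr_gt0 // mulrBl divff // gt_eqF.
have hw := weight_gt0; have hd := delay_gt0.
rewrite /potential e; case: h => [[-> h]|[h1 h2]].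
  have : weight * (F / n') <= weight * (F / n).
    by rewrite ler_pM2l.
  by lra.
have h3 : weight * (F' / n') <= weight * (F / n) - (delay + 1).
  have -> : delay + 1 = weight * c by rewrite /weight divfK // gt_eqF.
  by rewrite -mulrBr ler_pM2l.
have h4 : ln (F' / X) / ln theta <= ln (F / X) / ln theta + delay + 1.
  have -> : ln (F / X) / ln theta + delay + 1 =
      ln (F * (theta / (s * r)) / X) / ln theta.
    have -> : F * (theta / (s * r)) / X = (F / X) * (s * r)^-1 * theta.
      by field; rewrite !gt_eqF //=; lra.
    have sr0 : 0 < (s * r)^-1 by rewrite invr_gt0 mulr_gt0; lra.
    rewrite !lnM ?posrE ?mulr_gt0 ?invr_gt0 ?mulr_gt0 //; try lra.
    by rewrite /delay !mulrDl divff // gt_eqF.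
  rewrite ler_pM2r ?invr_gt0 // ler_ln ?posrE ?divr_gt0 ?mulr_gt0 ?invr_gt0 //;
    rewrite ?mulr_gt0 //; try lra.
  by rewrite ler_pM2r // invr_gt0.
lra.
Qed.

Lemma potential_gt (n F X : R) :
  0 < n -> s * (n + r * X) <= F -> 0 < X -> - delay < potential F n X.
Proof.
have [hr' hs' ht' hc'] := And4 hr hs htheta hc.
move=> n0 hF X0.
have rX0 : 0 < r * X by rewrite mulr_gt0 //; lra.
have sn0 : 0 < s * n by rewrite mulr_gt0; lra.
have srX0 : 0 < s * (r * X) by rewrite mulr_gt0; lra.
have F0 : s * (r * X) < F by rewrite mulrDr in hF; lra.
have hw : 0 <= weight * (F / n).
  have hFn : 0 <= F / n by rewrite divr_ge0 //; lra.
  by rewrite mulr_ge0 // ltW // weight_gt0.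
have sr0 : 0 < s * r by rewrite mulr_gt0; lra.
have : - delay < ln (F / X) / ln theta.
  rewrite /delay -mulNr -lnV ?posrE ?invr_gt0 // invrK.
  rewrite ltr_pM2r ?invr_gt0 ?ln_theta_gt0 //.
  have h : s * r < F / X by rewrite ltr_pdivlMr // -mulrA.
  by rewrite ltr_ln ?posrE //; apply: lt_trans h.
rewrite /potential; lra.
Qed.

End Step.
End Potential.

(** * Economical covers of uniformly recurrent points *)
Section Coverable.
Context (R : realType).

(** Covers by finitely many balls, given as pairs of a centre and a radius.
    Finite lists can be concatenated, and their unions are measurable. *)
Definition coverable (s e : R) (A : set R) : Prop := exists c : seq (R * R),
  [/\ forall p, p \in c -> 0 <= p.2,
      forall x, A x -> exists2 p, p \in c & `|x - p.1| <= p.2 &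
      \sum_(p <- c) p.2 `^ s <= e].

Lemma coverable_bigcup s (I : eqType) (l : seq I) (A : I -> set R) (e : I -> R) :
  (forall i, i \in l -> coverable s (e i) (A i)) ->
  coverable s (\sum_(i <- l) e i) [set x | exists2 i, i \in l & A i x].
Proof.
elim: l => [|i l IH] h.
  exists [::]; split=> //; last by rewrite !big_nil.
  by move=> x [].
have [c [c1 c2 c3]] := h i (mem_head _ _).
have [|d [d1 d2 d3]] := IH; first by move=> k kl; apply: h; rewrite inE kl orbT.
exists (c ++ d); split.
- by move=> p; rewrite mem_cat => /orP[/c1|/d1].
- move=> x [k]; rewrite inE => /predU1P[->|kl] hx.
    by have [p pc hp] := c2 _ hx; exists p => //; rewrite mem_cat pc.
  have [|p pd hp] := d2 x; first by exists k.
  by exists p => //; rewrite mem_cat pd orbT.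
- by rewrite big_cat big_cons lerD.
Qed.

Lemma coverable_bigcup_le s (I : eqType) (l : seq I) (A : I -> set R) (e k : R)
    (B : set R) :
  (forall i, i \in l -> coverable s e (A i)) ->
  B `<=` [set x | exists2 i, i \in l & A i x] ->
  (size l)%:R * e <= k -> coverable s k B.
Proof.
move=> h hB hk; have [c [c1 c2 c3]] := coverable_bigcup h.
exists c; split=> //; first by move=> x /hB/c2.
by apply: le_trans c3 _; rewrite big_const_seq count_predT iter_addr_0 -mulr_natl.
Qed.

End Coverable.

Section CoverRec.
Context (R : realType) (b : R) (hb : 1 < b).
Local Notation T := (beta_transformation b).
Context (r : R).

Definition returns (x X : R) (n : nat) : Prop :=
  (0 < n)%N /\ `|iter n T x - x| < b `^ (- (r * X)).

Definition first_return (x X : R) (n : nat) : Prop :=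
  returns x X n /\ forall m, (m < n)%N -> ~ returns x X m.

(** The quantifier runs over real scales [X], so that the scales of the covering
    argument may form an exact geometric progression. *)
Definition uniformly_recurrent (X0 x : R) : Prop :=
  0 <= x < 1 /\
  forall X, X0 <= X -> exists2 n : nat, n%:R <= X & returns x X n.

(** On a branch, [T^n x - x] is affine with slope [b^n - 1]. *)
Definition return_radius (n : nat) (X : R) : R := b `^ (- (r * X)) / (b ^+ n - 1).

Lemma first_return_exists X0 X x : uniformly_recurrent X0 x -> X0 <= X ->
  exists2 n : nat, n%:R <= X & first_return x X n.
Proof.
case=> hx h hX; have [n nX hn] := h X hX.
have ex : exists n, `[< returns x X n >] by exists n; apply/asboolP.
exists (ex_minn ex).
  by case: ex_minnP => m _ /(_ n (asboolT hn)) mn; apply: le_trans nX; rewrite ler_nat.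
case: ex_minnP => m /asboolP hm hmin; split=> // k km /asboolT/hmin.
by rewrite leqNgt km.
Qed.

Lemma returnsW x X X' n : 0 < r -> X <= X' -> returns x X' n -> returns x X n.
Proof.
move=> r0 hX [n0 h]; split=> //; apply: lt_le_trans h _.
by apply: ler_powR; [exact: ltW|rewrite lerN2 ler_pM2l].
Qed.

Lemma first_return_le x X X' n n' : 0 < r -> X <= X' ->
  first_return x X n -> first_return x X' n' -> (n <= n')%N.
Proof.
move=> r0 hX [_ h] [h' _]; rewrite leqNgt; apply/negP => /h; apply.
exact: returnsW h'.
Qed.

Context (s theta c : R) (hr : 0 < r < 1) (hs : 0 < s < 1) (htheta : 1 < theta)
  (hc : 0 < c) (hgap : forall a,
    c <= a ^+ 2 - a * (s + 1 - r / theta + r / theta * s) + s).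

(** The quotient of [1 / (b^n - 1)] and [b^-n] is at most [kappa] for
    [n >= 1]. *)
Definition kappa := b / (b - 1).

Lemma kappa_ge1 : 1 <= kappa.
Proof. have hb' := hb; rewrite ler_pdivlMr ?mul1r; lra. Qed.

Lemma radius_ge0 n X : (0 < n)%N -> 0 <= return_radius n X.
Proof.
move=> n0; rewrite divr_ge0 ?powR_ge0 // subr_ge0 exprn_ege1 // ltW //.
Qed.

Lemma radius_le n X : (0 < n)%N ->
  return_radius n X <= kappa * b `^ (- (n%:R + r * X)).
Proof.
move=> n0; have b0 := base_gt0 hb; have hb' := hb.
have bn : b <= b ^+ n by rewrite -[leLHS]expr1 ler_eXn2l.
rewrite opprD powRD; last by rewrite (gt_eqF b0) implybT.
rewrite powRN powR_mulrn ?(ltW b0) // mulrA [leRHS]mulrC.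
rewrite ler_pM2l ?powR_gt0 // /kappa ler_pdivlMr ?exprn_gt0 //.
rewrite mulrC ler_pdivrMr; last lra.
rewrite mulrAC ler_pdivlMr; lra.
Qed.

Context (s' : R) (hs' : s < s' < 1) (X0 Xm : R) (hX0 : 1 <= X0).

(** One factor [Xm + 2] bounds the number of possible return times; the rest
    bounds the number of branches that an interval meets at such a time, per
    free digit. *)
Definition branching := (Xm + 2) ^+ 2 * (2 * kappa + 4).

Lemma branching_ge : 0 <= Xm -> kappa <= branching.
Proof.
move=> hXm; have k1 := kappa_ge1; rewrite /branching.
have h9 : 1 <= (Xm + 2) ^+ 2 by rewrite exprn_ege1 //; lra.
apply: (@le_trans _ _ (2 * kappa + 4)); first by lra.
by rewrite ler_peMl //; lra.
Qed.

Lemma coverable_stop (z : R) (n : nat) (F X : R) (A : set R) :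
  X0 <= X -> (0 < n)%N -> F < s * (n%:R + r * X) ->
  (forall x, A x -> `|x - z| <= return_radius n X) ->
  coverable s' (kappa * (b `^ (- F) * b `^ (- ((s' - s) * (r * X0))))) A.
Proof.
have [hr' hs1 hs2 hX0'] := And4 hr hs hs' hX0.
have b0 := base_gt0 hb; have k1 := kappa_ge1.
move=> XX n0 hF hA.
have nR : 0 < n%:R :> R by rewrite ltr0n.
have rX : r * X0 <= r * X by rewrite ler_pM2l; lra.
exists [:: (z, return_radius n X)]; split.
- by move=> p; rewrite inE => /eqP -> /=; exact: radius_ge0.
- by move=> x /hA hx; exists (z, return_radius n X); rewrite ?inE.
rewrite big_seq1 /=; set A0 := n%:R + r * X in hF *.
apply: (@le_trans _ _ ((kappa * b `^ (- A0)) `^ s')).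
  apply: ge0_ler_powR; rewrite ?nnegrE ?radius_ge0 ?radius_le //; first by lra.
  by rewrite mulr_ge0 ?powR_ge0 //; lra.
rewrite powRM ?powR_ge0 //; last by lra.
apply: ler_pM; rewrite ?powR_ge0 //; first by apply: ler1_powR; lra.
rewrite -powRrM -powRD; last by rewrite (gt_eqF b0) implybT.
apply: ler_powR; first exact: ltW.
have : (s' - s) * (r * X0) <= (s' - s) * A0 by rewrite ler_pM2l /A0; lra.
lra.
Qed.

(** A state consists of an interval of points whose first return to scale [X]
    occurs at time [n], weighted by the number [b^F] of its possible choices.
    One stops as soon as the digits known, [n + r X], outweigh the free ones,
    and the decrease of the potential bounds the number of steps. *)
Lemma coverable_state j (z : R) (n : nat) (F X : R) :
  X0 <= X -> X * theta ^+ j <= Xm -> (0 < n)%N ->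
  F <= n%:R -> n%:R <= X -> potential r s theta c F n%:R X <= j%:R - delay r s theta ->
  coverable s'
    (branching ^+ j.+1 * (b `^ (- F) * b `^ (- ((s' - s) * (r * X0)))))
    [set x | [/\ uniformly_recurrent X0 x, `|x - z| <= return_radius n X
                & first_return x X n]].
Proof.
have [hr' hs1 ht' hc'] := And4 hr hs htheta hc.
have [hs2 hX0' hb'] := And3 hs' hX0 hb.
have b0 := base_gt0 hb; have k1 := kappa_ge1.
set tail := b `^ (- ((s' - s) * (r * X0))).
have tail0 : 0 < tail by rewrite powR_gt0.
elim: j z n F X => [|j IH] z n F X XX XXm n0 Fn nX hpot.
all: have X0' : 0 < X by lra.
all: have nR : 0 < n%:R :> R by rewrite ltr0n.
all: have XmX : X <= Xm by apply: le_trans XXm; rewrite ler_peMr ?exprn_ege1 ?ltW.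
all: have hP : kappa <= branching by apply: branching_ge; lra.
all: have [hF|hF] := ltP F (s * (n%:R + r * X)).
1,3: have [d [d1 d2 d3]] := @coverable_stop z n F X _ XX n0 hF
       (fun x (h : [/\ uniformly_recurrent X0 x, `|x - z| <= return_radius n X
                & first_return x X n]) => let: And3 _ q _ := h in q).
1,2: exists d; split=> //; apply: le_trans d3 _.
1,2: apply: ler_wpM2r; first by rewrite mulr_ge0 ?powR_ge0.
1,2: apply: (le_trans hP); apply: ler_eXnr => //; exact: (le_trans k1 hP).
  have := potential_gt hr hs htheta hc nR hF X0'; lra.
pose N := (Num.truncn Xm).+1.
have hN : N%:R <= Xm + 2.
  have := truncn_itv (ltac:(lra) : 0 <= Xm); rewrite /N -natr1; lra.
have hXm0 : 0 < Xm + 2 by lra.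
have hk0 : 0 < 2 * kappa + 4 by lra.
have hP0 : 0 < branching by lra.
pose e := (Xm + 2) * (2 * kappa + 4) *
  (branching ^+ j.+1 * (b `^ (- F) * tail)).
have e0 : 0 < e by rewrite !mulr_gt0 ?exprn_gt0 ?powR_gt0.
pose B n' := [set x | [/\ uniformly_recurrent X0 x, `|x - z| <= return_radius n X,
  first_return x X n & first_return x (theta * X) n' /\ n'%:R <= theta * X]].
have htX : X <= theta * X by rewrite ler_peMl ?ltW.
have htXm : theta * X <= Xm.
  apply: le_trans XXm; have -> : X * theta ^+ j.+1 = theta * X * theta ^+ j.
    by rewrite exprS; ring.
  by apply: ler_peMr; [rewrite mulr_ge0 //; lra|rewrite exprn_ege1 // ltW].
apply: (@coverable_bigcup_le _ s' _ (iota 0 N) B e); last first.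
- rewrite size_iota.
  apply: (@le_trans _ _ ((Xm + 2) * e)).
    by apply: ler_wpM2r hN; exact: ltW.
  rewrite le_eqVlt; apply/orP; left; apply/eqP.
  rewrite (exprS branching j.+1) /e; set Q := branching ^+ j.+1.
  by rewrite /branching; ring.
- move=> x [hx hxz hf]; have [n' n'X hn'] := first_return_exists hx (le_trans XX htX).
  exists n'; last by split.
  rewrite mem_iota add0n /= /N ltnS truncn_ge_nat; [exact: le_trans htXm|lra].
move=> n' _.
have [/andP[nn' n'X]|bad] := boolP ((n <= n')%N && (n'%:R <= theta * X)); last first.
  exists [::]; split=> //; last by rewrite big_nil ltW.
  move=> x [_ _ h1 [h2 h3]]; case/negP: bad; rewrite h3 andbT.
  by apply: first_return_le h1 h2 => //; case/andP: hr.
have n'0 : (0 < n')%N by exact: leq_trans nn'.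
have nn'R : n%:R <= n'%:R :> R by rewrite ler_nat.
have [d [hd1 hd2]] := return_cover hb z (b `^ (- (r * (theta * X)))) n'0
  (radius_ge0 X n0).
set m := Num.max 0 (n'%:R - (n%:R + r * X)).
have m0 : 0 <= m by rewrite le_max lexx.
have hm : n'%:R - (n%:R + r * X) <= m by rewrite le_max lexx orbT.
pose D t := [set x | [/\ uniformly_recurrent X0 x,
  `|x - t| <= return_radius n' (theta * X) & first_return x (theta * X) n']].
apply: (@coverable_bigcup_le _ s' _ d D
          (branching ^+ j.+1 * (b `^ (- (F + m)) * tail))).
- move=> t _; apply: IH => //; first exact: le_trans htX.
  + by rewrite (_ : _ * _ = X * theta ^+ j.+1) // exprS; ring.
  + by have [] := free_ratio_step hr hs htheta hc hgap nR Fn hF nX nn'R n'X.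
  + apply: le_trans (potential_step hr hs htheta hc hgap nR Fn hF nX nn'R n'X) _.
    by rewrite -natr1 in hpot; lra.
- move=> x [h1 h2 h3 [h4 h5]]; have [t td ht] := hd2 x h1.1 h2 (ltW h4.1.2).
  by exists t.
have hbm : 1 <= b `^ m by rewrite -[leLHS](powRr0 b) ler_powR // ltW.
have hsz : (size d)%:R <= (Xm + 2) * (2 * kappa + 4) * b `^ m.
  apply: (le_trans hd1); rewrite -[leRHS]mulrA.
  have h0 : 0 <= 2 * return_radius n X * b ^+ n'.
    by rewrite mulr_ge0 ?exprn_ge0 ?(ltW b0) // mulr_ge0 // radius_ge0.
  apply: ler_pM => //; first by lra.
    have e1 : n'.+1%:R = n'%:R + 1 :> R by rewrite natr1.
    by rewrite e1; lra.
  rewrite [leRHS]mulrDl; apply: lerD; last by rewrite ler_peMr.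
  have h1 : return_radius n X * b ^+ n' <= kappa * b `^ (- (n%:R + r * X)) * b ^+ n'.
    by apply: ler_wpM2r; [rewrite exprn_ge0 // ltW|exact: radius_le].
  suff h2 : b `^ (- (n%:R + r * X)) * b ^+ n' <= b `^ m.
    have h3 : kappa * (b `^ (- (n%:R + r * X)) * b ^+ n') <= kappa * b `^ m.
      by apply: ler_wpM2l h2; lra.
    lra.
  rewrite -powR_mulrn ?(ltW b0) // -powRD ?(gt_eqF b0) ?implybT //.
  by apply: ler_powR; [exact: ltW|lra].
rewrite opprD powRD ?(gt_eqF b0) ?implybT // (powRN b m).
apply: (@le_trans _ _ (((Xm + 2) * (2 * kappa + 4) * b `^ m) *
   (branching ^+ j.+1 * (b `^ (- F) / b `^ m * tail)))).
  by rewrite ler_pM2r // !mulr_gt0 ?exprn_gt0 ?invr_gt0 ?powR_gt0.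
rewrite le_eqVlt; apply/orP; left; apply/eqP; rewrite /e; field.
by rewrite gt_eqF // powR_gt0.
Qed.

End CoverRec.

Section UpperBound.
Context (R : realType) (b : R) (hb : 1 < b).
Local Notation T := (beta_transformation b).

Lemma coverableW (s e e' : R) (A B : set R) : e <= e' -> B `<=` A ->
  coverable s e A -> coverable s e' B.
Proof.
move=> he hBA [c [c1 c2 c3]]; exists c; split=> //; last exact: le_trans he.
by move=> x /hBA /c2.
Qed.

(** [exp y >= y^(m + 1)] for a suitable multiple [y] of [X] beats a polynomial of
    degree [m] by a factor [X]. *)
Lemma poly_exp_small (a t C e X1 : R) (m : nat) : 0 <= a -> 0 < t -> 0 < C ->
  0 < e -> exists X, [/\ 1 <= X, X1 <= X & (a * X + 2) ^+ m * C * b `^ (- (t * X)) <= e].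
Proof.
move=> a0 t0 C0 e0.
have l0 : 0 < ln b by rewrite ln_gt0.
have b0 := base_gt0 hb.
pose q := t * ln b / m.+1%:R.
have q0 : 0 < q by rewrite divr_gt0 ?mulr_gt0.
pose D := (a + 2) ^+ m * C / q ^+ m.+1.
have D0 : 0 < D by rewrite divr_gt0 ?mulr_gt0 ?exprn_gt0 //; lra.
exists (1 + `|X1| + D / e).
set X := 1 + _ + _.
have De0 : 0 < D / e by rewrite divr_gt0.
have X1' : 1 <= X by rewrite /X; have := normr_ge0 X1; lra.
split=> //; first by rewrite /X; have := ler_norm X1; lra.
have hexp : (q * X) ^+ m.+1 <= b `^ (t * X).
  have -> : b `^ (t * X) = expR (q * X) ^+ m.+1.
    rewrite /powR gt_eqF // -expRM_natr; congr expR; rewrite /q.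
    by field; rewrite gt_eqF.
  rewrite ler_pXn2r ?nnegrE ?expR_ge0 //; last by rewrite mulr_ge0 ?(ltW q0) //; lra.
  by apply: le_trans (expR_ge1Dx _); lra.
rewrite powRN ler_pdivrMr ?powR_gt0 //.
apply: (@le_trans _ _ (e * (q * X) ^+ m.+1)); last by rewrite ler_pM2l.
apply: (@le_trans _ _ (((a + 2) * X) ^+ m * C)).
  apply: ler_wpM2r; first exact: ltW.
  have h : 0 <= a * X by rewrite mulr_ge0 //; lra.
  by apply: lerXn2r; rewrite ?nnegrE; lra.
have -> : ((a + 2) * X) ^+ m * C = D * (q ^+ m.+1 * X ^+ m).
  by rewrite /D exprMn; field; rewrite expf_neq0 // gt_eqF.
have -> : e * (q * X) ^+ m.+1 = e * X * (q ^+ m.+1 * X ^+ m).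
  by rewrite exprMn (exprS X); ring.
apply: ler_wpM2r; first by rewrite mulr_ge0 // exprn_ge0 ?(ltW q0) //; lra.
rewrite mulrC -ler_pdivrMr // /X; have := normr_ge0 X1; lra.
Qed.

Lemma uniformly_recurrentW (r X0 X1 x : R) : X0 <= X1 ->
  uniformly_recurrent b r X0 x -> uniformly_recurrent b r X1 x.
Proof. by move=> h [hx hr]; split=> // X hX; apply: hr; exact: le_trans hX. Qed.

(** The induction starts from the first return at scale [X0]: all [n] digits
    before it are free. *)
Lemma coverable_recurrent_start (r s theta c s' X0 Xm : R) (K : nat) :
  0 < r < 1 -> 0 < s < 1 -> 1 < theta -> 0 < c ->
  (forall a, c <= a ^+ 2 - a * (s + 1 - r / theta + r / theta * s) + s) ->
  s < s' < 1 -> 1 <= X0 -> X0 * theta ^+ K <= Xm ->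
  weight r s theta c <= K%:R - delay r s theta ->
  coverable s' (branching b Xm ^+ K.+2 * b `^ (- ((s' - s) * (r * X0))))
    (uniformly_recurrent b r X0).
Proof.
move=> hr hs htheta hc hgap hs' hX0 hXm hK.
have b0 := base_gt0 hb; have k1 := kappa_ge1 hb.
set tail := b `^ (- ((s' - s) * (r * X0))).
have tail0 : 0 < tail by rewrite powR_gt0.
have X0m : X0 <= Xm.
  apply: le_trans hXm; apply: ler_peMr; first by lra.
  by rewrite exprn_ege1 // ltW.
have hP : kappa b <= branching b Xm by apply: (branching_ge hb); lra.
have hP0 : 0 < branching b Xm by lra.
pose N := (Num.truncn Xm).+1.
have hN : N%:R <= Xm + 2.
  have := truncn_itv (ltac:(lra) : 0 <= Xm); rewrite /N -natr1; lra.
have hk0 : 0 < 2 * kappa b + 4 by lra.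
pose e := (Xm + 2) * (2 * kappa b + 4) * (branching b Xm ^+ K.+1 * tail).
have e0 : 0 < e by rewrite !mulr_gt0 ?exprn_gt0 //; lra.
pose B n := [set x | [/\ uniformly_recurrent b r X0 x,
   first_return b r x X0 n & n%:R <= X0]].
apply: (@coverable_bigcup_le _ s' _ (iota 0 N) B e); last first.
- rewrite size_iota.
  apply: (@le_trans _ _ ((Xm + 2) * e)); first by apply: ler_wpM2r hN; exact: ltW.
  rewrite le_eqVlt; apply/orP; left; apply/eqP.
  rewrite (exprS _ K.+1) /e; set Q := branching b Xm ^+ K.+1.
  by rewrite /branching; ring.
- move=> x hx; have [n nX hn] := first_return_exists hx (lexx X0).
  exists n; last by split.
  rewrite mem_iota add0n /= /N ltnS truncn_ge_nat; [exact: le_trans X0m|lra].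
move=> n _.
have [/andP[n0 nX]|bad] := boolP ((0 < n)%N && (n%:R <= X0)); last first.
  exists [::]; split=> //; last by rewrite big_nil ltW.
  by move=> x [_ [[h1 _] _] h3]; case/negP: bad; rewrite h3 andbT.
have nR : 0 < n%:R :> R by rewrite ltr0n.
have [d [hd1 hd2]] := return_cover hb 0 (b `^ (- (r * X0))) n0 (@ler01 R).
pose D t := [set x | [/\ uniformly_recurrent b r X0 x,
  `|x - t| <= return_radius b r n X0 & first_return b r x X0 n]].
have hbn : 1 <= b ^+ n by rewrite exprn_ege1 // ltW.
apply: (@coverable_bigcup_le _ s' _ d D
          (branching b Xm ^+ K.+1 * (b `^ (- n%:R) * tail))).
- move=> t _; apply: (coverable_state hb hr hs htheta hc hgap hs' hX0) => //.
  apply: le_trans hK; rewrite /potential divff ?gt_eqF // mulr1 gerDl.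
  have hl : 0 < ln theta by rewrite ln_gt0.
  rewrite pmulr_lle0 ?invr_gt0 // ln_le0 // ler_pdivrMr ?mul1r //; lra.
- move=> x [h1 [h2 h3] h4]; have [|t td ht] := hd2 x h1.1 _ (ltW h2.2).
    by case: h1 => h1 _; rewrite subr0 ger0_norm; lra.
  by exists t.
have hsz : (size d)%:R <= (Xm + 2) * (2 * kappa b + 4) * b ^+ n.
  apply: (le_trans hd1); rewrite -[leRHS]mulrA.
  apply: ler_pM => //; first by lra.
    have e1 : n.+1%:R = n%:R + 1 :> R by rewrite natr1.
    by rewrite e1; lra.
  have : 1 * b ^+ n <= kappa b * b ^+ n by apply: ler_wpM2r; lra.
  lra.
rewrite (powRN b) powR_mulrn ?(ltW b0) //.
apply: (@le_trans _ _ (((Xm + 2) * (2 * kappa b + 4) * b ^+ n) *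
   (branching b Xm ^+ K.+1 * (b ^- n * tail)))).
  apply: ler_wpM2r hsz.
  by rewrite ltW // !mulr_gt0 ?exprn_gt0 ?invr_gt0 ?exprn_gt0.
rewrite le_eqVlt; apply/orP; left; apply/eqP; rewrite /e; field.
by rewrite gt_eqF //; lra.
Qed.

(** The number of steps does not depend on [X0], so the polynomial factor loses
    against the exponential gain from [s < s']. *)
Lemma coverable_recurrent (r s' X0 e : R) : 0 < r < 1 ->
  ((1 - r) / (1 + r)) ^+ 2 < s' < 1 -> 0 < e ->
  coverable s' e (uniformly_recurrent b r X0).
Proof.
move=> hr hs' e0; pose s := (((1 - r) / (1 + r)) ^+ 2 + s') / 2.
have s1 : 0 <= ((1 - r) / (1 + r)) ^+ 2 by exact: sqr_ge0.
have hs1 : 0 < s < 1 by rewrite /s; lra.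
have hss : s < s' < 1 by rewrite /s; lra.
have [||theta [c [htheta hc hgap]]] := @discriminant_gap _ r s hr; try by rewrite /s; lra.
pose w := weight r s theta c + delay r s theta.
have hw : 0 < w.
  by rewrite addr_gt0 ?(weight_gt0 hr hs1 htheta hc) ?(delay_gt0 hr hs1 htheta).
have [K hK] : exists K : nat, w <= K%:R.
  by exists (Num.truncn w).+1; have := truncn_itv (ltW hw); lra.
have k1 := kappa_ge1 hb.
have k2 : 0 < 2 * kappa b + 4 by lra.
have ht : 1 <= theta ^+ K by rewrite exprn_ege1 // ltW.
have sr0 : 0 < (s' - s) * r by rewrite mulr_gt0; lra.
have [X [X1 hXX hX]] := @poly_exp_small (theta ^+ K) ((s' - s) * r)
  ((2 * kappa b + 4) ^+ K.+2) e X0 (2 * K.+2) (ltac:(lra)) sr0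
  (exprn_gt0 _ k2) e0.
apply: (@coverableW _ _ _ (uniformly_recurrent b r X)) (@coverable_recurrent_start
  r s theta c s' X (X * theta ^+ K) K hr hs1 htheta hc hgap hss X1 (lexx _) _).
- apply: le_trans hX; rewrite /branching exprMn -exprM (mulrC X) mulrA.
  by rewrite le_eqVlt -!mulrA eqxx.
- by move=> x; exact: uniformly_recurrentW.
- by rewrite lerBrDr.
Qed.

End UpperBound.

(** * Null sets for Hausdorff and Lebesgue measure *)
Section HausdorffNull.
Context (R : realType).
Implicit Types (s e : R) (A B : set R).

Lemma diam_power_ge0 s A : (0 <= diam_power s A)%E.
Proof. by rewrite /diam_power; case: ifP => // _; exact: poweR_ge0. Qed.

Lemma le_diam A x y : A x -> A y -> (`|x - y|%:E <= diam A)%E.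
Proof. by move=> Ax Ay; apply: ereal_sup_ubound; exists x, y. Qed.

Lemma diam_power_le s d A : 0 <= s -> 0 <= d -> (diam A <= d%:E)%E ->
  (diam_power s A <= (d `^ s)%:E)%E.
Proof.
move=> s0 d0 hd; rewrite /diam_power; case: eqP => [_|/eqP/set0P[x Ax]].
  by rewrite lee_fin powR_ge0.
have := le_diam Ax Ax; rewrite subrr normr0.
case: (diam A) hd => [t| |] //=; rewrite !lee_fin => td t0.
exact: ge0_ler_powR.
Qed.

Lemma diam_ball (c r : R) : (diam [set x | (`|x - c| <= r)%R] <= (2 * r)%:E)%E.
Proof.
apply: ge_ereal_sup => _ [x [y [/= hx hy ->]]]; rewrite lee_fin.
move: hx hy; rewrite !ler_norml; lra.
Qed.

Lemma hausdorff_premeasure_ge0 s d A : (0 <= hausdorff_premeasure s d A)%E.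
Proof.
apply: le_ereal_inf_tmp => _ [U [_ _ ->]].
by apply: nneseries_ge0 => i _ _; exact: diam_power_ge0.
Qed.

Lemma hausdorff_measure_ge0 s A : (0 <= hausdorff_measure s A)%E.
Proof.
apply: le_trans (hausdorff_premeasure_ge0 s 1 A) _.
by apply: ereal_sup_ubound; exists 1.
Qed.

Lemma hausdorff_measure_le s A B : A `<=` B ->
  (hausdorff_measure s A <= hausdorff_measure s B)%E.
Proof.
move=> AB; apply: ge_ereal_sup => _ [d d0 ->].
apply: (@le_trans _ _ (hausdorff_premeasure s d B)); last first.
  by apply: ereal_sup_ubound; exists d.
apply: le_ereal_inf_tmp => _ [U [h1 h2 ->]]; apply: ereal_inf_lbound.
by exists U; split=> //; exact: subset_trans h2.
Qed.

Lemma hausdorff_dim_le s A : 0 <= s -> hausdorff_measure s A = 0%E ->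
  (hausdorff_dim A <= s%:E)%E.
Proof. by move=> s0 h; apply: ereal_inf_lbound; exists s. Qed.

Lemma hausdorff_dim_mono A B : A `<=` B -> (hausdorff_dim A <= hausdorff_dim B)%E.
Proof.
move=> AB; apply: le_ereal_inf_tmp => _ [s [s0 h ->]].
apply: hausdorff_dim_le => //; apply/eqP; rewrite eq_le hausdorff_measure_ge0 andbT.
by rewrite -h; exact: hausdorff_measure_le.
Qed.

(** The covers of the sets [A m] are merged with costs [e / 2^(m + 1)].  A small
    cost forces small radii, since [0 < s]. *)
Lemma hausdorff_null s (A : nat -> set R) B : 0 < s ->
  (forall m e, 0 < e -> coverable s e (A m)) -> B `<=` \bigcup_m A m ->
  hausdorff_measure s B = 0%E.
Proof.
move=> s0 hA hB; apply/eqP; rewrite eq_le hausdorff_measure_ge0 andbT.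
apply: ge_ereal_sup => _ [dl dl0 ->].
apply/lee_addgt0Pr => e e0; rewrite add0e.
pose e' := Num.min (e / 2 `^ s) ((dl / 2) `^ s).
have e'0 : 0 < e' by rewrite lt_min divr_gt0 ?powR_gt0 // divr_gt0.
pose em m := e' / (2 ^ m.+1)%:R.
have em0 m : 0 < em m by rewrite divr_gt0 // ltr0n expn_gt0.
have em_le m : em m <= e'.
  rewrite ler_pdivrMr ?ltr0n ?expn_gt0 // ler_peMr ?(ltW e'0) //.
  by rewrite ler1n expn_gt0.
have [c hc] := choice (fun m => hA m (em m) (em0 m)).
pose V m i : set R := if (i < size (c m))%N
  then [set x | `|x - (nth (0, 0) (c m) i).1| <= (nth (0, 0) (c m) i).2]
  else set0.
have Vpow m i : (i < size (c m))%N -> (diam_power s (V m i) <=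
    (2 `^ s * (nth (0, 0) (c m) i).2 `^ s)%:E)%E.
  move=> hi; have [h1 _ _] := hc m; have h0 := h1 _ (mem_nth (0, 0) hi).
  rewrite -powRM //; apply: diam_power_le; [exact: ltW|by rewrite mulr_ge0|].
  by rewrite /V hi; exact: diam_ball.
have Vdiam m i : (diam (V m i) <= dl%:E)%E.
  have [hi|hi] := ltnP i (size (c m)); last first.
    rewrite /V ltnNge hi /=.
    by apply: ge_ereal_sup => _ [x [y [[]]]].
  have [h1 _ h3] := hc m; have h0 := h1 _ (mem_nth (0, 0) hi).
  rewrite /V hi; apply: le_trans (diam_ball _ _) _; rewrite lee_fin.
  rewrite mulrC -ler_pdivlMr //.
  have h4 : (nth (0, 0) (c m) i).2 `^ s <= (dl / 2) `^ s.
    apply: (@le_trans _ _ e'); last by rewrite ge_min lexx orbT.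
    apply: le_trans (em_le m); apply: le_trans h3.
    rewrite (perm_big _ (perm_to_rem (mem_nth (0, 0) hi))) big_cons lerDl.
    by apply: sumr_ge0 => p _; exact: powR_ge0.
  rewrite leNgt; apply/negP => h5; move: h4; apply/negP; rewrite -ltNge.
  by apply: gt0_ltr_powR; rewrite // nnegrE // divr_ge0 // ltW.
have Vsum m : (\sum_(0 <= i <oo) diam_power s (V m i) <= (2 `^ s * em m)%:E)%E.
  rewrite (nneseries_split 0 (size (c m))); last by move=> *; exact: diam_power_ge0.
  rewrite [X in (_ + X)%E]eseries0 ?adde0; last first.
    by move=> i hi _; rewrite /V ltnNge hi /= /diam_power eqxx.
  rewrite add0n; have [_ _ h3] := hc m.
  apply: (@le_trans _ _ (\sum_(0 <= i < size (c m))
      2 `^ s * (nth (0, 0) (c m) i).2 `^ s)%:E).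
    rewrite -sumEFin !big_nat; apply: lee_sum => i /andP[_ hi]; exact: Vpow.
  by rewrite lee_fin -mulr_sumr ler_wpM2l ?powR_ge0 // -(big_nth _ xpredT (fun p => p.2 `^ s)).
have /ppcard_eqP[f] := card_esym card_nat2.
apply: (@le_trans _ _ (\sum_(0 <= k <oo) diam_power s (V (f k).1 (f k).2))%E).
  apply: ereal_inf_lbound; exists (fun k => V (f k).1 (f k).2); split=> //.
  move=> x /hB[m _ Amx]; have [_ h2 _] := hc m.
  have [p pc hp] := h2 x Amx.
  have [k _ hk] : (f @` [set: nat]) (m, index p (c m)).
    by rewrite image_eq.
  by exists k => //; rewrite hk /= /V index_mem pc /= nth_index.
rewrite nneseries_esumT; last by move=> k; exact: diam_power_ge0.
rewrite -(reindex_esum [set: nat] [set: nat * nat] f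
   (fun k => diam_power s (V k.1 k.2))); last exact: 'bij_f.
rewrite (_ : [set: nat * nat] = [set: nat] `*`` (fun=> [set: nat])); last first.
  by apply/seteqP; split.
rewrite -(@esum_esum _ _ _ [set: nat] (fun=> [set: nat])
  (fun m i => diam_power s (V m i))); last by move=> *; exact: diam_power_ge0.
rewrite -nneseries_esumT; last by move=> i; apply: esum_ge0 => j _; exact: diam_power_ge0.
apply: (@le_trans _ _ (\sum_(0 <= m <oo) (2 `^ s * e' / (2 ^ m.+1)%:R)%:E)%E).
  apply: lee_nneseries => [m _ _|m _].
    by apply: esum_ge0 => j _; exact: diam_power_ge0.
  rewrite -nneseries_esumT; last by move=> j; exact: diam_power_ge0.
  by rewrite -mulrA; exact: Vsum.
apply: le_trans (epsilon_trick0 _ _) _; first by rewrite mulr_ge0 ?powR_ge0 // ltW.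
rewrite lee_fin mulrC -ler_pdivlMr ?powR_gt0 //.
by rewrite ge_min lexx.
Qed.

(** Radii below [1] are at most their powers of exponent [s <= 1]. *)
Lemma coverable_negligible s A : 0 < s <= 1 ->
  (forall e, 0 < e -> coverable s e A) -> (@lebesgue_measure R).-negligible A.
Proof.
move=> /andP[s0 s1] hA.
pose em m : R := (m.+1%:R)^-1.
have em0 m : 0 < em m by rewrite invr_gt0.
have em1 m : em m <= 1 by rewrite invf_le1 ?ler1n.
have [c hc] := choice (fun m => hA (em m) (em0 m)).
pose J (p : R * R) : set R := `[p.1 - p.2, p.1 + p.2]%classic.
pose V m := \big[setU/set0]_(p <- c m) J p.
have mV m : measurable (V m).
  by apply: bigsetU_measurable => p _; exact: measurable_itv.
have AV m : A `<=` V m.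
  move=> x Ax; have [_ h2 _] := hc m; have [p pc hp] := h2 x Ax.
  rewrite /V -bigcup_seq; exists p => //=; rewrite /J /= in_itv /=.
  by move: hp; rewrite ler_distl.
have muV m : (lebesgue_measure (V m) <= (2 * em m)%:E)%E.
  have [h1 _ h3] := hc m.
  have h4 : (lebesgue_measure (V m) <= (\sum_(p <- c m) 2 * p.2)%:E)%E.
    rewrite /V; elim: (c m) h1 => [|p l IH] h1.
      by rewrite !big_nil measure0.
    rewrite !big_cons EFinD; apply: le_trans (measureU2 _ _ _) _.
    - exact: measurable_itv.
    - by apply: bigsetU_measurable => q _; exact: measurable_itv.
    apply: leeD; last by apply: IH => q ql; apply: h1; rewrite inE ql orbT.
    rewrite /= (@lebesgue_measure_itv R `[p.1 - p.2, p.1 + p.2]) /= lte_fin.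
    case: ifP => _.
      by rewrite -EFinB lee_fin; lra.
    by rewrite lee_fin mulr_ge0 // h1 ?mem_head.
  apply: le_trans h4 _; rewrite lee_fin -mulr_sumr ler_wpM2l //.
  apply: (le_trans _ h3); rewrite !big_seq; apply: ler_sum => p pc.
  have := h1 p pc; rewrite le_eqVlt => /predU1P[<-|p0]; first exact: powR_ge0.
  apply: ger1_powR => //; rewrite p0 leNgt; apply/negP => p1.
  have : 1 < p.2 `^ s.
    have -> : 1 = 1 `^ s :> R by rewrite powR1.
    by apply: gt0_ltr_powR; rewrite // nnegrE ltW.
  apply/negP; rewrite -leNgt; apply: (le_trans _ (em1 m)); apply: le_trans h3.
  rewrite (perm_big _ (perm_to_rem pc)) big_cons lerDl.
  by apply: sumr_ge0 => q _; exact: powR_ge0.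
exists (\bigcap_m V m); split.
- exact: bigcapT_measurable.
- apply/eqP; rewrite eq_le measure_ge0 andbT; apply/lee_addgt0Pr => e e0.
  rewrite add0e; pose m := Num.truncn (2 / e).
  apply: (@le_trans _ _ (lebesgue_measure (V m))).
    apply: le_measure; [rewrite inE; exact: bigcapT_measurable|rewrite inE; exact: mV|].
    by move=> x hx; exact: (hx m I).
  apply: le_trans (muV m) _; rewrite lee_fin /em ler_pdivrMr ?ltr0n //.
  by rewrite mulrC -ler_pdivrMr // ltW // truncnS_gt.
- by move=> x Ax m _; exact: AV.
Qed.

End HausdorffNull.

(** * Returns faster than the expansion *)
Section FastReturns.
Context (R : realType) (b : R) (hb : 1 < b).
Local Notation T := (beta_transformation b).

(** A periodic point of period [n] is determined by the left endpoint
    [x - x / b^n] of its branch. *)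
Lemma countable_periodic :
  countable [set x : R | 0 <= x < 1 /\ exists2 n, (0 < n)%N & iter n T x = x].
Proof.
have b0 := base_gt0 hb.
pose F (k : nat * nat) := [set x : R | [/\ 0 <= x < 1, (0 < k.1)%N,
  iter k.1 T x = x & new_endpoint b k.2 (x - x / b ^+ k.1)]].
apply: (@sub_countable _ _ _ (\bigcup_k F k)).
  apply: subset_card_le => x [hx [n n0 hn]].
  have hy := left_endpoint_itv hb n hx; have hz := iter_left_endpoint hb n hx.
  rewrite hn in hy hz; have [i _ hi] := new_endpoint_exists hy hz.
  by exists (n, i).
apply: bigcup_countable => // -[n i] _; apply/countable_injP.
exists (fun x => pickle (Num.floor (b ^+ i * (x - x / b ^+ n)))).
move=> x y; rewrite !inE => -[/= _ n0 _ hx] [/= _ _ _ hy] /(pcan_inj pickleK) h.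
have := new_endpoint_floor_inj hb hx hy h.
have hbn : 1 < b ^+ n by rewrite exprn_egt1 // -lt0n.
move=> e; have : (x - y) * (1 - (b ^+ n)^-1) = 0.
  by rewrite mulrBr mulr1 mulrBl; lra.
move/eqP; rewrite mulf_eq0 => /orP[|]; rewrite subr_eq0; first by move/eqP.
move/eqP=> h1; suff : (b ^+ n)^-1 < 1 by rewrite -h1 ltxx.
by rewrite invf_lt1 //; lra.
Qed.

(** The upper point of a crossing ends near [0].  If [T^m x] is not that small,
    only [u] can be this point. *)
Lemma crossing_above (m : nat) (x u : R) : 0 <= x < 1 -> 0 <= u < 1 -> x != u ->
  b ^+ m * `|u - x| < 1 -> b ^+ m * `|u - x| <= iter m T x ->
  iter m T u = iter m T x + b ^+ m * (u - x) \/
  x < u /\ exists j, [/\ (j < m)%N,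
    forall i, (i <= j)%N -> iter i T u - iter i T x = b ^+ i * (u - x),
    1 <= b * iter j T u &
    forall i, (j < i <= m)%N -> iter i T u < b ^+ i * (u - x)].
Proof.
move=> /andP[x0 x1] /andP[u0 u1] xu hq hT.
case: (ltgtP x u) xu => // hxu _.
  rewrite gtr0_norm ?subr_gt0 // in hq.
  have [h|[j [h1 h2 h3 _ h4]]] := crossing hb x0 hxu u1 hq.
    by left; rewrite -h addrC subrK.
  by right; split=> //; exists j; split.
rewrite distrC gtr0_norm ?subr_gt0 // in hq hT.
have [h|[j [h1 h2 _ _ h4]]] := crossing hb u0 hxu x1 hq.
  by left; rewrite -opprB mulrN -h opprB addrC subrK.
by have := h4 m; rewrite h1 leqnn => /(_ isT); rewrite ltNge hT.
Qed.

(** The part of a branch below one of its points belongs to it.  Contraposed: a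
    discontinuity between [x] and [u] also separates [x] from every [v] above
    [u], no later than [u]. *)
Lemma crossing_lower (j : nat) (x u v : R) : 0 <= x < 1 -> 0 <= v < 1 ->
  x <= u -> u <= v -> iter j T v - iter j T x = b ^+ j * (v - x) ->
  b ^+ j * (u - x) <= iter j T u.
Proof.
move=> hx hv xu uv hl.
have bj : 0 < b ^+ j by rewrite exprn_gt0 // base_gt0.
have /andP[hT0 _] := iter_itv b j hx.
have e : iter j T v = iter j T x + b ^+ j * (v - x) by rewrite -hl addrC subrK.
have hle : b ^+ j * (v - u) <= iter j T v.
  rewrite e -[leLHS]add0r lerD // ler_pM2l //.
  by rewrite lerD2l lerN2.
have -> : u = v - b ^+ j * (v - u) / b ^+ j.
  by rewrite mulrAC divff ?gt_eqF // mul1r subKr.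
rewrite iter_down // ?mulr_ge0 ?subr_ge0 ?(ltW bj) // e.
rewrite mulrAC divff ?gt_eqF // mul1r subKr.
have -> : iter j T x + b ^+ j * (v - x) - b ^+ j * (v - u) =
  iter j T x + b ^+ j * (u - x) by ring.
by rewrite lerDr.
Qed.

(** The argument of Fine and Wilf: two returns [n < n'] to within less than
    [b^-n'] would make [T^(n + n') x] close to [x] in two incompatible ways.
    Near a discontinuity, [T^(n + n') x] is close to [0] instead; then the two
    returns have to cross it at the same time, whereas they are [n' - n] apart. *)
Lemma no_two_fast_returns (x : R) (n n' : nat) : 0 < x < 1 -> (0 < n < n')%N ->
  0 < `|iter n' T x - x| < `|iter n T x - x| ->
  3 * (b ^+ n' * `|iter n T x - x|) < x ->
  b * (b ^+ n' * `|iter n T x - x|) < 1 -> False.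
Proof.
move=> hx /andP[n0 nn'] /andP[]; set z := iter n T x; set z' := iter n' T x.
set d := `|z - x|; set d' := `|z' - x|; set q := b ^+ n' * d => d'0 d'd hq1 hq2.
have b0 := base_gt0 hb.
have hx1 : 0 <= x < 1 by case/andP: hx => /ltW -> ->.
have x0 : 0 < x by case/andP: hx.
have hz : 0 <= z < 1 by exact: iter_itv.
have hz' : 0 <= z' < 1 by exact: iter_itv.
have d0 : 0 < d by exact: lt_trans d'd.
have hbn : 1 < b ^+ n by rewrite exprn_egt1 // -lt0n.
have hbnn : b ^+ n < b ^+ n' by rewrite ltr_eXn2l.
have hbn' : 1 < b ^+ n' by exact: lt_trans hbnn.
have dq : d < q by rewrite /q ltr_pMl.
have q0 : 0 < q by exact: lt_trans dq.
have q1 : q < 1 by apply: lt_trans hq2; rewrite ltr_pMl.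
have q'q : b ^+ n * d' < q.
  by apply: ltr_pM => //; rewrite ltW // (lt_trans _ hbn).
have q'0 : 0 < b ^+ n * d' by rewrite mulr_gt0 // (lt_trans _ hbn).
have hcom : iter n' T z = iter n T z' by rewrite -!iterD addnC.
have dz : - d <= z - x <= d by rewrite -ler_norml lexx.
have dz' : - d' <= z' - x <= d' by rewrite -ler_norml lexx.
have bz : - q <= b ^+ n' * (z - x) <= q.
  by rewrite -ler_norml normrM ger0_norm ?(ltW (lt_trans _ hbn')).
have bz' : - (b ^+ n * d') <= b ^+ n * (z' - x) <= b ^+ n * d'.
  by rewrite -ler_norml normrM ger0_norm ?(ltW (lt_trans _ hbn)).
have xz : x != z by rewrite eq_sym -subr_eq0 -normr_gt0.
have xz' : x != z' by rewrite eq_sym -subr_eq0 -normr_gt0.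
have hTz : b ^+ n' * `|z - x| <= iter n' T x.
  rewrite -/d -/q -/z'; clear -dz' d'd dq hq1 q0; lra.
have hTz' : b ^+ n * `|z' - x| <= iter n T x.
  rewrite -/d' -/z; clear -dz dq q'q hq1 q0; lra.
have [h1|[ltxz [j1 [j1n hl _ hs]]]] := crossing_above hx1 hz xz q1 hTz;
have [h2|[ltxz' [j2 [j2n _ hj2 hs2]]]] :=
  crossing_above hx1 hz' xz' (lt_trans q'q q1) hTz'.
- have : (b ^+ n' - 1) * (z - x) = (b ^+ n - 1) * (z' - x).
    by move: hcom; rewrite h1 h2 -/z -/z'; clear; lra.
  move/(congr1 Num.norm); rewrite !normrM -/d -/d' !gtr0_norm ?subr_gt0 // => e.
  have : (b ^+ n - 1) * d' < (b ^+ n' - 1) * d.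
    by apply: ltr_pM; rewrite ?subr_ge0 ?ltrD2r // ltW.
  by rewrite e ltxx.
- have := hs2 n; rewrite j2n leqnn -hcom h1 -/z' => /(_ isT).
  by clear -q'q bz bz' dz' d'd dq hq1 q0; lra.
- have := hs n'; rewrite j1n leqnn hcom h2 -/z => /(_ isT).
  by clear -q'q bz bz' dz d'd dq hq1 q0; lra.
have ez : z - x = d by rewrite /d gtr0_norm // subr_gt0.
have ez' : z' - x = d' by rewrite /d' gtr0_norm // subr_gt0.
have zz' : z' <= z by rewrite -(lerD2r (- x)) ez ez' ltW.
have [j12|j21] := leqP j1 j2; last first.
  have := hs2 j2.+1; rewrite ltnSn j2n => /(_ isT); apply/negP; rewrite -leNgt.
  by apply: (@crossing_lower _ _ _ z); rewrite ?hl // ltW.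
have hi : (j1 < j2 + (n' - n) <= n')%N by clear - nn' j12 j2n; lia.
have e3 : iter (j2 + (n' - n)) T z = iter j2 T z'.
  by rewrite /z /z' -!iterD; congr (iter _ T x); clear - nn'; lia.
have := hs _ hi; rewrite e3 ez => h3.
have h4 : b ^+ (j2 + (n' - n)) * d <= q.
  by rewrite ler_pM2r // ler_eXn2l //; case/andP: hi.
have : b * iter j2 T z' < b * q by rewrite ltr_pM2l // (lt_le_trans h3).
by rewrite ltNge (le_trans (ltW hq2)).
Qed.

Lemma infty_decay (a t e : R) : 0 < t -> 0 < e ->
  exists N0 : nat, forall N : nat, (N0 <= N)%N -> b `^ (a - t * N%:R) < e.
Proof.
move=> t0 e0; have l0 : 0 < ln b by rewrite ln_gt0.
have b0 := base_gt0 hb.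
pose M := (a - ln e / ln b) / t.
exists (Num.truncn M).+1 => N hN.
have hM : M < N%:R by apply: lt_le_trans (truncnS_gt M) _; rewrite ler_nat.
rewrite /powR gt_eqF // -[ltRHS]lnK ?posrE // ltr_expR.
rewrite -ltr_pdivlMr // ltrBlDr -ltrBlDl.
by rewrite [ltRHS]mulrC -ltr_pdivrMr.
Qed.

(** Take the first return [n] at a large scale, and the next one [n'] when [n]
    ceases to be good enough: minimality of that scale keeps the distance at
    time [n] below [b^-(r (n' - 1))], and [r > 1]. *)
Lemma fast_return_periodic (r X0 x : R) : 1 < r -> 0 < x ->
  uniformly_recurrent b r X0 x -> exists2 n, (0 < n)%N & iter n T x = x.
Proof.
move=> r1 x0 hu; apply: contrapT => hper.
have b0 := base_gt0 hb; have [hx _] := hu.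
have hd n : (0 < n)%N -> 0 < `|iter n T x - x|.
  move=> n0; rewrite normr_gt0 subr_eq0; apply/eqP => h.
  by apply: hper; exists n.
pose eta := Num.min (x / 3) b^-1.
have eta0 : 0 < eta by rewrite lt_min divr_gt0 ?invr_gt0.
have [N1 hN1] := @infty_decay r (r - 1) eta (ltac:(lra)) eta0.
pose N0 := maxn N1 (Num.truncn X0).+1.
have hX0 : X0 <= N0%:R.
  apply: ltW; apply: lt_le_trans (truncnS_gt X0) _.
  by rewrite ler_nat leq_maxr.
have [n _ hn] := first_return_exists hu hX0.
have [[n0 hnd] _] := hn.
have [N2 hN2] := @infty_decay 0 r _ (ltac:(lra)) (hd n n0).
have ex : exists N : nat, b `^ (- (r * N%:R)) <= `|iter n T x - x|.
  by exists N2; rewrite ltW // -sub0r hN2.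
case: (ex_minnP ex) => N' hN' hmin.
have r0 : 0 < r by lra.
have N0N' : (N0 < N')%N.
  rewrite ltnNge; apply/negP => h; have := lt_le_trans hnd (lexx _).
  rewrite ltNge; apply/negP; rewrite negbK; apply: le_trans hN'.
  by apply: ler_powR; rewrite ?(ltW hb) // lerN2 ler_pM2l // ler_nat.
have hprev : `|iter n T x - x| < b `^ (- (r * (N'%:R - 1))).
  rewrite ltNge; apply/negP => h; have := hmin N'.-1.
  rewrite -subn1 natrB ?(leq_ltn_trans _ N0N') // => /(_ h).
  by rewrite leqNgt subn1 ltn_predL (leq_ltn_trans _ N0N').
have hNN : N0%:R <= N'%:R :> R by rewrite ler_nat ltnW.
have [n' n'N' hn'] := first_return_exists hu (le_trans hX0 hNN).
have [[n'0 hnd'] _] := hn'.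
have nn' : (n < n')%N.
  rewrite ltn_neqAle (first_return_le hb r0 hNN hn hn') andbT.
  apply/eqP => e; rewrite -e in hnd'.
  by have := lt_le_trans hnd' hN'; rewrite ltxx.
have hq : b ^+ n' * `|iter n T x - x| < eta.
  apply: lt_trans (hN1 N' _); last first.
    by apply: leq_trans (ltnW N0N'); exact: leq_maxl.
  have -> : r - (r - 1) * N'%:R = N'%:R + - (r * (N'%:R - 1)) by ring.
  rewrite powRD ?(gt_eqF b0) ?implybT // powR_mulrn ?(ltW b0) //.
  apply: (@le_lt_trans _ _ (b ^+ N' * `|iter n T x - x|)).
    by rewrite ler_pM2r ?hd // ler_eXn2l // -(ler_nat R).
  by rewrite ltr_pM2l // exprn_gt0.
have [q1 q2] : b ^+ n' * `|iter n T x - x| < x / 3 /\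
    b ^+ n' * `|iter n T x - x| < b^-1.
  by move: hq; rewrite lt_min => /andP.
apply: (@no_two_fast_returns x n n'); rewrite ?n0 ?nn' ?hd //.
- by rewrite x0; case/andP: hx.
- exact: lt_le_trans hnd' hN'.
- by rewrite mulrC -ltr_pdivlMr.
- by rewrite mulrC -ltr_pdivlMr // mul1r.
Qed.

End FastReturns.

(** * The exponent: negligible set, countable set, upper bound *)
Section Exponent.
Context (R : realType) (b : R) (hb : 1 < b).
Local Notation T := (beta_transformation b).

Lemma inv_power_EFin (N : nat) (r : R) :
  inv_power (b ^+ N) r%:E = (b `^ (- (r * N%:R)))%:E.
Proof.
rewrite /inv_power -powR_mulrn ?(ltW (base_gt0 hb)) // -powRrM.
by rewrite mulrN mulrC.
Qed.

Lemma exponent_returns (r : R) (x : R) :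
  (r%:E < uniform_recurrence_exponent b x)%E ->
  exists N0 : nat, forall N : nat, (N0 <= N)%N ->
    exists2 n : nat, (n <= N)%N & returns b r x N%:R n.
Proof.
move=> /ereal_sup_gt[e [e0 [N0 _ hN]] re]; exists N0 => N hN0.
have [n [/andP[n1 nN] hn]] := hN N hN0.
exists n => //; split=> //.
case: e e0 re hn {hN} => [e| |] // e0 re; last first.
  by rewrite /= lte_fin ltNge normr_ge0.
rewrite inv_power_EFin lte_fin => hn; apply: lt_le_trans hn _.
rewrite lte_fin in re; apply: ler_powR; first exact: ltW.
by rewrite lerN2 ler_wpM2r // ltW.
Qed.

(** Passing from integer to real scales costs a rounding, which the smaller
    exponent [r'] absorbs. *)
Lemma exponent_uniformly_recurrent (r r' : R) (x : R) : 0 <= x < 1 ->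
  0 < r' -> r' < r -> (r%:E <= uniform_recurrence_exponent b x)%E ->
  exists m : nat, uniformly_recurrent b r' m%:R x.
Proof.
move=> hx r'0 r'r hr; pose q := (r + r') / 2.
have rq : r' < q by rewrite /q; lra.
have qr : q < r by rewrite /q; lra.
have [|N0 hN] := @exponent_returns q x.
  by apply: lt_le_trans hr; rewrite lte_fin.
exists (N0 + (Num.truncn (q / (q - r'))).+1)%N; split=> // X hX.
have X0 : 0 <= X by apply: le_trans hX.
have /andP[h1 h2] := truncn_itv X0.
have hXN : N0%:R <= X by apply: le_trans hX; rewrite ler_nat leq_addr.
have hXq : q / (q - r') <= X.
  apply: le_trans hX; apply: ltW; apply: lt_le_trans (truncnS_gt _) _.
  by rewrite ler_nat leq_addl.
have [|n nN [n0 hn]] := hN (Num.truncn X); first by rewrite truncn_ge_nat.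
exists n; first by apply: le_trans h1; rewrite ler_nat.
split=> //; apply: lt_le_trans hn _; apply: ler_powR; first exact: ltW.
rewrite lerN2.
have h3 : q <= X * (q - r') by rewrite -ler_pdivrMr // subr_gt0.
have h4 : q * (X - 1) <= q * (Num.truncn X)%:R.
  rewrite ler_pM2l; last by lra.
  by rewrite lerBlDr natr1 ltW.
apply: le_trans h4; lra.
Qed.

Lemma exponent_ge0 (x : R) : 0 <= x < 1 ->
  (0 <= uniform_recurrence_exponent b x)%E.
Proof.
move=> hx; apply: ereal_sup_ubound; split=> //; exists 1%N => // N /= N1.
exists 1%N; rewrite N1; split=> //.
rewrite oppr0 powRr0 lte_fin.
have := @beta_transformation_itv _ b x; rewrite ltr_norml /=; lra.
Qed.

Lemma countable_fast (r : \bar R) : (1 < r)%E ->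
  countable [set x : R | 0 <= x < 1 /\ (r <= uniform_recurrence_exponent b x)%E].
Proof.
move=> r1; have [r' r'1 hr'] : exists2 r' : R, 1 < r' & (r'%:E <= r)%E.
  case: r r1 => [r| |] // r1; first by exists r.
  by exists 2; rewrite ?ltr1n ?leey.
apply: (@sub_countable _ _ _
  ([set 0 : R] `|` [set x : R | 0 <= x < 1 /\ exists2 n, (0 < n)%N & iter n T x = x])).
  apply: subset_card_le => x [hx hrx].
  have [->|x0] := eqVneq x 0; [by left|right; split=> //].
  have [m hm] := @exponent_uniformly_recurrent r' ((1 + r') / 2) x hx
    (ltac:(lra)) (ltac:(lra)) (le_trans hr' hrx).
  apply: (@fast_return_periodic _ b hb ((1 + r') / 2) m%:R); first by lra.
    by rewrite lt_def x0; case/andP: hx.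
  exact: hm.
rewrite -bigcup2E; apply: bigcup_countable => // -[|[|i]] _ /=.
- exact: countable1.
- exact: countable_periodic.
- exact: countable0.
Qed.

(** The condition on [s] is open in [r], so it holds for some [r' < r]; the sets
    are indexed by the scale from which the points recur with exponent [r']. *)
Lemma exponent_coverable (r s : R) : 0 < r <= 1 ->
  ((1 - r) / (1 + r)) ^+ 2 < s < 1 ->
  exists A : nat -> set R,
    (forall m e, 0 < e -> coverable s e (A m)) /\
    [set x : R | 0 <= x < 1 /\ (r%:E <= uniform_recurrence_exponent b x)%E]
      `<=` \bigcup_m A m.
Proof.
move=> hr hs.
have s0 : 0 < s.
  by case/andP: hs => h _; apply: le_lt_trans h; exact: sqr_ge0.
pose q := Num.sqrt s.
have q0 : 0 < q by rewrite sqrtr_gt0.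
have q2 : q ^+ 2 = s by rewrite sqr_sqrtr // ltW.
have q1 : q < 1 by rewrite -sqrtr1 ltr_sqrt //; case/andP: hs.
have hq : (1 - r) / (1 + r) < q.
  rewrite -(@ltr_pXn2r _ 2) ?q2 // ?nnegrE ?divr_ge0 //; try lra.
have hr0 : (1 - q) / (1 + q) < r.
  move: hq; rewrite !ltr_pdivrMr; lra.
pose r' := ((1 - q) / (1 + q) + r) / 2.
have p0 : 0 < (1 - q) / (1 + q) by rewrite divr_gt0 //; lra.
have hr' : (1 - q) / (1 + q) < r' < r by rewrite /r'; lra.
have r0 : 0 < r' by lra.
have hq' : (1 - r') / (1 + r') < q.
  move: hr'; rewrite !ltr_pdivrMr; lra.
exists (fun m => uniformly_recurrent b r' m%:R); split.
  move=> m e e0; apply: coverable_recurrent => //; first lra.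
  have -> /= : s < 1 by lra.
  rewrite andbT -q2 ltr_pXn2r // nnegrE ?divr_ge0 //; lra.
move=> x [hx hrx].
have [m hm] := @exponent_uniformly_recurrent r r' x hx
  (ltac:(lra)) (ltac:(lra)) hrx.
by exists m.
Qed.

Lemma coverable_unit_interval (s e : R) : 1 < s -> 0 < e ->
  coverable s e [set x : R | 0 <= x < 1].
Proof.
move=> s1 e0; have s10 : 0 < s - 1 by rewrite subr_gt0.
pose X := e `^ (- (s - 1)^-1).
have X0 : 0 < X by rewrite powR_gt0.
have [N hN] : exists N : nat, X < N%:R.
  by exists (Num.truncn X).+1; exact: truncnS_gt.
have N0 : 0 < N%:R :> R by exact: lt_trans hN.
exists [seq (i%:R / N%:R, N%:R^-1) | i <- iota 0 N]; split.
- by move=> p /mapP[i _ ->] /=; rewrite invr_ge0 ltW.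
- move=> x hx; have hxN : 0 <= x * N%:R by case/andP: hx => h _; rewrite mulr_ge0 // ltW.
  have /andP[h1 h2] := truncn_itv hxN.
  exists ((Num.truncn (x * N%:R))%:R / N%:R, N%:R^-1) => /=.
    apply: (map_f (fun i : nat => (i%:R / N%:R, N%:R^-1) : R * R)).
    rewrite mem_iota add0n /= truncn_lt_nat // -[ltRHS]mul1r ltr_pM2r //.
    by case/andP: hx.
  set k := (Num.truncn _)%:R.
  have -> : x - k / N%:R = (x * N%:R - k) / N%:R by rewrite mulrBl mulfK ?gt_eqF.
  rewrite normrM [X in _ * X]gtr0_norm ?invr_gt0 //.
  rewrite ler_piMl ?invr_ge0 ?(ltW N0) // ger0_norm ?subr_ge0 //.
  by rewrite lerBlDr addrC natr1 ltW.
rewrite big_map /= big_const_seq count_predT size_iota iter_addr_0.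
have -> : N%:R^-1 `^ s *+ N = (N%:R `^ (s - 1))^-1 :> R.
  rewrite -[LHS]mulr_natl.
  rewrite -powR_inv1 ?(ltW N0) // -powRrM -{1}[N%:R](powRr1 (ltW N0)).
  rewrite -powRD ?(gt_eqF N0) ?implybT // -powRN; congr (_ `^ _); ring.
rewrite invf_ple ?posrE ?powR_gt0 //.
have -> : e^-1 = X `^ (s - 1).
  by rewrite /X -powRrM mulNr mulVf ?gt_eqF // powR_inv1 // ltW.
by apply: ge0_ler_powR; rewrite ?nnegrE ltW.
Qed.

Lemma hausdorff_dim_upper (r : R) : 0 <= r <= 1 ->
  (hausdorff_dim [set x : R | (0 <= x < 1)%R /\ (r%:E <= uniform_recurrence_exponent b x)%E]
    <= (((1 - r) / (1 + r)) ^+ 2)%:E)%E.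
Proof.
move=> hr; apply/lee_addgt0Pr => e e0; rewrite -EFinD.
suff [s [A [hs s0 hA hsub]]] : exists (s : R) (A : nat -> set R),
    [/\ s <= ((1 - r) / (1 + r)) ^+ 2 + e, 0 < s,
      forall m e, 0 < e -> coverable s e (A m) &
      [set x : R | 0 <= x < 1 /\ (r%:E <= uniform_recurrence_exponent b x)%E]
        `<=` \bigcup_m A m].
  apply: (@le_trans _ _ s%:E); last by rewrite lee_fin.
  by apply: hausdorff_dim_le (ltW s0) _; exact: hausdorff_null s0 hA hsub.
have [->|r0] := eqVneq r 0.
  exists (1 + e), (fun=> [set x : R | 0 <= x < 1]); split.
  - by rewrite subr0 addr0 divr1 expr1n.
  - lra.
  - by move=> _ e' e'0; apply: coverable_unit_interval => //; lra.
  - by move=> x [hx _]; exists 0%N.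
have hr' : 0 < r <= 1 by rewrite lt_def r0.
set s0 := ((1 - r) / (1 + r)) ^+ 2.
have s00 : 0 <= s0 by exact: sqr_ge0.
have s01 : s0 < 1.
  rewrite /s0 expr_lt1 ?divr_ge0 //; try lra.
  rewrite ltr_pdivrMr; lra.
pose m := Num.min e (1 - s0).
have m0 : 0 < m by rewrite lt_min e0 subr_gt0.
have me : m <= e by rewrite ge_min lexx.
have ms : m <= 1 - s0 by rewrite ge_min lexx orbT.
have [|A [hA hsub]] := @exponent_coverable r (s0 + m / 2) hr'.
  by rewrite -/s0; clear hr hr' r0; lra.
by exists (s0 + m / 2), A; split=> //; lra.
Qed.

Lemma exponent_null : (@lebesgue_measure R).-negligible
  (`[0, 1[ `\` [set x : R | 0 <= x < 1 /\ uniform_recurrence_exponent b x = 0%E]).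
Proof.
have hneg : (@lebesgue_measure R).-negligible (\bigcup_k [set x : R |
    0 <= x < 1 /\ ((k.+1%:R^-1)%:E <= uniform_recurrence_exponent b x)%E]).
  apply: negligible_bigcup => k.
  set r : R := k.+1%:R^-1.
  have hr : 0 < r <= 1 by rewrite invr_gt0 ltr0n /= invf_le1 ?ler1n.
  pose s0 := ((1 - r) / (1 + r)) ^+ 2.
  have s00 : 0 <= s0 by exact: sqr_ge0.
  have s01 : s0 < 1.
    rewrite /s0 expr_lt1 ?divr_ge0 //; try lra.
    rewrite ltr_pdivrMr; lra.
  have [|A [hA hsub]] := @exponent_coverable r ((s0 + 1) / 2) hr; first by rewrite -/s0; lra.
have hN : (@lebesgue_measure R).-negligible (\bigcup_m A m).
  apply: negligible_bigcup => m.
    by apply: coverable_negligible (hA m); lra.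
  exact: (@negligibleS _ _ _ (@lebesgue_measure R) _ _ hsub hN).
apply: (@negligibleS _ _ _ (@lebesgue_measure R) _ _ _ hneg) => x [/= hx hn]; rewrite in_itv /= in hx.
have h0 := exponent_ge0 hx.
have : (0 < uniform_recurrence_exponent b x)%E.
  by rewrite lt_def h0 andbT; apply/eqP => h; apply: hn.
case E : (uniform_recurrence_exponent b x) => [e| |] // he.
  rewrite lte_fin in he; exists (Num.truncn e^-1) => //; split=> //.
  rewrite E lee_fin -[leRHS]invrK lef_pV2 ?posrE ?invr_gt0 ?ltr0n //.
  by rewrite ltW // truncnS_gt.
by exists 0%N => //; split=> //; rewrite E leey.
Qed.
End Exponent.

(** * Full branches and alphabets *)
Section Alphabet.
Context (R : realType) (b : R) (hb : 1 < b).
Local Notation T := (beta_transformation b).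

(** The branch of [T^l] that starts at [y] is full.  The margin [c0] keeps orbits
    away from [1], which is where the lower point of a crossing goes. *)
Definition full_branch (l : nat) (c0 y : R) : Prop :=
  [/\ 0 <= y, y + 2 / b ^+ l <= 1 & forall t, 0 <= t < 1 ->
    iter l T (y + t / b ^+ l) = t /\
    forall j, (j < l)%N -> iter j T (y + t / b ^+ l) <= 1 - c0].

Lemma iter_small (j : nat) (x : R) : 0 <= x -> b ^+ j * x < 1 ->
  iter j T x = b ^+ j * x.
Proof.
have b0 := base_gt0 hb; move=> x0.
elim: j => [|j IH] h; first by rewrite expr0 mul1r.
have h' : b * (b ^+ j * x) < 1 by rewrite mulrA -exprS.
have bx0 : 0 <= b ^+ j * x by rewrite mulr_ge0 // exprn_ge0 // ltW.
have h1 : b ^+ j * x < 1.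
  by apply: le_lt_trans h'; rewrite ler_peMl // ltW.
rewrite iterS IH // beta_transformation_small ?exprS ?mulrA //.
by rewrite -mulrA h' mulr_ge0 // ltW.
Qed.

(** Points of the lower half of a full branch have points of the same branch
    above them, at a distance that [T^j] expands: this keeps [T^j] away from
    [1]. *)
Lemma full_branch_margin (i j : nat) (a t : R) : 0 <= a -> a + b ^- i <= 1 ->
  (forall u, 0 <= u < 1 -> iter i T (a + u / b ^+ i) = u) ->
  0 <= t -> t <= 2^-1 -> (j <= i)%N ->
  iter j T (a + t / b ^+ i) <= 1 - b ^- i / 3.
Proof.
move=> a0 a1 ha t0 t1 ji.
have b0 := base_gt0 hb.
have bi : 0 < b ^+ i by rewrite exprn_gt0.
have bj : 0 < b ^+ j by rewrite exprn_gt0.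
have vi : 0 < b ^- i by rewrite invr_gt0.
pose w := a + (t + 3^-1) / b ^+ i.
have hw : 0 <= w < 1.
  rewrite /w; have h : (t + 3^-1) / b ^+ i < b ^- i.
    rewrite -[ltRHS]mul1r ltr_pM2r //; lra.
  have : 0 <= (t + 3^-1) / b ^+ i by rewrite mulr_ge0 ?(ltW vi) //; lra.
  lra.
have hTw : 0 <= iter j T w < 1 by exact: iter_itv.
pose y := w - iter j T w / b ^+ j.
have hwv : w - (a + t / b ^+ i) = b ^- i / 3 by rewrite /w; ring.
(* T^j has no discontinuity between the two points, because T^i does not
   vanish there *)
have hy : y <= a + t / b ^+ i.
  rewrite leNgt; apply/negP => h.
  have hyi : iter i T y = 0.
    by rewrite -(subnK ji) iterD iter_left_endpoint // iter_zero.
  have := ha ((y - a) * b ^+ i).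
  rewrite mulfK ?gt_eqF // (addrC a) subrK hyi => e.
  have yw : y <= w.
    by rewrite /y gerBl divr_ge0 ?(ltW bj) //; case/andP: hTw.
  have h1 : t < (y - a) * b ^+ i by rewrite -ltr_pdivrMr // ltrBrDl.
  have h2 : (y - a) * b ^+ i <= t + 3^-1.
    by rewrite -ler_pdivlMr // lerBlDl.
  have := e (ltac:(lra)); lra.
have hle : b ^+ j * (b ^- i / 3) <= iter j T w.
  by rewrite mulrC -ler_pdivlMr // -hwv; rewrite /y in hy; lra.
have -> : a + t / b ^+ i = w - b ^+ j * (b ^- i / 3) / b ^+ j.
  by rewrite mulrAC divff ?gt_eqF // mul1r -hwv subKr.
rewrite iter_down //; last first.
  by rewrite hle andbT mulr_ge0 // ?(ltW bj) // divr_ge0 // ltW.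
have : 1 * (b ^- i / 3) <= b ^+ j * (b ^- i / 3).
  rewrite ler_pM2r ?divr_gt0 // exprn_ege1 // ltW //.
lra.
Qed.

(** After a full branch of [T^i], the branch of [T^q] at [0] confines the points
    to the lower half. *)
Lemma full_branch_intro (i q : nat) (a : R) : 2 <= b ^+ q -> (0 < q)%N ->
  0 <= a -> a + b ^- i <= 1 ->
  (forall u, 0 <= u < 1 -> iter i T (a + u / b ^+ i) = u) ->
  full_branch (i + q) (Num.min (b ^- i / 3) (1 - b^-1)) a.
Proof.
move=> q2 q0 a0 a1 ha.
have b0 := base_gt0 hb.
have bi : 0 < b ^+ i by rewrite exprn_gt0.
have bq : 0 < b ^+ q by rewrite exprn_gt0.
have vi : 0 < b ^- i by rewrite invr_gt0.
have hq2 : 2 / b ^+ q <= 1 by rewrite ler_pdivrMr // mul1r.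
have he u : u / b ^+ (i + q) = (u / b ^+ q) / b ^+ i.
  by rewrite exprD invfM (mulrC (b ^- i)) mulrA.
split=> //.
  rewrite he; apply: le_trans a1; rewrite lerD2l -[leRHS]mul1r ler_pM2r //.
move=> t ht; rewrite he.
have ht1 : 0 <= t / b ^+ q <= 2^-1.
  apply/andP; split; first by rewrite divr_ge0 ?(ltW bq) //; case/andP: ht.
  rewrite ler_pdivrMr //; apply: (@le_trans _ _ (2^-1 * 2)); first by lra.
  by rewrite ler_pM2l.
have hi : iter i T (a + t / b ^+ q / b ^+ i) = t / b ^+ q by apply: ha; lra.
have /andP[t0 t1] := ht.
have htq : b ^+ q * (t / b ^+ q) = t by rewrite mulrC divfK // gt_eqF.
split.
  by rewrite addnC iterD hi iter_small ?htq //; case/andP: ht1.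
move=> j jl; have [ij|ji] := leqP i j; last first.
  apply: (@le_trans _ _ (1 - b ^- i / 3)).
    by apply: full_branch_margin => //; [case/andP: ht1..|exact: ltnW].
  by rewrite lerD2l lerN2 ge_min lexx.
rewrite -(subnK ij) iterD hi.
have hlt : b ^+ (j - i) * (t / b ^+ q) <= b^-1.
  rewrite mulrA ler_pdivrMr // ler_pdivlMl // mulrA -exprS.
  apply: (@le_trans _ _ (b ^+ (j - i).+1)).
    by rewrite ler_piMr ?exprn_ge0 ?ltW.
  rewrite ler_eXn2l //; clear - jl ij; lia.
have b1 : b^-1 < 1 by rewrite invf_lt1.
rewrite iter_small; [|by case/andP: ht1|exact: le_lt_trans b1].
apply: (@le_trans _ _ (1 - (1 - b^-1))); first by rewrite subKr.
by rewrite lerD2l lerN2 ge_min lexx orbT.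
Qed.

Lemma full_branch_left (i : nat) (y : R) : new_endpoint b i.+1 y ->
  [/\ 0 <= y - b ^- i.+1, y - b ^- i.+1 + b ^- i.+1 <= 1,
      forall u, 0 <= u < 1 ->
        iter i.+1 T (y - b ^- i.+1 + u / b ^+ i.+1) = u &
      y - b ^- i.+1 != 0 -> b ^- i.+1 <= y - b ^- i.+1].
Proof.
move=> hy; have b0 := base_gt0 hb; have [hy1 hy0 hyj] := hy.
have bi : 0 < b ^+ i.+1 by rewrite exprn_gt0.
have vi : 0 < b ^- i.+1 by rewrite invr_gt0.
have hu u : 0 <= u < 1 -> iter i.+1 T (y - b ^- i.+1 + u / b ^+ i.+1) = u.
  move=> hu1; have -> : y - b ^- i.+1 + u / b ^+ i.+1 = y - (1 - u) / b ^+ i.+1.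
    by ring.
  by rewrite (new_endpoint_full hb hy) ?subKr //; lra.
have ha : 0 <= y - b ^- i.+1.
  rewrite subr_ge0 leNgt; apply/negP => h.
  have := @iter_small i.+1 y; rewrite hy0.
  case/andP: hy1 => y0 y1 /(_ y0).
  rewrite mulrC -ltr_pdivlMr // mul1r h => /(_ isT)/eqP.
  rewrite eq_sym mulf_eq0 (gt_eqF bi) orbF => /eqP e.
  by have := hyj 0%N isT; rewrite /= e eqxx.
split=> //; first by rewrite subrK; case/andP: hy1 => _ /ltW.
set a := y - _ in ha hu *.
move=> a0; rewrite leNgt; apply/negP => h.
have := @iter_small i.+1 a ha; rewrite mulrC -ltr_pdivlMr // mul1r h => /(_ isT).
have := hu 0 (ltac:(lra)); rewrite mul0r addr0 => -> /eqP.
by rewrite eq_sym mulf_eq0 (gt_eqF bi) orbF (negbTE a0).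
Qed.

End Alphabet.

Lemma pigeonhole_fiber (J n : nat) (lev : 'I_J -> 'I_n.+1) :
  exists i, (J <= #|[pred j | lev j == i]| * n.+1)%N.
Proof.
pose f i := #|[pred j | lev j == i]|.
exists [arg max_(i > ord0) f i]; case: arg_maxnP => // i _ hi.
have e : (\sum_(k < n.+1) f k)%N = J.
  rewrite -[RHS]card_ord -[RHS]sum1_card [RHS](partition_big lev predT) //=.
  by apply: eq_bigr => k _; rewrite /f -sum1_card; apply: eq_bigl => j.
apply: leq_trans (eq_leq (esym e)) _.
apply: (@leq_trans (\sum_(k < n.+1) f i)).
  by apply: leq_sum => k _; exact: hi.
by rewrite sum_nat_const card_ord mulnC.
Qed.

Section AlphabetExists.
Context (R : realType) (b : R) (hb : 1 < b).
Local Notation T := (beta_transformation b).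

(** Words over [0, ..., M] name compositions of full branches of [T^l]; the
    symbol [0] is the branch at [0]. *)
Record alphabet (l M : nat) (c0 : R) (val : nat -> R) : Prop := {
  alphabet_l : (0 < l)%N;
  alphabet_M : (1 < M)%N;
  alphabet_c0 : 0 < c0;
  alphabet_base : 2 <= b ^+ l;
  alphabet_val0 : val 0%N = 0;
  alphabet_branch : forall m, (m <= M)%N -> full_branch b l c0 (val m);
  alphabet_sep : forall m m', (m <= M)%N -> (m' <= M)%N -> m != m' ->
    2 / b ^+ l <= `|val m - val m'| }.

(** The count needed below: [b^n] endpoints shared among [n + 1] levels still
    leave the growth rate [1 - e], at a scale that also pays for [q] steps. *)
Lemma large_scale (e : R) (q : nat) : 0 < e < 1 -> exists n : nat,
  2 <= (b ^+ n) `^ (1 - e) /\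
  (n.+1)%:R * ((b ^+ (n + q)) `^ (1 - e) + 1) + 1 <= b ^+ n.
Proof.
move=> he; have b0 := base_gt0 hb.
have [e0 e1] : 0 < e /\ 0 < 1 - e by lra.
have bq : 1 <= b ^+ q by rewrite exprn_ege1 // ltW.
have l0 : 0 < ln b by rewrite ln_gt0.
have C0 : 0 < 3 * b ^+ q by lra.
have [X [X1 hX1 hX]] := @poly_exp_small R b hb 1 e (3 * b ^+ q) 1
  (ln 2 / ln b / (1 - e)) 1 ler01 e0 C0 ltr01.
pose n := (Num.truncn X).+1.
have hn : X < n%:R by exact: truncnS_gt.
have hn' : n%:R <= X + 1.
  by rewrite /n -natr1 lerD2r; have := truncn_itv (ltac:(lra) : 0 <= X); lra.
clearbody n; exists n.
have bn k : (b ^+ k) `^ (1 - e) = b `^ (k%:R * (1 - e)).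
  by rewrite powRrM powR_mulrn // ltW.
split.
  rewrite bn -[leLHS]lnK ?posrE // /powR gt_eqF // ler_expR.
  rewrite -!ler_pdivrMr //; exact: le_trans hX1 (ltW hn).
have bD u v : b `^ (u + v) = b `^ u * b `^ v.
  by rewrite powRD // (gt_eqF b0) implybT.
set y := b `^ (- (e * n%:R)).
have y0 : 0 < y by rewrite powR_gt0.
have bn1 : 1 <= b ^+ n by rewrite exprn_ege1 // ltW.
have yb : 1 <= y * b ^+ n.
  rewrite /y -powR_mulrn ?(ltW b0) // -bD -[leLHS](powRr0 b).
  apply: ler_powR; first exact: ltW.
  have : 0 <= (1 - e) * n%:R by rewrite mulr_ge0 // ltW.
  by rewrite mulrBl mul1r addrC.
have h1 : (b ^+ (n + q)) `^ (1 - e) <= b ^+ q * (y * b ^+ n).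
  rewrite bn /y -!powR_mulrn ?(ltW b0) // -!bD.
  apply: ler_powR; first exact: ltW.
  rewrite natrD mulrDl.
  have : q%:R * (1 - e) <= q%:R by rewrite ler_piMr //; clear - he; lra.
  lra.
have yX : y <= b `^ (- (e * X)).
  apply: ler_powR; first exact: ltW.
  by rewrite lerN2 ler_pM2l // ltW.
have hfin : (n%:R + 1) * (3 * b ^+ q) * y <= 1.
  apply: le_trans hX; rewrite mul1r expr1.
  apply: ler_pM => //; first by rewrite mulr_ge0 ?(ltW C0) ?addr_ge0.
    exact: ltW.
  by rewrite ler_pM2r //; clear - hn'; lra.
have n1 : 1 <= n%:R + 1 :> R by rewrite lerDr.
have byb : y * b ^+ n <= b ^+ q * (y * b ^+ n).
  by rewrite ler_peMl //; apply: le_trans yb.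
apply: (@le_trans _ _ ((n%:R + 1) * (3 * b ^+ q) * y * b ^+ n)); last first.
  by rewrite ler_piMl // (le_trans _ bn1).
have -> : (n%:R + 1) * (3 * b ^+ q) * y * b ^+ n =
  (n%:R + 1) * (2 * (b ^+ q * (y * b ^+ n))) + (n%:R + 1) * (b ^+ q * (y * b ^+ n)).
  by ring.
apply: lerD.
  rewrite natr1; apply: ler_wpM2l => //.
  by clear - h1 yb byb; lra.
apply: le_trans (le_trans yb byb) _.
by rewrite ler_peMl //; apply: le_trans byb; apply: le_trans yb.
Qed.

(** Left endpoints of [T^n] are [b^-n]-dense, so that for some [i <= n] a
    fraction [1 / (n + 1)] of [b^n] of them are new at step [i].  Each of them
    has a full branch of [T^i] on its left, and [q] more steps separate these
    branches. *)
Lemma alphabet_exists (e : R) : 0 < e < 1 -> exists l M c0 val,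
  alphabet l M c0 val /\ (b ^+ l) `^ (1 - e) <= M%:R.
Proof.
move=> he; have b0 := base_gt0 hb.
have [q hq] : exists q : nat, 2 <= b ^+ q.
  have l0 : 0 < ln b by rewrite ln_gt0.
  exists (Num.truncn (ln 2 / ln b)).+1.
  rewrite -powR_mulrn ?(ltW b0) // -[leLHS]lnK ?posrE // /powR gt_eqF //.
  by rewrite ler_expR -ler_pdivrMr // ltW // truncnS_gt.
have q0 : (0 < q)%N by case: q hq => // ; rewrite expr0; lra.
have [n [hn2 hn]] := large_scale q he.
have bn : 0 < b ^+ n by rewrite exprn_gt0.
have vn : 0 < b ^- n by rewrite invr_gt0.
pose J := Num.truncn (b ^+ n).
have hJ : J%:R <= b ^+ n < J.+1%:R by apply: truncn_itv; exact: ltW.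
clearbody J.
pose x (j : nat) : R := j%:R / b ^+ n.
have hx (j : 'I_J) : 0 <= x j < 1.
  rewrite /x divr_ge0 ?(ltW bn) //= ltr_pdivrMr // mul1r.
  case/andP: hJ => hJ _; apply: lt_le_trans hJ; rewrite ltr_nat //.
pose y (j : nat) := x j - iter n T (x j) / b ^+ n.
have hy (j : 'I_J) : exists i : 'I_n.+1, new_endpoint b i (y j).
  have [i hi hi'] := new_endpoint_exists (left_endpoint_itv hb n (hx j))
    (iter_left_endpoint hb n (hx j)).
  by rewrite -ltnS in hi; exists (Ordinal hi).
have [lev hlev] := choice hy.
have ylt (j k : 'I_J) : (j < k)%N -> y j < y k.
  move=> jk; have := iter_itv b n (hx j); have := iter_itv b n (hx k).
  move=> hk hj.
  apply: (@le_lt_trans _ _ (x j)).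
    by rewrite gerBl divr_ge0 ?(ltW bn) //; case/andP: hj.
  rewrite /y /x -mulrBl ltr_pM2r //.
  have : j%:R + 1 <= k%:R :> R by rewrite natr1 ler_nat.
  by clear - hk; lra.
have [i hi] := pigeonhole_fiber lev.
set c := #|_| in hi.
have bq0 : 0 < b ^+ q by rewrite exprn_gt0.
set W := (b ^+ (n + q)) `^ (1 - e) in hn.
have e1 : 0 < 1 - e by clear - he; lra.
have bW k : (k <= n)%N -> (b ^+ (k + q)) `^ (1 - e) <= W.
  move=> kn; apply: ge0_ler_powR; rewrite ?nnegrE ?exprn_ge0 ?(ltW b0) ?(ltW e1) //.
  by rewrite ler_eXn2l // leq_add2r.
have W2 : 2 <= W.
  apply: (le_trans hn2); apply: ge0_ler_powR;
    rewrite ?nnegrE ?exprn_ge0 ?(ltW b0) ?(ltW e1) //.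
  by rewrite ler_eXn2l // leq_addr.
have yinj : injective (fun j : 'I_J => y j).
  move=> j k /= jk; apply/val_inj => /=.
  case: (ltngtP j k) => // h; first by have := ylt j k h; rewrite jk ltxx.
  by have := ylt k j h; rewrite jk ltxx.
have n1 : 0 < n.+1%:R :> R by rewrite ltr0n.
have Wc (m : nat) : (c <= m.+1)%N -> W < m%:R.
  move=> cm; have h1 : J%:R <= m.+1%:R * n.+1%:R :> R.
    rewrite -natrM ler_nat; apply: leq_trans hi _.
    by rewrite leq_mul2r cm orbT.
  have h2 : n.+1%:R * (W + 1) < n.+1%:R * (m%:R + 1).
    rewrite natr1 [ltRHS]mulrC; case/andP: hJ => _; rewrite -natr1 => h3.
    clear - hn h1 h3; lra.
  by move: h2; rewrite ltr_pM2l // ltrD2r.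
have i0 : (0 < i)%N.
  rewrite lt0n; apply/negP => /eqP hi0.
  have : (c <= 1)%N.
    apply/card_le1_eqP => j k; rewrite !inE => /eqP jl /eqP kl; apply: yinj.
    have [_ hj _] := hlev j; have [_ hk _] := hlev k.
    by move: hj hk; rewrite jl kl hi0 /= => -> ->.
  by move=> /Wc; rewrite ltNge (le_trans _ W2).
pose d := val i; have hd : d = d.-1.+1 by rewrite prednK.
have dn : (d <= n)%N by rewrite -ltnS ltn_ord.
have bd : 0 < b ^+ d by rewrite exprn_gt0.
have vd : 0 < b ^- d by rewrite invr_gt0.
pose F := [pred j : 'I_J | (lev j == i) && (y j != b ^- d)].
have hF j : j \in F -> new_endpoint b d (y j).
  by rewrite inE => /andP[/eqP jl _]; have := hlev j; rewrite jl.
pose sv := [seq y (nat_of_ord j) - b ^- d | j <- enum F].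
pose P u := u = 0 \/ exists2 j : 'I_J, j \in F & u = y j - b ^- d.
have svP k : (k <= size sv)%N -> P (nth 0 (0 :: sv) k).
  case: k => [|k] hk; first by left.
  right; have /mapP[j] : nth 0 sv k \in sv by exact: mem_nth.
  by rewrite mem_enum => jF e'; exists j.
have cF : (c <= #|F|.+1)%N.
  rewrite /c -(cardID [pred j : 'I_J | y j == b ^- d]) addnC -[leqRHS]addn1 leq_add //.
    apply: subset_leq_card.
    apply/fintype.subsetP => j; rewrite !inE.
    by case/andP => h1 h2; rewrite h1 h2.
  apply/card_le1_eqP => j k; rewrite !inE => /andP[_ /eqP yj] /andP[_ /eqP yk].
  by apply: yinj; rewrite yj yk.
have sz : size sv = #|F| by rewrite size_map -cardE.
have WM := Wc _ cF.
have sd2 : 2 / b ^+ (d + q) <= b ^- d.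
  rewrite exprD invfM mulrCA ler_piMr ?(ltW vd) // ler_pdivrMr // mul1r //.
have uq : uniq (0 :: sv).
  rewrite /= map_inj_uniq ?enum_uniq ?andbT; last by move=> j k /addIr /yinj.
  apply/negP => /mapP[j]; rewrite mem_enum inE => /andP[_ /eqP h1] /eqP.
  by rewrite eq_sym subr_eq0 => /eqP.
have Pbranch u : P u -> [/\ 0 <= u, u + b ^- d <= 1 &
    forall t, 0 <= t < 1 -> iter d T (u + t / b ^+ d) = t].
  case=> [->|[j /hF jF ->]].
    split=> //.
      by rewrite add0r invf_le1 // exprn_ege1 // ltW.
    move=> t /andP[t0 t1]; have e' : b ^+ d * (t / b ^+ d) = t.
      by rewrite mulrC divfK // gt_eqF.
    by rewrite add0r (iter_small hb) ?e' ?divr_ge0 ?(ltW bd).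
  by move: jF; rewrite hd => /(full_branch_left hb)[].
have Psep u v : P u -> P v -> u != v -> b ^- d <= `|u - v|.
  have h0 j : j \in F -> b ^- d <= y j - b ^- d.
    move=> jF; have := hF j jF; move: jF; rewrite inE => /andP[_].
    rewrite -subr_eq0 hd => h /(full_branch_left hb)[_ _ _ h']; exact: h'.
  move=> [->|[j jF ->]] [->|[k kF ->]].
  - by rewrite eqxx.
  - by move=> _; rewrite sub0r normrN; apply: le_trans (ler_norm _); exact: h0.
  - by move=> _; rewrite subr0; apply: le_trans (ler_norm _); exact: h0.
  rewrite (inj_eq (addIr _)) => jk.
  have -> : y j - b ^- d - (y k - b ^- d) = y j - y k by ring.
  case: (ltgtP (y j) (y k)) jk => // h _.
    by rewrite distrC; apply: le_trans (ler_norm _);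
      exact: (new_endpoint_sep hb (hF k kF) (hF j jF) h).
  by apply: le_trans (ler_norm _);
      exact: (new_endpoint_sep hb (hF j jF) (hF k kF) h).
exists (d + q)%N, #|F|, (Num.min (b ^- d / 3) (1 - b^-1)), (nth 0 (0 :: sv)).
split; last by rewrite ltW // (le_lt_trans (bW d dn)).
split.
- by rewrite addn_gt0 q0 orbT.
- by rewrite -(ltr_nat R); apply: le_lt_trans WM; rewrite (le_trans _ W2) // ler1n.
- by rewrite lt_min divr_gt0 // subr_gt0 invf_lt1.
- by rewrite exprD; apply: (le_trans hq); rewrite ler_peMl ?(ltW bq0) // exprn_ege1 // ltW.
- by [].
- move=> m mF; have [|h1 h2 h3] := Pbranch _ (svP m _); first by rewrite sz.
  exact: full_branch_intro.
- move=> m m' mF mF' mm'; apply: (le_trans sd2); apply: Psep.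
  + by apply: svP; rewrite sz.
  + by apply: svP; rewrite sz.
  + by rewrite nth_uniq //= sz ltnS.
Qed.

End AlphabetExists.

(** * Coding points by words *)
Section Coding.
Context (R : realType) (b : R) (hb : 1 < b) (l M : nat) (c0 : R) (val : nat -> R)
  (hA : alphabet b l M c0 val).
Local Notation T := (beta_transformation b).
Local Notation B := (b ^+ l).

Definition word (s : nat -> nat) := forall i, (s i <= M)%N.
Definition shift (k : nat) (s : nat -> nat) := fun i => s (k + i)%N.
(** Words are expansions in base [B] with digits [val], so that [T^l] acts as the
    shift. *)
Definition partial_code (s : nat -> nat) n := \sum_(i < n) val (s i) / B ^+ i.
Definition code s := sup (range (partial_code s)).

Lemma codeB_gt0 : 0 < B. Proof. by rewrite exprn_gt0 // base_gt0. Qed.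

Lemma codeBX_gt0 i : 0 < B ^+ i. Proof. by rewrite exprn_gt0 // codeB_gt0. Qed.

Lemma codeB_ge2 : 2 <= B. Proof. exact: alphabet_base hA. Qed.

Lemma word_shift k s : word s -> word (shift k s).
Proof. by move=> hs i; exact: hs. Qed.

Lemma val_itv m : (m <= M)%N -> 0 <= val m /\ val m + 2 / B <= 1.
Proof. by move=> /(alphabet_branch hA)[]. Qed.

Lemma val_pos m : (m <= M)%N -> m != 0%N -> 2 / B <= val m.
Proof.
move=> hm m0; have := alphabet_sep hA hm (leq0n M) m0.
by rewrite (alphabet_val0 hA) subr0 ger0_norm //; have [] := val_itv hm.
Qed.

Lemma partial_codeS s n :
  partial_code s n.+1 = val (s 0%N) + partial_code (shift 1 s) n / B.
Proof.
rewrite /partial_code big_ord_recl expr0 divr1; congr (_ + _).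
rewrite mulr_suml; apply: eq_bigr => i _.
by rewrite exprSr invfM mulrA.
Qed.

Lemma partial_code_ge0 s n : word s -> 0 <= partial_code s n.
Proof.
move=> hs; apply: sumr_ge0 => i _; apply: divr_ge0; last exact: ltW (codeBX_gt0 i).
by have [] := val_itv (hs i).
Qed.

Lemma partial_code_le s n : word s -> partial_code s n <= 1 - B^-1.
Proof.
have B0 := codeB_gt0; have vB : 0 < B^-1 by rewrite invr_gt0.
have B1 : B^-1 <= 1 by rewrite invf_le1 //; have := codeB_ge2; lra.
elim: n s => [|n IH] s hs; first by rewrite /partial_code big_ord0 subr_ge0.
rewrite partial_codeS; have [_ h] := val_itv (hs 0%N).
have h2 : partial_code (shift 1 s) n / B <= (1 - B^-1) / B.
  by rewrite ler_pM2r // IH //; exact: word_shift.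
have : 0 <= B^-1 * B^-1 by rewrite mulr_ge0 ?ltW.
lra.
Qed.

Lemma code_has_sup s : word s -> has_sup (range (partial_code s)).
Proof.
move=> hs; split; first by exists (partial_code s 0), 0%N.
by exists (1 - B^-1) => _ [n _ <-]; exact: partial_code_le.
Qed.

Lemma partial_code_le_code s n : word s -> partial_code s n <= code s.
Proof.
move=> hs; apply: ub_le_sup; last by exists n.
by case: (code_has_sup hs).
Qed.

Lemma code_le s x : word s -> (forall n, partial_code s n <= x) -> code s <= x.
Proof.
move=> hs h; apply: ge_sup; first by case: (code_has_sup hs).
by move=> _ [n _ <-].
Qed.

Lemma code_itv s : word s -> 0 <= code s <= 1 - B^-1.
Proof.
move=> hs; rewrite (le_trans (partial_code_ge0 0 hs) (partial_code_le_code 0 hs)) /=.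
by apply: code_le => // n; exact: partial_code_le.
Qed.

Lemma code_lt1 s : word s -> 0 <= code s < 1.
Proof.
move=> /code_itv/andP[-> h]; apply: le_lt_trans h _.
by rewrite gtrBl invr_gt0 codeB_gt0.
Qed.

Lemma code_shift1 s : word s -> code s = val (s 0%N) + code (shift 1 s) / B.
Proof.
have B0 := codeB_gt0; move=> hs; have hs1 := word_shift 1 hs.
apply/eqP; rewrite eq_le; apply/andP; split.
  apply: code_le => // -[|n].
    rewrite /partial_code big_ord0 addr_ge0 //; first by have [] := val_itv (hs 0%N).
    by rewrite divr_ge0 ?(ltW B0) //; case/andP: (code_itv hs1).
  by rewrite partial_codeS lerD2l ler_pM2r ?invr_gt0 // partial_code_le_code.
rewrite addrC -lerBrDr ler_pdivrMr //; apply: code_le => // n.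
by rewrite -ler_pdivrMr // lerBrDr addrC -partial_codeS partial_code_le_code.
Qed.

Lemma iter_code1 s : word s -> iter l T (code s) = code (shift 1 s) /\
  forall j, (j < l)%N -> iter j T (code s) <= 1 - c0.
Proof.
move=> hs; rewrite code_shift1 //.
have [_ _ h] := alphabet_branch hA (hs 0%N).
exact: (h _ (code_lt1 (word_shift 1 hs))).
Qed.

Lemma iter_code k s : word s -> iter (l * k) T (code s) = code (shift k s).
Proof.
elim: k s => [|k IH] s hs; first by rewrite muln0.
rewrite mulnS addnC iterD; have [-> _] := iter_code1 hs.
by rewrite IH //; exact: word_shift.
Qed.

Lemma iter_code_le j s : word s -> iter j T (code s) <= 1 - c0.
Proof.
move=> hs; rewrite (divn_eq j l) addnC iterD mulnC iter_code //.
apply: (iter_code1 (word_shift _ hs)).2.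
by rewrite ltn_mod (alphabet_l hA).
Qed.

Lemma code_agree s s' n : word s -> word s' ->
  (forall i, (i < n)%N -> s i = s' i) ->
  code s - code s' = (code (shift n s) - code (shift n s')) / B ^+ n.
Proof.
elim: n s s' => [|n IH] s s' hs hs' h; first by rewrite expr0 divr1.
have h1 i : (i < n)%N -> shift 1 s i = shift 1 s' i by move=> hi; apply: h.
have e := IH _ _ (word_shift 1 hs) (word_shift 1 hs') h1.
rewrite (code_shift1 hs) (code_shift1 hs') h //.
have -> : shift n.+1 s = shift n (shift 1 s).
  by apply/funext => i; rewrite /shift addSn.
have -> : shift n.+1 s' = shift n (shift 1 s').
  by apply/funext => i; rewrite /shift addSn.
rewrite opprD addrACA subrr add0r -mulrBl e exprSr invfM mulrA //.
Qed.

Lemma code_close s s' n : word s -> word s' ->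
  (forall i, (i < n)%N -> s i = s' i) -> `|code s - code s'| < B ^- n.
Proof.
move=> hs hs' h; rewrite (code_agree hs hs' h) normrM.
have Bn : 0 < B ^- n by rewrite invr_gt0 codeBX_gt0.
rewrite [X in _ * X]gtr0_norm // -[ltRHS]mul1r ltr_pM2r //.
have := code_lt1 (word_shift n hs); have := code_lt1 (word_shift n hs').
rewrite ltr_norml; lra.
Qed.

Lemma code_apart s s' n : word s -> word s' ->
  (forall i, (i < n)%N -> s i = s' i) -> s n != s' n ->
  B ^- n.+1 <= `|code s - code s'|.
Proof.
move=> hs hs' h hn; rewrite (code_agree hs hs' h) normrM.
have B0 := codeB_gt0.
have Bn : 0 < B ^- n by rewrite invr_gt0 exprn_gt0.
rewrite [X in _ * X]gtr0_norm // exprS invfM ler_pM2r //.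
have [hw hw'] := (word_shift n hs, word_shift n hs').
rewrite code_shift1 // (code_shift1 hw') /shift addn0.
have := alphabet_sep hA (hs n) (hs' n) hn.
set t := code _; set t' := code _.
have ht : 0 <= t < 1 by apply: code_lt1; exact: (word_shift 1 hw).
have ht' : 0 <= t' < 1 by apply: code_lt1; exact: (word_shift 1 hw').
have e : val (s n) - val (s' n) =
    (val (s n) + t / B - (val (s' n) + t' / B)) + (t' - t) / B by ring.
rewrite {1}e => h1.
have h2 : `|(t' - t) / B| <= B^-1.
  rewrite normrM [X in _ * X]gtr0_norm ?invr_gt0 // -[leRHS]mul1r ler_pM2r ?invr_gt0 //.
  by rewrite ler_norml; lra.
have := le_trans h1 (ler_normD _ _); lra.
Qed.

Lemma code_zeros s n : word s -> (forall i, (i < n)%N -> s i = 0%N) ->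
  code s < B ^- n.
Proof.
move=> hs h; have h0 : word (fun=> 0%N) by [].
have c00 : code (fun=> 0%N) = 0.
  apply/eqP; rewrite eq_le; case/andP: (code_itv h0) => -> _; rewrite andbT.
  apply: code_le => // k; rewrite /partial_code big1 // => i _.
  by rewrite (alphabet_val0 hA) mul0r.
have := code_close hs h0 h; rewrite c00 subr0 ger0_norm //.
by case/andP: (code_itv hs).
Qed.

Lemma code_nonzero s i : word s -> s i != 0%N -> 2 * B ^- i.+1 <= code s.
Proof.
move=> hs hi; apply: le_trans (partial_code_le_code i.+1 hs).
rewrite /partial_code big_ord_recr /= exprS invfM mulrA.
have Bn : 0 < B ^- i by rewrite invr_gt0 codeBX_gt0.
apply: (@le_trans _ _ (val (s i) / B ^+ i)).
  by rewrite ler_pM2r // val_pos.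
by rewrite lerDr; exact: (partial_code_ge0 i hs).
Qed.

(** Orbits of coded points never come close to [1], so no discontinuity can
    separate two such points that are close to each other. *)
Lemma code_linear s j n : word s ->
  b ^+ j * `|iter n T (code s) - code s| < c0 ->
  `|iter (j + n) T (code s) - iter j T (code s)| =
  b ^+ j * `|iter n T (code s) - code s|.
Proof.
move=> hs; have b0 := base_gt0 hb; set x := code s.
have hx : 0 <= x < 1 by exact: code_lt1.
have c01 : c0 <= 1.
  have := iter_code_le 0 hs; rewrite /= -/x; case/andP: hx => h _; lra.
have hz : 0 <= iter n T x < 1 by exact: iter_itv.
have bnd i : iter i T x <= 1 - c0 by exact: iter_code_le.
have bndz i : iter i T (iter n T x) <= 1 - c0 by rewrite -iterD; exact: iter_code_le.
rewrite iterD; set z := iter n T x in hz bndz *.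
suff main u v : 0 <= u -> u < v -> v < 1 -> (forall i, iter i T u <= 1 - c0) ->
    b ^+ j * (v - u) < c0 -> `|iter j T v - iter j T u| = b ^+ j * (v - u).
  have [x0 x1] := andP hx; have [z0 z1] := andP hz.
  case: (ltgtP x z) => [h|h|->]; last by rewrite !subrr normr0 mulr0.
    by rewrite (gtr0_norm (_ : 0 < z - x)) ?subr_gt0 //; exact: main.
  by rewrite !(distrC _ x) !(distrC _ (iter j T x)) (gtr0_norm (_ : 0 < x - z)) ?subr_gt0 //; exact: main.
move=> u0 uv v1 hu hlt.
have [|h|[i [ij _ _ h _]]] := crossing hb u0 uv v1 (m := j).
- by apply: lt_le_trans hlt _.
- by rewrite h ger0_norm // mulr_ge0 ?exprn_ge0 ?subr_ge0 ?ltW.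
have := hu i.+1; have : b ^+ i.+1 * (v - u) <= b ^+ j * (v - u).
  by rewrite ler_pM2r ?subr_gt0 // ler_eXn2l.
lra.
Qed.

End Coding.

(** * Words with prescribed copies of their prefixes *)
Section Construction.
Context (n L : nat -> nat).

(** The prefix of length [L k] is copied at position [n k]; a run of zeros that
    is longer than all previous ones marks the end [A k] of the copy, and the
    digits from [D k] to [n k.+1] are free. *)
Definition copy_end k := (n k + L k)%N.
(** The letter [1] stands at [copy_end k], followed by [2 k + 5] zeros. *)
Definition free_start k := (copy_end k + 2 * k + 6)%N.

(** Number of free digits before position [n k]. *)
Fixpoint free_count k := match k with
  | 0 => n 0
  | k'.+1 => (free_count k' + (n k'.+1 - free_start k'))%N
  end.

(** Only the values at positions below [n k] matter.  Since [L k] may exceed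
    [n k], copying the prefix means continuing with period [n k]. *)
Fixpoint stage (u : nat -> nat) k p := match k with
  | 0 => u p
  | k'.+1 =>
    if (p < copy_end k')%N then stage u k' (p %% n k')%N
    else if p == copy_end k' then 1%N
    else if (p < free_start k')%N then 0%N
    else u (free_count k' + (p - free_start k'))%N
  end.

Definition sequence_of u p := stage u p p.

Context (n0 : (0 < n 0)%N) (hn : forall k, (free_start k < n k.+1)%N).
Local Notation A := copy_end.
Local Notation D := free_start.

Lemma A_lt_D k : (A k < D k)%N.
Proof. by rewrite /free_start -addnA -ltn_subLR // subnn addn_gt0 orbT. Qed.

Lemma n_le_A k : (n k <= A k)%N. Proof. exact: leq_addr. Qed.

Lemma n_lt_n k : (n k < n k.+1)%N.
Proof.
by apply: leq_ltn_trans (n_le_A k) _; exact: ltn_trans (A_lt_D k) (hn k).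
Qed.

Lemma n_mono j k : (j <= k)%N -> (n j <= n k)%N.
Proof.
move=> jk; rewrite -(subnK jk); elim: (k - j)%N => // i IH.
by rewrite addSn; apply: leq_trans IH _; exact: ltnW (n_lt_n _).
Qed.

Lemma ltn_n k : (k < n k)%N.
Proof. by elim: k => // k IH; apply: leq_ltn_trans IH (n_lt_n k). Qed.

Lemma n_gt0 k : (0 < n k)%N. Proof. exact: leq_ltn_trans (ltn_n k). Qed.

Lemma stageS u k p : (p < n k)%N -> stage u k.+1 p = stage u k p.
Proof.
by move=> pk /=; rewrite (leq_trans pk (n_le_A k)) modn_small.
Qed.

Lemma stage_stable u j k p : (j <= k)%N -> (p < n j)%N ->
  stage u k p = stage u j p.
Proof.
move=> jk pj; rewrite -(subnK jk); elim: (k - j)%N => // i IH.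
rewrite addSn stageS ?IH //; apply: leq_trans pj (n_mono _); exact: leq_addl.
Qed.

Lemma sequence_stage u k p : (p < n k)%N -> sequence_of u p = stage u k p.
Proof.
move=> pk; rewrite /sequence_of; have [kp|pk'] := leqP k p.
  exact: stage_stable.
by rewrite (stage_stable u (ltnW pk')) // ltn_n.
Qed.

Lemma sequence_copy u k p : (n k <= p < A k)%N ->
  sequence_of u p = sequence_of u (p - n k).
Proof.
case/andP=> np pA; have h : (A k < n k.+1)%N by exact: ltn_trans (A_lt_D k) (hn k).
have pA' : (p - n k < A k)%N by exact: leq_ltn_trans (leq_subr _ _) pA.
rewrite (sequence_stage u (ltn_trans pA h)) (sequence_stage u (ltn_trans pA' h)).
by rewrite /= pA pA' -{1}(subnK np) modnDr.
Qed.

Lemma sequence_prefix u k i : (i < L k)%N ->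
  sequence_of u (n k + i) = sequence_of u i.
Proof.
by move=> iL; rewrite (@sequence_copy _ k) ?addKn // leq_addr /= ltn_add2l.
Qed.

Lemma sequence_one u k : sequence_of u (A k) = 1%N.
Proof.
rewrite (@sequence_stage _ k.+1); last exact: ltn_trans (A_lt_D k) (hn k).
by rewrite /= ltnn eqxx.
Qed.

Lemma sequence_zero u k p : (A k < p < D k)%N -> sequence_of u p = 0%N.
Proof.
case/andP=> Ap pD; rewrite (@sequence_stage _ k.+1); last exact: ltn_trans pD (hn k).
by rewrite /= ltnNge (ltnW Ap) /= gtn_eqF // pD.
Qed.

Lemma sequence_free u k p : (D k <= p < n k.+1)%N ->
  sequence_of u p = u (free_count k + (p - D k))%N.
Proof.
case/andP=> Dp pn; rewrite (@sequence_stage _ k.+1) //=.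
have Ap : (A k < p)%N by exact: leq_trans (A_lt_D k) Dp.
by rewrite ltnNge (ltnW Ap) /= gtn_eqF // ltnNge Dp.
Qed.

Lemma sequence_start u p : (p < n 0)%N -> sequence_of u p = u p.
Proof. by move=> h; rewrite (@sequence_stage _ 0). Qed.

Lemma sequence_le u M : (0 < M)%N -> (forall i, (u i <= M)%N) ->
  forall p, (sequence_of u p <= M)%N.
Proof.
move=> M0 hu p; rewrite /sequence_of.
suff h k q : (stage u k q <= M)%N by exact: h.
elim: k q => [|k IH] q //=.
by case: ifP => // _; case: ifP => // _; case: ifP.
Qed.

Lemma stage_agree u v k : (forall i, (i < free_count k)%N -> u i = v i) ->
  forall p, (p < n k)%N -> stage u k p = stage v k p.
Proof.
elim: k => [|k IH] h p pn /=; first exact: h.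
have hk p' : (p' < n k)%N -> stage u k p' = stage v k p'.
  by apply: IH => i hi; apply: h; apply: leq_trans hi _; exact: leq_addr.
case: ifP => [_|pA]; first by apply: hk; rewrite ltn_mod n_gt0.
case: ifP => // _; case: ifP => // pD; apply: h => /=.
by rewrite ltn_add2l; apply: ltn_sub2r.
Qed.

(** Copies only repeat what is already determined, so the first free digit that
    differs is also the first letter that differs.  The last clause locates it,
    for the comparison of [c] with [p]. *)
Lemma first_difference u v c : (forall i, (i < c)%N -> u i = v i) -> u c != v c ->
  exists p, [/\ forall i, (i < p)%N -> sequence_of u i = sequence_of v i,
    sequence_of u p != sequence_of v p &
    (p = c /\ (c < n 0)%N) \/
    exists k, (D k <= p < n k.+1)%N /\ c = (free_count k + (p - D k))%N].
Proof.
move=> h hc; have [c0|c0] := ltnP c (n 0).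
  exists c; split; [|by rewrite !sequence_start|by left].
  by move=> i ic; rewrite !sequence_start ?h // (ltn_trans ic).
have cc_inf k : (k <= free_count k)%N.
  elim: k => // k IH /=; have := hn k; clear - IH; lia.
have ex : exists k, (c < free_count k)%N by exists c.+1; exact: cc_inf.
case: (ex_minnP ex) => -[|k] hk hmin; first by rewrite ltnNge c0 in hk.
have ck : (free_count k <= c)%N.
  by rewrite leqNgt; apply/negP => /hmin; rewrite ltnn.
exists (D k + (c - free_count k))%N.
have hp : (D k <= D k + (c - free_count k) < n k.+1)%N.
  by rewrite leq_addr /=; have := hn k; rewrite /= in hk; lia.
have hce : c = (free_count k + (D k + (c - free_count k) - D k))%N by lia.
split.
- move=> i ip; have ink : (i < n k.+1)%N by case/andP: hp => _; exact: ltn_trans.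
  rewrite !(sequence_stage _ ink) /=.
  case: ifP => [_|iA].
    by apply: stage_agree; [move=> m mk; apply: h; exact: leq_trans ck|rewrite ltn_mod n_gt0].
  case: ifP => // _; case: ifP => // iD; apply: h.
  by rewrite ltnNge in iD; clear - ip iD ck; lia.
- by rewrite !(sequence_free _ hp) -hce.
- by right; exists k.
Qed.

(** Copies only contain runs from earlier stages, and the letter [1] at the end
    of a copy stops the run that the copy may have cut.  The run of stage
    [k - 1], of length [2 k + 3], is the longest one. *)
Lemma short_runs u : (forall i, u i != 0%N) -> forall k p, (p <= A k)%N ->
  exists i, [/\ (i <= 2 * k + 3)%N, (p + i <= A k)%N & sequence_of u (p + i) != 0%N].
Proof.
move=> hu k p; have [m] := ubnP p; elim: m k p => // m IHm k p pm pA.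
have hcopy j : (n j <= p < A j)%N -> (j <= k)%N ->
    exists i, [/\ (i <= 2 * j + 3)%N, (p + i <= A j)%N & sequence_of u (p + i) != 0%N].
  move=> hp jk; case/andP: (hp) => np pAj.
  have [||i [i1 i2 i3]] := IHm j (p - n j)%N.
  - by have := n_gt0 j; clear - np pm; lia.
  - by clear - pAj; lia.
  have [pi|pi] := ltnP (p + i) (A j).
    exists i; split=> //; first exact: ltnW.
    rewrite (@sequence_copy _ j) //; last by rewrite pi (leq_trans np) ?leq_addr.
    by rewrite (_ : (p + i - n j = p - n j + i)%N) //; clear - np; lia.
  exists (A j - p)%N; rewrite subnKC ?(ltnW pAj) // sequence_one; split=> //.
  by clear - i1 pi pAj; lia.
elim: k pA hcopy => [|k IHk] pA hcopy.
  have [p0|p0] := ltnP p (n 0).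
    by exists 0%N; rewrite addn0 sequence_start.
  have [pA0|] := ltnP p (A 0); first by apply: hcopy; rewrite ?p0.
  by move=> h; exists 0%N; rewrite addn0 (_ : p = A 0) ?sequence_one //; apply/eqP; rewrite eqn_leq pA.
have [pk|pk] := leqP p (A k).
  have [//||i [i1 i2 i3]] := IHk.
    by move=> j hj jk; apply: hcopy => //; exact: leqW.
  exists i; split=> //; first by clear - i1; lia.
  apply: leq_trans i2 _; apply: leq_trans (n_le_A _).
  by apply: ltnW; exact: ltn_trans (A_lt_D k) (hn k).
have [pD|pD] := ltnP p (D k).
  exists (D k - p)%N; rewrite subnKC ?(ltnW pD) //; split.
  - by rewrite /free_start; clear - pk; lia.
  - by apply: leq_trans (ltnW (hn k)) (n_le_A _).
  - by rewrite (@sequence_free _ k) // leqnn hn.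
have [pn|pn] := ltnP p (n k.+1).
  by exists 0%N; rewrite addn0 (@sequence_free _ k) // pD pn.
have [pA'|] := ltnP p (A k.+1); first by apply: hcopy; rewrite ?pn.
by move=> h; exists 0%N; rewrite addn0 (_ : p = A k.+1) ?sequence_one //; apply/eqP; rewrite eqn_leq pA.
Qed.

End Construction.

(** * Returns of the constructed points *)
Section CodedReturns.
Context (R : realType) (b : R) (hb : 1 < b) (l M : nat) (c0 : R) (val : nat -> R)
  (hA : alphabet b l M c0 val).
Context (n L : nat -> nat) (n0 : (0 < n 0)%N)
  (hn : forall k, (free_start n L k < n k.+1)%N)
  (hL : forall k, (L k <= L k.+1)%N).
Context (u : nat -> nat) (hu : forall i, (0 < u i <= M)%N).
Local Notation T := (beta_transformation b).
Local Notation B := (b ^+ l).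
Local Notation A := (copy_end n L).
Local Notation D := (free_start n L).
Local Notation s := (sequence_of n L u).
Local Notation x := (code b l val s).

Lemma sequence_word : word M s.
Proof.
apply: sequence_le; first exact: ltnW (alphabet_M hA).
by move=> i; case/andP: (hu i).
Qed.

Lemma digit_neq0 i : u i != 0%N.
Proof. by rewrite -lt0n; case/andP: (hu i). Qed.

Let B0 : 0 < B. Proof. by rewrite exprn_gt0 // base_gt0. Qed.
Let B1 : 1 < B. Proof. by apply: lt_le_trans (alphabet_base hA); rewrite ltr1n. Qed.
Let BX i : 0 < B ^+ i. Proof. by rewrite exprn_gt0. Qed.
Let VX i : 0 < B ^- i. Proof. by rewrite invr_gt0. Qed.
Let hx : 0 <= x < 1. Proof. exact: (code_lt1 hb hA sequence_word). Qed.

Lemma B_inv_le i j : (i <= j)%N -> B ^- j <= B ^- i.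
Proof. by move=> ij; rewrite lef_pV2 ?posrE // ler_eXn2l. Qed.

Lemma iter_le_expand i v : 0 <= v < 1 -> iter i T v <= b ^+ i * v.
Proof.
move=> hv; have b0 := base_gt0 hb.
case/andP: (left_endpoint_itv hb i hv) => h _.
by rewrite subr_ge0 ler_pdivrMr ?exprn_gt0 // mulrC in h.
Qed.

Lemma iter_at_mark k : iter (l * (A k).+1) T x < B ^- (2 * k + 5).
Proof.
rewrite (iter_code hb hA _ sequence_word).
apply: (code_zeros hb hA); first exact: word_shift sequence_word.
move=> i ik; apply: (@sequence_zero n L n0 hn u k).
by rewrite /free_start; clear - ik; lia.
Qed.

(** Letters control the orbit at multiples of [l] only; from time [t] to the
    next multiple it grows at most [B]-fold. *)
Lemma iter_lower t p i : (t <= l * p)%N -> (l * p < t + l)%N ->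
  s (p + i) != 0%N -> 2 * B ^- (i + 2) <= iter t T x.
Proof.
move=> tp pt hs.
have h1 : 2 * B ^- i.+1 <= iter (l * p) T x.
  rewrite (iter_code hb hA _ sequence_word).
  by apply: (code_nonzero hb hA (s := shift p s)); first exact: word_shift sequence_word.
have ht : 0 <= iter t T x < 1 by exact: iter_itv.
have h2 : iter (l * p) T x <= B * iter t T x.
  rewrite -(subnK tp) iterD; apply: (le_trans (iter_le_expand _ ht)).
  apply: ler_wpM2r; first by case/andP: ht.
  by rewrite ler_eXn2l //; clear - pt tp; lia.
rewrite addn2 exprS invfM mulrCA -ler_pdivlMl ?invr_gt0 // invrK.
exact: le_trans h1 h2.
Qed.

Lemma ceil_div t : exists p, (t <= l * p)%N /\ (l * p < t + l)%N.
Proof.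
have l0 := alphabet_l hA.
exists ((t + l.-1) %/ l)%N.
have := divn_eq (t + l.-1) l; have := ltn_pmod (t + l.-1) l0.
move: ((t + l.-1) %/ l)%N ((t + l.-1) %% l)%N => d m hm e.
by rewrite mulnC; clear - e hm l0; lia.
Qed.

Lemma iter_before_mark k t : (t <= l * A k)%N -> 2 * B ^- (2 * k + 5) <= iter t T x.
Proof.
move=> tA; have [p [tp pt]] := ceil_div t.
have pA : (p <= A k)%N.
  rewrite leqNgt; apply/negP => h.
  have h2 : (l * (A k).+1 <= l * p)%N by rewrite leq_mul2l h orbT.
  by move: h2 pt tA; rewrite mulnS; clear; lia.
have [i [i1 _ i3]] := short_runs n0 hn digit_neq0 pA.
apply: le_trans (iter_lower tp pt i3); rewrite ler_pM2l // B_inv_le //.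
by clear - i1; lia.
Qed.

Lemma iter_free k t : (l * D k <= t)%N -> (t <= l * (n k.+1).-1)%N ->
  2 * B ^- 2 <= iter t T x.
Proof.
move=> Dt tn; have [p [tp pt]] := ceil_div t; have l0 := alphabet_l hA.
apply: (iter_lower tp pt (i := 0)); rewrite addn0 (@sequence_free n L n0 hn u k) ?digit_neq0 //.
apply/andP; split.
  by rewrite -(leq_pmul2l l0); exact: leq_trans tp.
have := hn k; rewrite -(ltn_pmul2l l0) => hDn.
rewrite ltnNge; apply/negP => h.
have h2 : (l * n k.+1 <= l * p)%N by rewrite leq_mul2l h orbT.
have h3 : (n k.+1 = (n k.+1).-1.+1)%N by rewrite prednK // (n_gt0 n0 hn).
by move: h2 pt tn; rewrite {1}h3 mulnS; clear; lia.
Qed.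

(** If the return at time [m] lasted until the run of zeros of stage [k], then
    [x] would contain a comparable run at an earlier place, contrary to
    [short_runs]. *)
Lemma return_before_mark k m : (l <= m)%N -> (m <= l * (A k).+1)%N ->
  c0 * B ^- (2 * k + 5) <= b ^+ (l * (A k).+1 - m) * `|iter m T x - x|.
Proof.
move=> lm mA; set j := (_ - m)%N; rewrite leNgt; apply/negP => h.
have c00 := alphabet_c0 hA.
have c01 : c0 <= 1.
  have := iter_code_le hb hA 0 sequence_word => /=; case/andP: hx => h0 _.
  by move=> h1; have := le_trans h0 h1; rewrite subr_ge0.
have hc : c0 * B ^- (2 * k + 5) <= c0.
  by rewrite ler_piMr ?(ltW c00) // invf_le1 // exprn_ege1 // ltW.
have hlin := code_linear hb hA sequence_word (lt_le_trans h hc).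
have jm : (j + m = l * (A k).+1)%N by rewrite /j subnK.
rewrite jm in hlin.
have h1 := iter_at_mark k.
have h2 : 2 * B ^- (2 * k + 5) <= iter j T x.
  by apply: iter_before_mark; rewrite /j mulnS; clear - lm; lia.
have h3 : c0 * B ^- (2 * k + 5) <= B ^- (2 * k + 5) by rewrite ler_piMl // ltW.
have : iter j T x - iter (l * (A k).+1) T x <= b ^+ j * `|iter m T x - x|.
  by rewrite -hlin distrC ler_norm.
lra.
Qed.

(** A return that starts after the run of stage [k] and lasts for a time
    [l (A j + 1)] would carry the run of stage [j] into the zone of free digits,
    which contains no zeros. *)
Lemma return_in_free_zone k j m : (l * (A k).+1 <= m)%N ->
  (2 * k + 5 <= (A j).+1)%N ->
  (m + l * (A j).+1 <= l * (n k.+1).-1)%N ->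
  c0 * B ^- 5 <= B ^+ (A j).+1 * `|iter m T x - x|.
Proof.
move=> Am hq mn; rewrite leNgt; apply/negP => h.
have c00 := alphabet_c0 hA.
have c01 : c0 <= 1.
  have := iter_code_le hb hA 0 sequence_word => /=; case/andP: hx => h0 _.
  by move=> h1; have := le_trans h0 h1; rewrite subr_ge0.
have hc : c0 * B ^- 5 <= c0.
  by rewrite ler_piMr ?(ltW c00) // invf_le1 // exprn_ege1 // ltW.
have h' := lt_le_trans h hc; rewrite -exprM in h' h.
have hlin := code_linear hb hA sequence_word h'.
have h1 : iter (l * (A j).+1) T x < B ^- 5.
  by apply: lt_le_trans (iter_at_mark j) _; rewrite B_inv_le //; clear; lia.
have h2 : 2 * B ^- 2 <= iter (l * (A j).+1 + m) T x.
  apply: (@iter_free k); last by rewrite addnC.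
  apply: (@leq_trans (l * (A j).+1 + l * (A k).+1)); last by rewrite leq_add2l.
  by rewrite -mulnDr leq_mul2l /free_start; apply/orP; right; clear - hq; lia.
have h3 : c0 * B ^- 5 <= B ^- 5 by rewrite ler_piMl // ltW.
have h4 : B ^- 5 <= B ^- 2 by exact: B_inv_le.
have : iter (l * (A j).+1 + m) T x - iter (l * (A j).+1) T x <=
    b ^+ (l * (A j).+1) * `|iter m T x - x|.
  by rewrite -hlin ler_norm.
lra.
Qed.

Lemma expand_bound (a d m e : nat) (y : R) : 0 <= y -> (a <= l * d)%N ->
  (d + m <= e)%N -> c0 * B ^- m <= b ^+ a * y -> c0 <= B ^+ e * y.
Proof.
move=> y0 ad dme; rewrite ler_pdivrMr // => h; apply: (le_trans h).
rewrite mulrAC; apply: ler_wpM2r => //.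
apply: (@le_trans _ _ (B ^+ (d + m))); last by rewrite ler_eXn2l.
by rewrite exprD -(exprM b l d) ler_pM2r // ler_eXn2l.
Qed.

Lemma L_mono i j : (i <= j)%N -> (L i <= L j)%N.
Proof.
move=> ij; rewrite -(subnK ij); elim: (j - i)%N => // k IH.
by rewrite addSn; exact: leq_trans IH (hL _).
Qed.

(** A return at time [m] in stage [k] is cut short by the run that ends the copy
    if it precedes this run, by the free zone if there is room for a run of
    stage [j] before [n (k + 1)], and by the run of stage [k + 1] otherwise. *)
Lemma return_bound_before k j m : (2 * k + 5 <= (A j).+1)%N ->
  (l <= m)%N -> (m <= l * n k)%N ->
  c0 <= B ^+ (L k + A j + 2 * k + 8) * `|iter m T x - x|.
Proof.
move=> + lm; elim: k => [|k IH] hq mn.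
  have A0j : (A 0 <= A j)%N by rewrite leq_add ?(n_mono hn) ?L_mono.
  have mA : (m <= l * (A 0).+1)%N.
    apply: leq_trans mn _; rewrite leq_mul2l /copy_end; apply/orP; right; clear; lia.
  apply: (expand_bound _ _ _ (return_before_mark lm mA) (d := A 0)) => //.
    by rewrite mulnS; clear - lm; lia.
  by clear - A0j; lia.
have hLk := hL k.
have [mk|km] := leqP m (l * n k).
  have hq' : (2 * k + 5 <= (A j).+1)%N by clear - hq; lia.
  apply: (le_trans (IH hq' mk)); apply: ler_wpM2r => //.
  by rewrite ler_eXn2l //; clear - hLk; lia.
have [mA|Am] := leqP m (l * (A k).+1).
  apply: (expand_bound _ _ _ (return_before_mark lm mA) (d := (L k).+1)) => //.
    by move: km; rewrite /copy_end !mulnS !mulnDr; clear; lia.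
  by clear - hLk; lia.
have [mz|zm] := leqP (m + l * (A j).+1) (l * (n k.+1).-1).
  have hq' : (2 * k + 5 <= (A j).+1)%N by clear - hq; lia.
  have := return_in_free_zone (ltnW Am) hq' mz; rewrite -(exprM b l (A j).+1) => h.
  by apply: (expand_bound _ _ _ h (d := (A j).+1)) => //; clear; lia.
have mA : (m <= l * (A k.+1).+1)%N.
  apply: leq_trans mn _; rewrite leq_mul2l /copy_end; apply/orP; right; clear; lia.
apply: (expand_bound _ _ _ (return_before_mark lm mA) (d := (L k.+1 + A j + 3)%N)) => //.
  have h3 : (n k.+1 = (n k.+1).-1.+1)%N by rewrite prednK // (n_gt0 n0 hn).
  move: zm; rewrite /(copy_end _ _ k.+1) {2}h3 !(mulnS, mulnDr); clear; lia.
by clear; lia.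
Qed.

Lemma return_bound_free k j m : (2 * k + 5 <= (A j).+1)%N ->
  (l <= m)%N -> (m + l * (A j).+1 <= l * (n k.+1).-1)%N ->
  c0 <= B ^+ (L k + A j + 2 * k + 8) * `|iter m T x - x|.
Proof.
move=> hq lm mz; have [mk|km] := leqP m (l * n k).
  exact: return_bound_before.
have [mA|Am] := leqP m (l * (A k).+1).
  apply: (expand_bound _ _ _ (return_before_mark lm mA) (d := (L k).+1)) => //.
    by move: km; rewrite /copy_end !mulnS !mulnDr; clear; lia.
  by clear; lia.
have := return_in_free_zone (ltnW Am) hq mz; rewrite -(exprM b l (A j).+1) => h.
by apply: (expand_bound _ _ _ h (d := (A j).+1)) => //; clear; lia.
Qed.

Lemma return_at_copy k : `|iter (l * n k) T x - x| < B ^- L k.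
Proof.
rewrite (iter_code hb hA _ sequence_word).
apply: (code_close hb hA); [exact: word_shift sequence_word|exact: sequence_word|].
by move=> i iL; exact: sequence_prefix.
Qed.

End CodedReturns.

(** * The exponent of the constructed points *)
Section CodedExponent.
Context (R : realType) (b : R) (hb : 1 < b) (l M : nat) (c0 : R) (val : nat -> R)
  (hA : alphabet b l M c0 val).
Context (n L : nat -> nat) (n0 : (0 < n 0)%N)
  (hn : forall k, (free_start n L k < n k.+1)%N)
  (hL : forall k, (L k <= L k.+1)%N).
Context (r : R) (r0 : 0 <= r)
  (hLr : forall k, r * (n k.+1)%:R <= (L k)%:R <= r * (n k.+1)%:R + 1).
(** Marks of a stage [j] that are far from the origin compared with the run
    lengths of stage [k], and yet negligible compared with [n k.+1]. *)
Context (hsparse : forall (d C : R) (K : nat), 0 < d -> exists k j,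
    [/\ (K <= k)%N, (2 * k + 5 <= (copy_end n L j).+1)%N &
        (copy_end n L j)%:R + (2 * k)%:R + C <= d * (n k.+1)%:R]).
Context (u : nat -> nat) (hu : forall i, (0 < u i <= M)%N).
Local Notation T := (beta_transformation b).
Local Notation B := (b ^+ l).
Local Notation A := (copy_end n L).
Local Notation x := (code b l val (sequence_of n L u)).

Lemma coded_itv : 0 <= x < 1.
Proof. exact: (code_lt1 hb hA (sequence_word hA n L hu)). Qed.

(** Between [l (n k)] and [l (n (k + 1))] the return at time [l (n k)] is used. *)
Lemma coded_exponent_ge : (r%:E <= uniform_recurrence_exponent b x)%E.
Proof.
have b0 := base_gt0 hb; have l0 := alphabet_l hA.
apply: ereal_sup_ubound; split; first by rewrite lee_fin.
exists (l * n 0)%N => // N /= hN.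
have ex : exists k, (N < l * n k.+1)%N.
  exists N; apply: leq_trans (ltnW (ltn_n n0 hn N.+1)) _.
  by rewrite leq_pmull.
case: (ex_minnP ex) => k hk hmin.
have hkN : (l * n k <= N)%N.
  case: k hk hmin => // k _ hmin; rewrite leqNgt; apply/negP => /hmin.
  by rewrite ltnn.
exists (l * n k)%N; rewrite hkN muln_gt0 l0 (n_gt0 n0 hn); split=> //.
have [->] := inv_power_EFin hb N r; rewrite lte_fin.
apply: lt_le_trans (return_at_copy hb hA n0 hn hu k) _.
rewrite -exprM -powR_mulrn ?(ltW b0) // -powRN.
apply: ler_powR; first exact: ltW.
rewrite lerN2 natrM; have /andP[h _] := hLr k.
apply: (@le_trans _ _ (r * (l * n k.+1)%:R)).
  by apply: ler_wpM2l => //; rewrite ler_nat ltnW.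
by rewrite natrM mulrCA; apply: ler_wpM2l.
Qed.

Lemma coded_not_periodic m : (0 < m)%N -> 0 < `|iter m T x - x|.
Proof.
move=> m0; have l0 := alphabet_l hA; rewrite normr_gt0 subr_eq0; apply/eqP => h.
have [k [j [km hq _]]] := @hsparse 1 0 m ltr01.
have hm i : iter (i * m) T x = x by elim: i => // i IH; rewrite mulSn iterD IH.
have lm : (l <= l * m)%N by rewrite leq_pmulr.
have mk : (l * m <= l * n k)%N.
  by rewrite leq_mul2l (leq_trans km (ltnW (ltn_n n0 hn k))) orbT.
have := return_bound_before hb hA n0 hn hL hu hq lm mk.
by rewrite hm subrr normr0 mulr0 leNgt (alphabet_c0 hA).
Qed.

(** Shortly before [l (n (k + 1))] no return time up to now agrees with [x] on
    much more than [L k <= r (n (k + 1)) + 1] letters. *)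
Lemma coded_exponent_le : (uniform_recurrence_exponent b x <= r%:E)%E.
Proof.
have b0 := base_gt0 hb; have l0 := alphabet_l hA; have hx := coded_itv.
rewrite leNgt; apply/negP => hlt.
have [q rq hq] : exists2 q : R, r < q & (q%:E < uniform_recurrence_exponent b x)%E.
  case: (uniform_recurrence_exponent b x) hlt => [e| |] //.
    rewrite lte_fin => re; exists ((r + e) / 2); rewrite ?lte_fin; lra.
  by exists (r + 1); rewrite ?ltry // ltrDl.
have q0 : 0 < q by exact: le_lt_trans rq.
have [N0 hN0] := exponent_returns hb hq.
(* return_bound_free only speaks of times from l on; the earlier ones keep a
   positive distance because x is not periodic *)
have hpos K : exists N1 : nat, forall m N, (0 < m < K)%N -> (N1 <= N)%N ->
    b `^ (- (q * N%:R)) < `|iter m T x - x|.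
  elim: K => [|l' [N1 IH]]; first by exists 0%N => m N; rewrite ltn0 andbF.
  have [->|l'0] := posnP l'.
    by exists 0%N => m N; case: m.
  have [N2 hN2] := @infty_decay _ b hb 0 q _ q0 (coded_not_periodic l'0).
  exists (maxn N1 N2) => m N /andP[m0]; rewrite ltnS leq_eqVlt geq_max.
  move=> /predU1P[->|ml] /andP[h1 h2]; first by rewrite -sub0r hN2.
  by apply: IH => //; rewrite m0.
have [N1 hN1] := hpos l.
have [G hG] : exists G : nat, b `^ (- G%:R) < c0.
  have [G hG] := @infty_decay _ b hb 0 1 _ ltr01 (alphabet_c0 hA).
  by exists G; have := hG G (leqnn G); rewrite sub0r mul1r.
pose d := Num.min ((q - r) / (1 + q)) 1.
have d0 : 0 < d by rewrite lt_min ltr01 andbT divr_gt0 // ?subr_gt0 // addr_gt0.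
have [k [j [_ hqj hkj]]] := @hsparse d (11 + G%:R + N0%:R + N1%:R) 0 d0.
have [a ea] : exists a, a = A j by exists (A j).
have [X eX] : exists X, X = n k.+1 by exists (n k.+1).
rewrite -?ea -?eX in hqj hkj.
have X0 : 0 <= X%:R :> R by [].
have k2 : 0 <= (2 * k)%:R :> R by [].
have G0 : 0 <= G%:R :> R by [].
have N00 : 0 <= N0%:R :> R by [].
have N10 : 0 <= N1%:R :> R by [].
have hX1 : a%:R + (11 + G%:R + N0%:R + N1%:R) <= X%:R :> R.
  have : d * X%:R <= X%:R by rewrite ler_piMl // ge_min lexx orbT.
  lra.
have hX2 : (1 + q) * (a%:R + (2 * k)%:R + (11 + G%:R + N0%:R + N1%:R)) <= (q - r) * X%:R.
  have h1 : d * X%:R <= (q - r) / (1 + q) * X%:R.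
    by apply: ler_wpM2r => //; rewrite ge_min lexx.
  have := le_trans hkj h1; rewrite mulrAC ler_pdivlMr; last by lra.
  by rewrite [leLHS]mulrC.
have hXn : (a + 2 + N0 + N1 <= X)%N.
  by rewrite -(ler_nat R) !natrD; lra.
pose N := (l * (X.-1 - a.+1))%N.
have hNge : (N0 + N1 <= N)%N.
  apply: (@leq_trans (X.-1 - a.+1)%N); first by clear - hXn; lia.
  by rewrite leq_pmull.
have [m mN [m0 hm]] := hN0 N (leq_trans (leq_addr _ _) hNge).
have [ml|lm] := ltnP m l.
  have := hN1 m N; rewrite m0 ml (leq_trans (leq_addl _ _) hNge) => /(_ isT isT).
  by rewrite ltNge ltW.
have hmN : (m + l * a.+1 <= l * (n k.+1).-1)%N.
  have -> : (n k.+1).-1 = (X.-1 - a.+1 + a.+1)%N by clear - hXn eX; lia.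
  by rewrite mulnDr leq_add2r.
rewrite ea in hqj hmN.
have hc := return_bound_free hb hA n0 hn hL hu hqj lm hmN.
set E := (L k + A j + 2 * k + 8)%N in hc.
have hlt2 : b `^ (- G%:R) < b `^ ((l * E)%:R - q * N%:R).
  apply: (lt_le_trans hG); apply: (le_trans hc).
  rewrite powRD ?(gt_eqF b0) ?implybT // powR_mulrn ?(ltW b0) // exprM.
  by apply: ler_wpM2l; [rewrite !exprn_ge0 // ltW|exact: ltW].
have hexp : - G%:R < (l * E)%:R - q * N%:R.
  rewrite ltNge; apply/negP => h; move: hlt2; apply/negP; rewrite -leNgt.
  by apply: ler_powR => //; exact: ltW.
have l1 : 1 <= l%:R :> R by rewrite ler1n.
have eN : N%:R = l%:R * (X%:R - 2 - a%:R) :> R.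
  rewrite /N natrM; congr (_ * _).
  rewrite (_ : X.-1 - a.+1 = X - (2 + a))%N; last by clear; lia.
  by rewrite natrB ?natrD; [ring|clear - hXn; lia].
have hG' : G%:R <= l%:R * G%:R :> R by rewrite ler_peMl.
have hmain : l%:R * (q * (X%:R - 2 - a%:R)) < l%:R * (E%:R + G%:R).
  rewrite natrM eN in hexp; lra.
rewrite ltr_pM2l in hmain; last by lra.
have /andP[_ hLk] := hLr k; rewrite -eX in hLk.
have eE : E%:R = (L k)%:R + a%:R + (2 * k)%:R + 8 :> R by rewrite /E -ea !natrD.
rewrite eE in hmain.
have p1 : 0 <= q * (2 * k)%:R by rewrite mulr_ge0 // ltW.
have p2 : 0 <= q * G%:R by rewrite mulr_ge0 // ltW.
have p3 : 0 <= q * N0%:R by rewrite mulr_ge0 // ltW.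
have p4 : 0 <= q * N1%:R by rewrite mulr_ge0 // ltW.
lra.
Qed.

Lemma coded_exponent : uniform_recurrence_exponent b x = r%:E.
Proof. by apply/eqP; rewrite eq_le coded_exponent_le coded_exponent_ge. Qed.

End CodedExponent.

(** * Lower bounds for Hausdorff measure *)
Section HoelderLower.
Context (R : realType).

(** The inverse of [phi] is Hoelder, so it maps covers of [A] to covers of the
    unit interval; this plays the part of the mass distribution principle. *)
Lemma hausdorff_measure_neq0 (phi : R -> R) (A : set R) (C s : R) : 0 < C -> 0 <= s ->
  (forall u, 0 <= u < 1 -> A (phi u)) ->
  (forall u v, 0 <= u < 1 -> 0 <= v < 1 ->
    `|u - v| <= C * `|phi u - phi v| `^ s) ->
  hausdorff_measure s A <> 0%E.
Proof.
move=> C0 s0 hA hphi h0.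
have h1 : (hausdorff_premeasure s 1 A < (4 * C)^-1%:E)%E.
  apply: (@le_lt_trans _ _ 0%E); last by rewrite lte_fin invr_gt0 mulr_gt0.
  by rewrite -h0; apply: ereal_sup_ubound; exists 1.
have [_ [U [hd hU ->]] hlt] := ereal_inf_lt h1.
have hfin i : U i !=set0 -> exists d : R, [/\ 0 <= d, diam (U i) = d%:E &
    diam_power s (U i) = (d `^ s)%:E].
  move=> [x Ux]; have := le_diam Ux Ux; have := hd i.
  rewrite subrr normr0 /diam_power; case: (diam (U i)) => [d| |] //=.
  rewrite !lee_fin => _ d0; exists d; split=> //.
  by case: eqP => // e; rewrite e in Ux.
have hex i : exists Ki : set R, [/\ measurable Ki,
    (lebesgue_measure Ki <= (2 * C)%:E * diam_power s (U i))%E &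
    forall u, 0 <= u < 1 -> U i (phi u) -> Ki u].
  have [[v [hv Uv]]|hno] := pselect (exists v, 0 <= v < 1 /\ U i (phi v)); last first.
    exists set0; split => //.
      by rewrite measure0 mule_ge0 ?diam_power_ge0 // lee_fin mulr_ge0 // ltW.
    by move=> u hu Uu; apply: hno; exists u.
  have [|d [d0 ed ep]] := hfin i; first by exists (phi v).
  have w0 : 0 <= C * d `^ s by rewrite mulr_ge0 ?powR_ge0 // ltW.
  exists `[v - C * d `^ s, v + C * d `^ s]%classic; split.
  - exact: measurable_itv.
  - rewrite ep (@lebesgue_measure_itv R `[v - C * d `^ s, v + C * d `^ s]) /= lte_fin.
    case: ifP => _; last by rewrite -EFinM lee_fin -mulrA mulr_ge0.
    by rewrite -EFinB -EFinM lee_fin; lra.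
  move=> u hu Uu /=; rewrite in_itv /= -ler_distl.
  apply: (le_trans (hphi u v hu hv)); apply: ler_wpM2l; first exact: ltW.
  apply: ge0_ler_powR; rewrite ?nnegrE //.
  by rewrite -lee_fin -ed; exact: le_diam.
have [K hK] := choice hex.
pose J : set R := `[0, 1[%classic.
have hcov : J `<=` \bigcup_i K i.
  move=> u; rewrite /J /=; rewrite in_itv /= => hu; have [i _ Ui] := hU _ (hA u hu).
  by exists i => //; have [_ _ h] := hK i; exact: h.
have h01 : lebesgue_measure J = 1%E.
  by rewrite (@lebesgue_measure_itv R `[0, 1[) /= lte_fin ltr01 oppr0 adde0.
have hsub : (lebesgue_measure J <=
    \sum_(0 <= i <oo) lebesgue_measure (K i))%E.
  apply: (@measure_sigma_subadditive _ _ _ (@lebesgue_measure R) J K _ _ hcov); last exact: measurable_itv.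
  by move=> i; have [] := hK i.
move: hsub; rewrite h01.
apply/negP; rewrite -ltNge.
apply: (@le_lt_trans _ _ (\sum_(0 <= i <oo) (2 * C)%:E * diam_power s (U i))%E).
  apply: lee_nneseries => [i _ _|i _]; first exact: measure_ge0.
  by have [] := hK i.
rewrite nneseriesZl; last by move=> i _; exact: diam_power_ge0.
apply: (@le_lt_trans _ _ ((2 * C)%:E * (4 * C)^-1%:E)%E).
  apply: lee_wpmul2l; first by rewrite lee_fin mulr_ge0 // ltW.
  exact: ltW.
rewrite -EFinM lte_fin invfM mulrACA divff ?gt_eqF // mulr1; lra.
Qed.

Lemma hausdorff_dim_lower (A : set R) (d : R) :
  (forall s, 0 <= s -> s < d -> hausdorff_measure s A <> 0%E) ->
  (d%:E <= hausdorff_dim A)%E.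
Proof.
move=> h; apply: le_ereal_inf_tmp => _ [s [s0 hs ->]]; rewrite lee_fin leNgt.
by apply/negP => /(h s s0).
Qed.

End HoelderLower.

Section Digits.
Context (R : realType) (M : nat) (hM : (1 < M)%N).
Local Notation T := (beta_transformation (M%:R : R)).

Let M1 : 1 < M%:R :> R. Proof. by rewrite ltr1n. Qed.

(** The digits of [u] in base [M], increased by [1] because the letter [0] is
    reserved for the runs. *)
Definition digit (u : R) (i : nat) : nat := (`|Num.floor (M%:R * iter i T u)|%N).+1.

Lemma digit_itv u i : 0 <= u < 1 -> (0 < digit u i <= M)%N.
Proof.
move=> hu; have /andP[h0 h1] := iter_itv M%:R i hu; rewrite /digit /=.
have M0 : 0 < M%:R :> R by exact: lt_trans M1.
have hf : 0 <= Num.floor (M%:R * iter i T u).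
  by rewrite floor_ge0 mulr_ge0 // ltW.
rewrite -ltz_nat gez0_abs // floor_lt_int.
by rewrite -pmulrn gtr_pMr.
Qed.

(** The digits are the itinerary of [u] under the transformation of base [M], so
    equal digits mean a common branch. *)
Lemma digit_agree u v c : 0 <= u < 1 -> 0 <= v < 1 ->
  (forall i, (i < c)%N -> digit u i = digit v i) ->
  `|u - v| <= (M%:R)^-1 ^+ c.
Proof.
move=> hu hv h; have M0 : 0 < M%:R :> R by exact: lt_trans M1.
have hlin : iter c T u - iter c T v = M%:R ^+ c * (u - v).
  elim: c h => [|c IH] h; first by rewrite expr0 mul1r.
  have e := h c (ltnSn c); rewrite !iterS /beta_transformation.
  have hf w : 0 <= w < 1 -> 0 <= Num.floor (M%:R * iter c T w).
    by move=> hw; rewrite floor_ge0 mulr_ge0 ?(ltW M0) //; case/andP: (iter_itv M%:R c hw).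
  have -> : Num.floor (M%:R * iter c T u) = Num.floor (M%:R * iter c T v).
    by rewrite -[LHS]gez0_abs ?hf // -[RHS]gez0_abs ?hf //; case: e => ->.
  have := IH (fun i hi => h i (ltnW hi)) => IH'.
  by rewrite exprS -mulrA -IH'; ring.
have := iter_itv M%:R c hu; have := iter_itv M%:R c hv => h1 h2.
have h3 : `|iter c T u - iter c T v| <= 1 by rewrite ler_norml; lra.
rewrite hlin normrM [X in X * _]gtr0_norm ?exprn_gt0 // in h3.
by rewrite exprVn -[leRHS]mul1r ler_pdivlMr ?exprn_gt0 // mulrC.
Qed.

Lemma digit_neq u v : 0 <= u < 1 -> 0 <= v < 1 -> u != v ->
  exists c, (forall i, (i < c)%N -> digit u i = digit v i) /\ digit u c != digit v c.
Proof.
move=> hu hv uv.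
have ex : exists c, digit u c != digit v c.
  apply: contrapT => hno.
  have d0 : 0 < `|u - v| by rewrite normr_gt0 subr_eq0.
  have [N hN] := @infty_decay _ M%:R M1 0 1 _ ltr01 d0.
  have := hN N (leqnn N); rewrite sub0r mul1r powRN powR_mulrn ?ler0n // -exprVn.
  rewrite ltNge digit_agree // => i _; apply/eqP.
  by apply: contrapT => /negP hne; apply: hno; exists i.
case: (ex_minnP ex) => c hc hmin; exists c; split=> // i ic; apply/eqP.
by apply: contraTT ic => /hmin; rewrite -leqNgt.
Qed.

End Digits.

Section CodedDimension.
Context (R : realType) (b : R) (hb : 1 < b) (l M : nat) (c0 : R) (val : nat -> R)
  (hA : alphabet b l M c0 val).
Context (n L : nat -> nat) (n0 : (0 < n 0)%N)
  (hn : forall k, (free_start n L k < n k.+1)%N).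
Local Notation B := (b ^+ l).

Definition embed (u : R) : R := code b l val (sequence_of n L (digit M u)).

(** If the digits of [u] and [v] first differ at rank [c], then [|u - v|] is at
    most [M^-c <= B^-(t c)], while the words first differ at the position [p] of
    that digit and the points are at least [B^-(p + 1)] apart.  The hypothesis
    on [C] compares [c] with [p] where this is worst, at the start of a free
    zone. *)
Lemma embed_hoelder (s t C : R) : 0 <= s -> s <= t -> B `^ t <= M%:R ->
  (forall k, s * ((free_start n L k)%:R + 1) <= t * (free_count n L k)%:R + C) ->
  exists2 C', 0 < C' & forall u v, 0 <= u < 1 -> 0 <= v < 1 ->
    `|u - v| <= C' * `|embed u - embed v| `^ s.
Proof.
move=> s0 st hBM hC; pose C2 := Num.max C s.
have b0 := base_gt0 hb; have hM := alphabet_M hA.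
have B0 : 0 < B by rewrite exprn_gt0.
have B1 : 1 <= B by apply: le_trans (alphabet_base hA); rewrite ler1n.
exists (B `^ C2); first by rewrite powR_gt0.
move=> u v hu hv; have [->|uv] := eqVneq u v.
  by rewrite subrr normr0 mulr_ge0 ?powR_ge0.
have [c [hc1 hc2]] := digit_neq hM hu hv uv.
have [p [hp1 hp2 hp3]] := first_difference n0 hn hc1 hc2.
have hw (w : R) : 0 <= w < 1 -> word M (sequence_of n L (digit M w)).
  move=> hw; apply: (sequence_word hA) => i; exact: digit_itv.
have hap := code_apart hb hA (hw u hu) (hw v hv) hp1 hp2.
have hexp : s * (p%:R + 1) <= t * c%:R + C2.
  case: hp3 => [[-> _]|[k [/andP[Dp _] ->]]].
    have : s <= C2 by rewrite le_max lexx orbT.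
    have : s * c%:R <= t * c%:R by apply: ler_wpM2r.
    lra.
  have h1 : C <= C2 by rewrite le_max lexx.
  have h2 : s * (p - free_start n L k)%:R <= t * (p - free_start n L k)%:R.
    by apply: ler_wpM2r.
  have h3 := hC k; have e : p%:R = (free_start n L k)%:R + (p - free_start n L k)%:R :> R.
    by rewrite -natrD subnKC.
  rewrite natrD e; lra.
apply: (le_trans (digit_agree hM hu hv hc1)).
have M0 : 0 < M%:R :> R by rewrite ltr0n ltnW.
apply: (@le_trans _ _ (B `^ (- (t * c%:R)))).
  rewrite exprVn powRN lef_pV2 ?posrE ?exprn_gt0 ?powR_gt0 //.
  rewrite powRrM powR_mulrn ?powR_ge0 //.
  by apply: lerXn2r; rewrite ?nnegrE ?powR_ge0 // ltW.
apply: (@le_trans _ _ (B `^ C2 * (B ^- p.+1) `^ s)).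
  have -> : (B ^- p.+1) `^ s = B `^ (- (s * (p%:R + 1))).
    rewrite -powR_mulrn ?(ltW B0) // -powRN -powRrM -natr1.
    by congr (_ `^ _); ring.
  rewrite -powRD ?(gt_eqF B0) ?implybT //.
  by apply: ler_powR => //; lra.
apply: ler_wpM2l; first exact: powR_ge0.
by apply: ge0_ler_powR; rewrite ?nnegrE ?invr_ge0 ?exprn_ge0 ?(ltW b0).
Qed.

End CodedDimension.

(** * Choice of the parameters and conclusion *)
Section ScaleChoice.
Context (R : realType).

(** The rounding errors in [n] and [L] and the runs of zeros add up to a quadratic
    polynomial in [k]. *)
Lemma quadratic_le_exp (g : R) : 0 < g ->
  exists C : R, forall k : nat, k%:R ^+ 2 + 10 * k%:R + 20 <= g * 2 ^+ k + C.
Proof.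
move=> g0; have l2 : 0 < ln 2 :> R by rewrite ln_gt0 // ltr1n.
pose h : R := ln 2 / 3; have h0 : 0 < h by rewrite divr_gt0.
pose Z := 31 / (g * h ^+ 3); have gh : 0 < g * h ^+ 3 by rewrite mulr_gt0 // exprn_gt0.
have Z0 : 0 < Z by rewrite divr_gt0.
have hk (k : nat) : (h * k%:R) ^+ 3 <= 2 ^+ k :> R.
  have -> : 2 ^+ k = expR (h * k%:R) ^+ 3 :> R.
    rewrite -expRM_natr /h -[X in X ^+ k]lnK ?posrE // -expRM_natr.
    by congr expR; field.
  have hk0 : 0 <= h * k%:R by rewrite mulr_ge0 // ltW.
  apply: lerXn2r; rewrite ?nnegrE ?expR_ge0 //.
  by apply: le_trans (expR_ge1Dx (h * k%:R)); rewrite lerDr.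
exists (31 + 31 * Z ^+ 2) => -[|k].
  rewrite expr0n /= mulr0 !add0r expr0 mulr1.
  have : 0 <= Z ^+ 2 by exact: sqr_ge0.
  lra.
set x : R := k.+1%:R; have x1 : 1 <= x by rewrite ler1n.
have h1 : x ^+ 2 + 10 * x + 20 <= 31 * x ^+ 2 by rewrite expr2; nra.
have h2 : g * (h * x) ^+ 3 <= g * 2 ^+ k.+1 by rewrite ler_pM2l // hk.
have h3 : 31 * x ^+ 2 <= g * (h * x) ^+ 3 + 31 * Z ^+ 2.
  have [xZ|Zx] := leP x Z.
    have : x ^+ 2 <= Z ^+ 2 by apply: lerXn2r; rewrite ?nnegrE ?(ltW Z0) //; lra.
    have : 0 <= g * (h * x) ^+ 3.
      by rewrite mulr_ge0 ?(ltW g0) // exprn_ge0 // mulr_ge0 ?(ltW h0) //; lra.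
    lra.
  have h4 : 31 <= g * h ^+ 3 * x by rewrite mulrC -ler_pdivrMr // ltW.
  have -> : g * (h * x) ^+ 3 = g * h ^+ 3 * x * x ^+ 2 by ring.
  have h5 : 31 * x ^+ 2 <= g * h ^+ 3 * x * x ^+ 2 by rewrite ler_wpM2r // sqr_ge0.
  have : 0 <= Z ^+ 2 by exact: sqr_ge0.
  lra.
lra.
Qed.

(** With [n k ~ 10 rho^k], [rho = 2 / (1 - r)], and [L k ~ r n_(k+1)], the
    fraction of free digits before the end of the [k]th copy tends to
    [((1 - r) / (1 + r))^2]; this value of [rho] maximizes it. *)
Lemma parameters_exist (r s t : R) : 0 <= r < 1 -> 0 <= s -> 0 < t <= 1 ->
  s < t * ((1 - r) / (1 + r)) ^+ 2 ->
  exists (n L : nat -> nat) (C : R),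
    [/\ (0 < n 0)%N, forall k, (free_start n L k < n k.+1)%N,
        forall k, (L k <= L k.+1)%N &
        forall k, r * (n k.+1)%:R <= (L k)%:R <= r * (n k.+1)%:R + 1] /\
    (forall (d C : R) (K : nat), 0 < d -> exists k j,
      [/\ (K <= k)%N, (2 * k + 5 <= (copy_end n L j).+1)%N &
        (copy_end n L j)%:R + (2 * k)%:R + C <= d * (n k.+1)%:R]) /\
    forall k, s * ((free_start n L k)%:R + 1) <= t * (free_count n L k)%:R + C.
Proof.
move=> hr s0 ht hs.
pose rho := 2 / (1 - r); pose q := (1 - r) / (1 + r).
have r1 : 0 < 1 - r by lra.
have r2 : 0 < 1 + r by lra.
have hrho2 : 2 <= rho by rewrite /rho ler_pdivlMr //; lra.
have hrho : rho = 2 + r * rho by rewrite /rho; field; rewrite gt_eqF.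
have hq : q * (1 + r * rho) = 1 by rewrite /q /rho; field; rewrite !gt_eqF.
have q0 : 0 < q by rewrite divr_gt0.
have q1 : q <= 1 by rewrite ler_pdivrMr //; lra.
have rr0 : 0 <= r * rho by rewrite mulr_ge0; lra.
have pk0 k : 0 < rho ^+ k by rewrite exprn_gt0 //; lra.
have p2k k : 2 ^+ k <= rho ^+ k.
  by apply: lerXn2r => //; rewrite nnegrE; lra.
have pk k : k%:R + 1 <= rho ^+ k.
  apply: le_trans (p2k k); rewrite natr1 -natrX ler_nat; exact: ltn_expl.
pose n k := (Num.truncn (10 * rho ^+ k)).+1.
pose L k := (Num.truncn (r * (n k.+1)%:R)).+1.
have hn k : 10 * rho ^+ k < (n k)%:R <= 10 * rho ^+ k + 1.
  have := truncn_itv (ltW (mulr_gt0 (ltr0n _ 10) (pk0 k))).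
  by rewrite /n -natr1; lra.
have hL k : r * (n k.+1)%:R < (L k)%:R <= r * (n k.+1)%:R + 1.
  have : 0 <= r * (n k.+1)%:R by rewrite mulr_ge0 //; case/andP: hr.
  by move/truncn_itv; rewrite /L -natr1; lra.
have n_mono k : (n k <= n k.+1)%N.
  rewrite ltnS le_truncn // ler_pM2l // exprS ler_peMl //; first exact: ltW.
  by lra.
clearbody n; clearbody L.
have hD k : (free_start n L k)%:R <= 10 * rho ^+ k * (1 + r * rho) + 2 * k%:R + 9.
  rewrite /free_start /copy_end 3!natrD natrM.
  have := hn k; have := hL k; have := hn k.+1; rewrite exprS.
  have : r * (n k.+1)%:R <= r * (10 * rho ^+ k.+1 + 1).
    by apply: ler_wpM2l; [case/andP: hr|case/andP: (hn k.+1)].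
  rewrite exprS; nra.
have hgap k : 10 * rho ^+ k - 2 * k%:R - 9 <= (n k.+1)%:R - (free_start n L k)%:R.
  have := hD k; have := hn k.+1; rewrite exprS {1 3}hrho; nra.
have hDn k : (free_start n L k < n k.+1)%N.
  rewrite -(ltr_nat R) -subr_gt0; apply: lt_le_trans (hgap k).
  have := pk k; have : 0 <= k%:R :> R by []. lra.
have hfc k : 10 * rho ^+ k * q - (10 * q + k%:R ^+ 2 + 8 * k%:R) <=
    (free_count n L k)%:R.
  elim: k => [|k IH].
    rewrite /= expr0; have := hn 0%N; rewrite expr0; lra.
  rewrite [free_count _ _ _]/= natrD natrB ?(ltnW (hDn k)) //.
  have := hgap k; rewrite -natr1 exprS.
  have : rho * rho ^+ k * q = rho ^+ k * q + rho ^+ k.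
    have -> : rho * rho ^+ k * q = rho ^+ k * (rho * q) by ring.
    have -> : rho * q = q + 1 by rewrite {1}hrho; lra.
    by ring.
  rewrite !expr2; lra.
have hst : s < t * q ^+ 2 by exact: hs.
pose g := t * q - s * (1 + r * rho).
have g0 : 0 < g.
  rewrite /g subr_gt0 -(ltr_pM2l q0) mulrCA hq mulr1.
  by rewrite (_ : q * (t * q) = t * q ^+ 2) //; ring.
have s1 : s <= 1.
  have : t * q ^+ 2 <= 1 by rewrite mulr_ile1 ?sqr_ge0 ?exprn_ile1 ?(ltW q0) //; lra.
  lra.
have [C hC] := @quadratic_le_exp (10 * g) (ltac:(lra)).
exists n, L, C; split; [split|split].
- by rewrite -(ltr_nat R); have := hn 0%N; rewrite expr0; lra.
- exact: hDn.
- move=> k; rewrite -ltnS -(ltr_nat R) -natr1.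
  have : r * (n k.+1)%:R <= r * (n k.+2)%:R.
    by apply: ler_wpM2l; [case/andP: hr|rewrite ler_nat].
  have := hL k; have := hL k.+1; lra.
- by move=> k; have := hL k; lra.
- move=> d C' K d0.
  pose j := maxn K (Num.truncn ((15 + `|C'|) / d)).
  have jK : (K <= j)%N by exact: leq_maxl.
  have hj : 15 + `|C'| <= d * rho ^+ j.
    rewrite -ler_pdivrMl // mulrC; apply: le_trans (pk j).
    apply: le_trans (ltW (truncnS_gt _)) _; rewrite natr1 ler_nat ltnS.
    exact: leq_maxr.
  clearbody j; exists (2 * j)%N, j; split.
  + by apply: leq_trans jK _; clear; lia.
  + have h : (10 * j.+1 <= n j)%N.
      rewrite -(ler_nat R) natrM -natr1; have := hn j; have := pk j; lra.
    by rewrite /copy_end; clear - h; lia.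
  have h1 : (copy_end n L j)%:R <= 10 * rho ^+ j.+1 + 1.
    apply: le_trans (andP (hn j.+1)).2; rewrite ler_nat.
    by apply: ltnW; apply: ltn_trans (hDn j); exact: A_lt_D.
  have p1 : 1 <= rho ^+ j.+1 by rewrite exprn_ege1 //; lra.
  have pj := pk j.+1; rewrite -natr1 in pj.
  have hC1 : C' <= `|C'| * rho ^+ j.+1.
    by apply: le_trans (ler_norm _) _; rewrite ler_peMr.
  have h2 : (15 + `|C'|) * rho ^+ j.+1 <= d * (10 * rho ^+ (2 * j).+1).
    have -> : d * (10 * rho ^+ (2 * j).+1) = 10 * (d * rho ^+ j * rho ^+ j.+1).
      rewrite (_ : (2 * j).+1 = j + j.+1)%N ?exprD; [by ring|clear; lia].
    have : (15 + `|C'|) * rho ^+ j.+1 <= d * rho ^+ j * rho ^+ j.+1.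
      by rewrite ler_pM2r.
    have : 0 <= (15 + `|C'|) * rho ^+ j.+1.
      by rewrite mulr_ge0 ?(ltW (pk0 _)) // addr_ge0.
    lra.
  have h3 : d * (10 * rho ^+ (2 * j).+1) <= d * (n (2 * j).+1)%:R.
    by rewrite ler_pM2l //; have := hn (2 * j).+1; lra.
  rewrite !natrM; lra.
move=> k; have hCk := hC k.
have h1 : s * ((free_start n L k)%:R + 1) <=
    s * (10 * rho ^+ k * (1 + r * rho) + 2 * k%:R + 10).
  by apply: ler_wpM2l => //; have := hD k; lra.
have h2 : t * (10 * rho ^+ k * q - (10 * q + k%:R ^+ 2 + 8 * k%:R)) <=
    t * (free_count n L k)%:R by rewrite ler_pM2l //; case/andP: ht.
have h3 : s * (2 * k%:R + 10) <= 2 * k%:R + 10.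
  by rewrite ler_piMl // addr_ge0 // mulr_ge0.
have h4 : t * (10 * q + k%:R ^+ 2 + 8 * k%:R) <= 10 + k%:R ^+ 2 + 8 * k%:R.
  have k2 : 0 <= k%:R ^+ 2 :> R by exact: sqr_ge0.
  have k1 : 0 <= k%:R :> R by [].
  apply: (@le_trans _ _ (10 * q + k%:R ^+ 2 + 8 * k%:R)); last by lra.
  by rewrite ler_piMl //; lra.
have h5 : 10 * g * 2 ^+ k <= 10 * g * rho ^+ k by rewrite ler_pM2l //; lra.
have h6 : 10 * g * rho ^+ k =
  t * (10 * rho ^+ k * q) - s * (10 * rho ^+ k * (1 + r * rho)) by rewrite /g; ring.
have h7 : s * (10 * rho ^+ k * (1 + r * rho) + 2 * k%:R + 10) =
  s * (10 * rho ^+ k * (1 + r * rho)) + s * (2 * k%:R + 10) by ring.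
lra.
Qed.

End ScaleChoice.

Section LowerBound.
Context (R : realType) (b : R) (hb : 1 < b).

(** Any [s] below the dimension leaves room for the loss [e] in the size of the
    alphabet. *)
Lemma hausdorff_dim_exponent_ge (r : R) : 0 <= r <= 1 ->
  ((((1 - r) / (1 + r)) ^+ 2)%:E <=
   hausdorff_dim [set x : R | (0 <= x < 1)%R /\
     uniform_recurrence_exponent b x = r%:E])%E.
Proof.
move=> hr; apply: hausdorff_dim_lower => s s0 hs.
set d := ((1 - r) / (1 + r)) ^+ 2 in hs.
have d0 : 0 < d by exact: le_lt_trans hs.
have r1 : r < 1.
  rewrite lt_neqAle; case/andP: hr => _ ->; rewrite andbT; apply/eqP => h.
  by move: d0; rewrite /d h subrr mul0r expr0n ltxx.
have d1 : d <= 1.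
  by rewrite /d exprn_ile1 ?divr_ge0 ?ler_pdivrMr //; lra.
(* chosen so that (1 - e) d is the mean of s and d *)
pose e := (d - s) / (2 * d).
have e0 : 0 < e by rewrite divr_gt0 ?subr_gt0 // mulr_gt0.
have e1 : e <= 2^-1.
  have d2 : 0 < 2 * d by rewrite mulr_gt0.
  by rewrite ler_pdivrMr // mulKf // gerBl.
have [l [M [c0 [val [hA hM]]]]] := @alphabet_exists _ b hb e (ltac:(lra)).
have hst : s < (1 - e) * d.
  have -> : (1 - e) * d = (d + s) / 2 by rewrite /e; field; rewrite gt_eqF.
  lra.
have [n [L [C [[n0 hn hL hLr] [hsp hcount]]]]] :=
  @parameters_exist R r s (1 - e) (ltac:(lra)) s0 (ltac:(lra)) hst.
have st : s <= 1 - e.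
  by apply: ltW; apply: lt_le_trans hst _; rewrite ler_piMr //; lra.
have [C' C'0 hC'] := embed_hoelder hb hA n0 hn s0 st hM hcount.
apply: (hausdorff_measure_neq0 C'0 s0 _ hC') => u hu.
have hdig i : (0 < digit M u i <= M)%N by apply: digit_itv => //; exact: alphabet_M hA.
split; first exact: (coded_itv hb hA n L hdig).
have r0 : 0 <= r by case/andP: hr.
exact: (coded_exponent hb hA n0 hn hL r0 hLr hsp hdig).
Qed.

End LowerBound.

Theorem theorem1p1 (R : realType) (beta : R) (hbeta : 1 < beta) :
  [/\ (@lebesgue_measure R).-negligible
        (`[0, 1[ `\` [set x : R | 0 <= x < 1 /\
                        uniform_recurrence_exponent beta x = 0%E]),
      forall r : \bar R, (1 < r <= +oo)%E ->
        countable [set x : R | 0 <= x < 1 /\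
                     (r <= uniform_recurrence_exponent beta x)%E]
    & forall r : R, 0 <= r <= 1 ->
        hausdorff_dim [set x : R | 0 <= x < 1 /\
                         (r%:E <= uniform_recurrence_exponent beta x)%E]
        = hausdorff_dim [set x : R | 0 <= x < 1 /\
                           uniform_recurrence_exponent beta x = r%:E] /\
        hausdorff_dim [set x : R | 0 <= x < 1 /\
                         uniform_recurrence_exponent beta x = r%:E]
        = (((1 - r) / (1 + r)) ^+ 2)%:E].
Proof.
split; first exact: exponent_null.
  by move=> r /andP[r1 _]; exact: countable_fast.
move=> r hr.
set E1 := [set x : R | _]; set E2 := [set x : R | _].
have E21 : E2 `<=` E1 by move=> x [hx h]; split=> //; rewrite h.
have hup := hausdorff_dim_upper hbeta hr.
have hlow := hausdorff_dim_exponent_ge hbeta hr.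
have hmono := hausdorff_dim_mono E21.
have e2 : hausdorff_dim E2 = (((1 - r) / (1 + r)) ^+ 2)%:E.
  by apply/eqP; rewrite eq_le hlow andbT (le_trans hmono).
split=> //; apply/eqP; rewrite eq_le hmono andbT e2; exact: hup.
Qed.
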